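(* Let $\mathcal{L}>0$. Any family of pairwise non-isomorphic leafless quantum graphs with minimum edge length $1$ and total edge length $\mathcal{L}$ that are pairwise isospectral for the standard Laplacian $\Delta_0$ has at most $e^{7\mathcal{L}\ln(\mathcal{L})}$ members. In particular, every family of pairwise non-isomorphic leafless quantum graphs that are pairwise isospectral for the standard Laplacian is finite.
   Context: Combinatorial graphs are finite; loops and multiple edges are allowed, and a loop contributes $2$ to the degree of its vertex. All graphs are assumed connected, without isolated vertices and without vertices of degree $2$. A graph is leafless if it has no vertex of degree $1$. A quantum graph $G$ is a combinatorial graph with vertex set $V$ and edge set $E$ together with a length function $L:E\to\mathbb{R}_{>0}$; each edge $e$ is identified with the interval $[0,L(e)]$. Two quantum graphs are isomorphic if there is a graph isomorphism between them preserving edge lengths. The total edge length is $\mathcal{L}=\sum_{e\in E}L(e)$. Convention: for the purposes of edge lengths, a loop of length $l$ is counted as two edges of length $l/2$; the minimum edge length is taken with this convention. The standard Laplacian $\Delta_0$ acts on each edge as $f\mapsto -f''$; its domain consists of all functions $f$ that are continuous on $G$, lie in the Sobolev space $W_2$ (closure of $C^2([0,L(e)])$ in the norm $\|f\|^2=\sum_{j=0}^2\int_0^{L(e)}|f^{(j)}|^2dx$) on each edge $e$, and satisfy the Kirchhoff condition $\sum_{e\sim v}\nu_{v,e}(f|_e)=0$ at every vertex $v$, where $\nu_{v,e}$ is the outward unit normal of the edge $e$ at $v$ (a loop at $v$ contributes at both of its ends). Two quantum graphs are isospectral for the standard Laplacian if the operators $\Delta_0$ have the same eigenvalues including multiplicities.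 *)

(* Defs.v *)
From HB Require Import structures.
From mathcomp Require Import all_boot all_order all_algebra.
From mathcomp Require Import all_classical all_reals all_analysis.
From mathcomp Require Import complex.
Import Order.TTheory GRing.Theory Num.Theory.
Import numFieldNormedType.Exports.

Set Implicit Arguments.
Unset Strict Implicit.
Unset Printing Implicit Defensive.

Local Open Scope classical_set_scope.
Local Open Scope ring_scope.

(* Each edge carries an arbitrary orientation, identifying it with [0, len e]
   so that 0 is src e and len e is tgt e; loops and multiple edges are allowed.
   The orientation is forgotten by qiso below. *)
Record qgraph (R : realType) := QGraph {
  vert : finType;
  edge : finType;
  src : edge -> vert;
  tgt : edge -> vert;
  len : edge -> R;
  deg (v : vert) : nat :=
    (#|[pred e | src e == v]| + #|[pred e | tgt e == v]|)%N;
  adj (v w : vert) : bool :=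
    [exists e, ((src e == v) && (tgt e == w)) || ((src e == w) && (tgt e == v))];
  len_gt0 : forall e, 0 < len e;
  vert_gt0 : (0 < #|vert|)%N;
  adj_connected : forall v w, connect adj v w;
  deg_neq0 : forall v, deg v != 0%N;
  deg_neq2 : forall v, deg v != 2%N }.

Definition leafless (R : realType) (G : qgraph R) : Prop :=
  forall v : vert G, deg v != 1%N.

Definition qiso (R : realType) (G H : qgraph R) : Prop :=
  exists (fv : vert G -> vert H) (fe : edge G -> edge H),
    [/\ bijective fv, bijective fe,
        forall e, (src (fe e) = fv (src e) /\ tgt (fe e) = fv (tgt e)) \/
                  (src (fe e) = fv (tgt e) /\ tgt (fe e) = fv (src e)) &
        forall e, len (fe e) = len e].

Definition total_length (R : realType) (G : qgraph R) : R :=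
  \sum_(e : edge G) len e.

(* A loop of length l counts as two edges of length l / 2. *)
Definition counted_len (R : realType) (G : qgraph R) (e : edge G) : R :=
  if src e == tgt e then len e / 2 else len e.

Definition min_edge_length (R : realType) (G : qgraph R) (m : R) : Prop :=
  (forall e : edge G, m <= counted_len e) /\
  (exists e : edge G, counted_len e = m).

(* Topological, differential and measure-theoretic properties of
   complex-valued functions are imposed on the real and imaginary parts. *)
Definition on_parts (R : realType) (P : (R -> R) -> Prop) (f : R -> R[i]) :
    Prop :=
  P (fun x => complex.Re (f x)) /\ P (fun x => complex.Im (f x)).

Definition cderiv (R : realType) (n : nat) (f : R -> R[i]) (x : R) : R[i] :=
  (derive1n n (fun y => complex.Re (f y)) x +i*
   derive1n n (fun y => complex.Im (f y)) x)%C.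

(* C^2([0, l]) is the set of restrictions to [0, l] of such functions. *)
Definition C2 (R : realType) (f : R -> R) : Prop :=
  [/\ forall x, derivable f x 1, forall x, derivable (derive1n 1 f) x 1 &
      continuous (derive1n 2 f)].

Definition L2_sqnorm (R : realType) (l : R) (f : R -> R[i]) : \bar R :=
  (\int[lebesgue_measure]_(x in `[0%R, l])
     ((complex.Re (f x)) ^+ 2 + (complex.Im (f x)) ^+ 2)%:E)%E.

Definition W2_sqnorm (R : realType) (l : R) (f0 f1 f2 : R -> R[i]) : \bar R :=
  (L2_sqnorm l f0 + L2_sqnorm l f1 + L2_sqnorm l f2)%E.

(* f belongs to the closure W_2 of C^2([0, l]), and (representatives of) its
   derivatives in W_2 are f1 and f2.  Measurability has to be required because
   the library's integral of a non-measurable function is only a lower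
   integral. *)
Definition in_W2 (R : realType) (l : R) (f f1 f2 : R -> R[i]) : Prop :=
  [/\ on_parts (measurable_fun `[0, l]) f,
      on_parts (measurable_fun `[0, l]) f1,
      on_parts (measurable_fun `[0, l]) f2 &
      exists phi : nat -> R -> R[i],
        (forall n, on_parts (@C2 R) (phi n)) /\
        (fun n => W2_sqnorm l (fun x => phi n x - f x)
                              (fun x => cderiv 1 (phi n) x - f1 x)
                              (fun x => cderiv 2 (phi n) x - f2 x))
          @ \oo --> 0%E].

(* Functions on G; only the values f e x with 0 <= x <= len e are meaningful. *)
Definition gfun (R : realType) (G : qgraph R) : Type := edge G -> R -> R[i].

Definition geq (R : realType) (G : qgraph R) (f g : gfun G) : Prop :=
  forall e x, 0 <= x <= len e -> f e x = g e x.

Definition gcontinuous (R : realType) (G : qgraph R) (f : gfun G) : Prop :=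
  (forall e : edge G,
     on_parts (fun h => {within `[0, len e], continuous h}) (f e)) /\
  exists fv : vert G -> R[i],
    forall e : edge G, f e 0 = fv (src e) /\ f e (len e) = fv (tgt e).

(* Sum of the outward derivatives at each vertex, f1 e being the derivative on
   e: the outward direction is -d/dx at x = 0 and d/dx at x = len e. *)
Definition kirchhoff (R : realType) (G : qgraph R) (f1 : gfun G) : Prop :=
  forall v : vert G,
    \sum_(e : edge G | src e == v) - f1 e 0 +
    \sum_(e : edge G | tgt e == v) f1 e (len e) = 0.

(* f is in the domain of Delta_0 and Delta_0 f = g.  The boundary values of the
   derivative are those of its continuous representative f1, which exists for
   every element of W_2 by Sobolev embedding. *)
Definition std_laplacian (R : realType) (G : qgraph R) (f g : gfun G) : Prop :=
  exists f1 f2 : gfun G,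
    [/\ gcontinuous f,
        forall e, in_W2 (len e) (f e) (f1 e) (f2 e),
        forall e, on_parts (fun h => {within `[0, len e], continuous h}) (f1 e),
        kirchhoff f1 &
        forall e, {ae lebesgue_measure,
                     forall x : R, 0 <= x <= len e -> g e x = - f2 e x}].

Definition eigenfun (R : realType) (G : qgraph R) (a : R[i]) (f : gfun G) :
    Prop :=
  std_laplacian f (fun e x => a * f e x).

Definition lincomb (R : realType) (G : qgraph R) (n : nat)
    (c : 'I_n -> R[i]) (b : 'I_n -> gfun G) : gfun G :=
  fun e x => \sum_(i < n) c i * b i e x.

(* The a-eigenspace has a basis of n elements; n = 0 means that a is not an
   eigenvalue. *)
Definition multiplicity (R : realType) (G : qgraph R) (a : R[i]) (n : nat) :
    Prop :=
  exists b : 'I_n -> gfun G,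
    [/\ forall i, eigenfun a (b i),
        forall c, geq (lincomb c b) (fun _ _ => 0) -> forall i, c i = 0 &
        forall f, eigenfun a f -> exists c, geq f (lincomb c b)].

Definition isospectral (R : realType) (G H : qgraph R) : Prop :=
  forall (a : R[i]) (n : nat), multiplicity G a n <-> multiplicity H a n.

(* Main.v *)
Require Import Defs.
From HB Require Import structures.
From mathcomp Require Import all_boot all_order all_algebra all_fingroup.
From mathcomp Require Import all_classical all_reals all_analysis.
From mathcomp Require Import measurable_realfun complex ring lra zify.
Import Order.TTheory GRing.Theory Num.Theory.
Import numFieldNormedType.Exports.

(** A function on a leafless graph [G] is an eigenfunction for [k ^ 2], [k > 0],
    exactly when it consists of two opposite waves on every edge whose
    amplitudes, a vector [a] indexed by the oriented edges (bonds), satisfy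
    [a = a U(k)].  Here [U(z) = D(z) S], where [D(z)] is the diagonal matrix of
    the phases [e ^ (i z len b)] and [S] the orthogonal matrix of the vertex
    scattering amplitudes.  The multiplicity of [k ^ 2] is therefore the
    dimension of the kernel of [1 - U(k)] ([multiplicity_kernel]), which is also
    the order of the zero of the secular determinant [F(z) = det (1 - U(z))] at
    [k] ([secular_local]).

    The determinant [F] is an exponential sum with real coefficients, and it is
    determined by its zeros on the positive half-line alone
    ([coef_eq_of_kernels]).  For suppose that [F] and [H] have the same positive
    zeros and differ, and let [s] be the least frequency at which their
    coefficients differ.  Then [g(z) = (F(z) - H(z)) / H(z) e ^ (- i s z)] has
    removable singularities on the positive half-line, tends to a nonzero number
    for [Im z] to [+oo] and, if [F] is the one with the smaller total length, to
    [0] for [Im z] to [-oo].  Integrating [g] along two long horizontal segments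
    at large opposite heights contradicts Cauchy's theorem ([no_gap]).

    Expanding the determinant, [F] is the sum over the configurations, that is
    the pairs of a set [A] of bonds and a permutation [s] supported by it whose
    cycles are closed walks in [G]; the frequency is the total length of [A].
    Suppose that the lengths of the edges in a set [K] are known, and consider
    the shortest configurations that use an edge outside [K].  Each of them is a
    single closed walk ([shortest_cycle]) which either goes back and forth along
    one edge or never reverses its direction ([shortest_reversal]).  As all the
    degrees are at least 3, the amplitudes of reversals are negative and the
    others positive, and it follows that all these configurations have negative
    weight ([shortest_weight]).  They do not cancel, so the spectrum and the
    lengths in [K] determine their common length.  Moreover, one of them uses
    only one edge [e] outside [K] ([next_edge]), and the length of [e] follows
    ([length_step]).

    Repeating this, one discovers the edges in an order along which the spectrum
    and the incidences determine the lengths.  Thus two isospectral graphs whose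
    edges, in such orders, join equally labelled vertices are isomorphic
    ([code_qiso]), and the size of an isospectral family is at most the number
    of codes: with at most [M] edges, hence at most [M] vertices, it is
    [(M ^ 2 + 1) ^ M].  If the minimal length is 1 then [M] may be taken to be
    the integer part of the total length, and this is the bound claimed.  In
    general the spectrum determines the total length and the least frequency of
    [F], which bounds the lengths from below, and so it bounds the number of
    edges ([isospectral_edges]). *)

Set Implicit Arguments.
Unset Strict Implicit.
Unset Printing Implicit Defensive.

Local Open Scope classical_set_scope.
Local Open Scope ring_scope.

Local Notation Re := (@complex.Re _).
Local Notation Im := (@complex.Im _).

(** * Complex numbers and holomorphic functions *)
Notation cmod := ComplexField.Normc.normc.

Section Holomorphic.
Context {R : realType}.
Local Notation C := R[i].
Implicit Types (f g : C -> C) (z c d : C).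

Lemma Re_add z c : Re (z + c) = Re z + Re c. Proof. by case: z c => ? ? []. Qed.
Lemma Im_add z c : Im (z + c) = Im z + Im c. Proof. by case: z c => ? ? []. Qed.
Lemma Re_opp z : Re (- z) = - Re z. Proof. by case: z. Qed.
Lemma Im_opp z : Im (- z) = - Im z. Proof. by case: z. Qed.
Lemma Re_mul z c : Re (z * c) = Re z * Re c - Im z * Im c.
Proof. by case: z c => ? ? []. Qed.
Lemma Im_mul z c : Im (z * c) = Re z * Im c + Im z * Re c.
Proof. by case: z c => ? ? []. Qed.
Definition sqmod z := Re z ^+ 2 + Im z ^+ 2.
Lemma Re_inv z : Re z^-1 = Re z * (sqmod z)^-1. Proof. by case: z. Qed.
Lemma Im_inv z : Im z^-1 = - (Im z * (sqmod z)^-1). Proof. by case: z. Qed.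
Lemma Im_sum (I : Type) (r : seq I) (P : pred I) (F : I -> C) :
  Im (\sum_(i <- r | P i) F i) = \sum_(i <- r | P i) Im (F i).
Proof. by apply: (big_morph Im Im_add). Qed.
Lemma complex_ext z c : Re z = Re c -> Im z = Im c -> z = c.
Proof. by case: z c => ? ? [? ?] /= -> ->. Qed.
Lemma sqmod_gt0 z : z != 0 -> 0 < sqmod z.
Proof.
move=> z0; rewrite /sqmod lt_neqAle addr_ge0 ?sqr_ge0// andbT eq_sym.
rewrite paddr_eq0 ?sqr_ge0// !sqrf_eq0; apply: contra z0 => /andP[/eqP a /eqP b].
by apply/eqP/complex_ext.
Qed.
Lemma cmodE z : cmod z = Num.sqrt (sqmod z). Proof. by case: z. Qed.
Lemma cmod_ge0 z : 0 <= cmod z. Proof. by rewrite cmodE sqrtr_ge0. Qed.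
Lemma cmod_sqr z : cmod z ^+ 2 = sqmod z.
Proof. by rewrite cmodE sqr_sqrtr// addr_ge0 ?sqr_ge0. Qed.
Lemma cmod0 : cmod (0 : C) = 0. Proof. exact: ComplexField.Normc.normc0. Qed.
Lemma cmod1 : cmod (1 : C) = 1. Proof. exact: ComplexField.Normc.normc1. Qed.
Lemma cmodM z c : cmod (z * c) = cmod z * cmod c.
Proof. exact: ComplexField.Normc.normcM. Qed.
Lemma cmodV z : cmod z^-1 = (cmod z)^-1. Proof. exact: ComplexField.Normc.normcV. Qed.
Lemma cmodD z c : cmod (z + c) <= cmod z + cmod c. Proof. exact: le_normcD. Qed.
Lemma cmodN z : cmod (- z) = cmod z. Proof. exact: normcN. Qed.
Lemma cmodX z n : cmod (z ^+ n) = cmod z ^+ n.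
Proof. by elim: n => [|n IH]; rewrite ?cmod1// !exprS cmodM IH. Qed.
Lemma cmodC z c : cmod (z - c) = cmod (c - z). Proof. by rewrite -cmodN opprB. Qed.
Lemma cmod_prod (I : Type) (r : seq I) (P : pred I) (F : I -> C) :
  cmod (\prod_(i <- r | P i) F i) = \prod_(i <- r | P i) cmod (F i).
Proof.
elim/big_rec2: _ => [|i a b _ <-]; first exact: cmod1.
exact: cmodM.
Qed.
Lemma cmod_sum (I : Type) (r : seq I) (P : pred I) (F : I -> C) :
  cmod (\sum_(i <- r | P i) F i) <= \sum_(i <- r | P i) cmod (F i).
Proof.
elim/big_ind2: _ => //; first by rewrite cmod0.
by move=> a b c d h1 h2; apply: le_trans (cmodD _ _) (lerD h1 h2).
Qed.
Lemma cmod_eq0 z : (cmod z == 0) = (z == 0).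
Proof.
apply/eqP/eqP => [|->]; last exact: cmod0.
exact: ComplexField.Normc.eq0_normc.
Qed.
Lemma cmod_gt0 z : (0 < cmod z) = (z != 0).
Proof. by rewrite lt_neqAle cmod_ge0 andbT eq_sym cmod_eq0. Qed.
Lemma cmod_real (a : R) : cmod a%:C%C = `|a|.
Proof. by rewrite cmodE /sqmod /= expr0n /= addr0 sqrtr_sqr. Qed.
Lemma le_Re_cmod z : `|Re z| <= cmod z.
Proof.
by rewrite cmodE -sqrtr_sqr ler_wsqrtr// /sqmod lerDl sqr_ge0.
Qed.
Lemma le_Im_cmod z : `|Im z| <= cmod z.
Proof.
by rewrite cmodE -sqrtr_sqr ler_wsqrtr// /sqmod lerDr sqr_ge0.
Qed.
Lemma cmodB_ge z c : cmod z - cmod c <= cmod (z - c).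
Proof. by rewrite lerBlDr; apply: le_trans (cmodD _ _); rewrite subrK. Qed.
Lemma cmod_le z : cmod z <= `|Re z| + `|Im z|.
Proof.
rewrite -ler_sqr ?nnegrE ?addr_ge0 ?cmod_ge0//.
rewrite cmod_sqr /sqmod sqrrD !real_normK ?num_real// [leRHS]addrAC lerDl.
by rewrite mulrn_wge0 // mulr_ge0.
Qed.
Lemma Re_real_mul (a : R) z : Re (a%:C%C * z) = a * Re z.
Proof. by rewrite Re_mul /= mul0r subr0. Qed.

Lemma is_dE (u : R -> R) (x a b : R) :
  is_derive x (1 : R) u a -> a = b -> is_derive x (1 : R) u b.
Proof. by move=> + <-. Qed.

Lemma is_dD (u v : R -> R) (x a b : R) :
  is_derive x (1 : R) u a -> is_derive x (1 : R) v b ->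
  is_derive x (1 : R) (fun t => u t + v t) (a + b).
Proof. move=> hu hv; exact: (@is_deriveD _ _ _ u v). Qed.

Lemma is_dB (u v : R -> R) (x a b : R) :
  is_derive x (1 : R) u a -> is_derive x (1 : R) v b ->
  is_derive x (1 : R) (fun t => u t - v t) (a - b).
Proof. move=> hu hv; exact: (@is_deriveB _ _ _ u v). Qed.

Lemma is_dM (u v : R -> R) (x a b : R) :
  is_derive x (1 : R) u a -> is_derive x (1 : R) v b ->
  is_derive x (1 : R) (fun t => u t * v t) (u x * b + v x * a).
Proof. move=> hu hv; exact: (@is_deriveM _ _ u v). Qed.

Lemma is_dN (u : R -> R) (x a : R) :
  is_derive x (1 : R) u a -> is_derive x (1 : R) (fun t => - u t) (- a).
Proof. move=> hu; exact: (@is_deriveN _ _ _ u). Qed.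

Lemma is_dV (u : R -> R) (x a : R) : u x != 0 ->
  is_derive x (1 : R) u a -> is_derive x (1 : R) (fun t => (u t)^-1) (- (u x) ^- 2 * a).
Proof. move=> u0 hu; exact: (@is_deriveV _ u x a 1 u0 hu). Qed.

(** [hol f z c]: at [z] the partial derivatives of [f] exist and satisfy the
    Cauchy-Riemann equations with complex derivative [c].  Only the partial
    derivatives are asked for, so that the mean value theorem of one real
    variable applies directly. *)
Definition hol f z c : Prop :=
  [/\ is_derive (Re z) (1 : R) (fun t : R => Re (f (t +i* Im z)%C)) (Re c),
      is_derive (Re z) (1 : R) (fun t : R => Im (f (t +i* Im z)%C)) (Im c),
      is_derive (Im z) (1 : R) (fun t : R => Re (f (Re z +i* t)%C)) (- Im c) &
      is_derive (Im z) (1 : R) (fun t : R => Im (f (Re z +i* t)%C)) (Re c)].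

Lemma hol_eq f z c d : hol f z c -> c = d -> hol f z d. Proof. by move=> + <-. Qed.

Lemma eta_complex z : (Re z +i* Im z)%C = z. Proof. by case: z. Qed.

Lemma hol_cst a z : hol (fun=> a) z 0.
Proof. by split; rewrite /= ?oppr0; exact: is_derive_cst. Qed.

Lemma hol_id z : hol id z 1.
Proof. by split; rewrite /= ?oppr0; do [exact: is_derive_id|exact: is_derive_cst]. Qed.

Lemma hol_add f g z c d : hol f z c -> hol g z d ->
  hol (fun w => f w + g w) z (c + d).
Proof.
move=> [f1 f2 f3 f4] [g1 g2 g3 g4]; split.
- by under eq_fun do rewrite Re_add; rewrite Re_add; exact: is_dD.
- by under eq_fun do rewrite Im_add; rewrite Im_add; exact: is_dD.
- by under eq_fun do rewrite Re_add; rewrite Im_add opprD; exact: is_dD.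
- by under eq_fun do rewrite Im_add; rewrite Re_add; exact: is_dD.
Qed.

Lemma hol_mul f g z c d : hol f z c -> hol g z d ->
  hol (fun w => f w * g w) z (c * g z + f z * d).
Proof.
move=> [f1 f2 f3 f4] [g1 g2 g3 g4]; split.
- under eq_fun do rewrite Re_mul.
  apply: (is_dE (is_dB (is_dM f1 g1) (is_dM f2 g2))).
  by rewrite /= /GRing.scale /= !eta_complex Re_add !Re_mul; ring.
- under eq_fun do rewrite Im_mul.
  apply: (is_dE (is_dD (is_dM f1 g2) (is_dM f2 g1))).
  by rewrite /= /GRing.scale /= !eta_complex Im_add !Im_mul; ring.
- under eq_fun do rewrite Re_mul.
  apply: (is_dE (is_dB (is_dM f3 g3) (is_dM f4 g4))).
  by rewrite /= /GRing.scale /= !eta_complex Im_add !Im_mul; ring.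
- under eq_fun do rewrite Im_mul.
  apply: (is_dE (is_dD (is_dM f3 g4) (is_dM f4 g3))).
  by rewrite /= /GRing.scale /= !eta_complex Re_add !Re_mul; ring.
Qed.

Lemma is_derive_sqmod (u v : R -> R) (x a b : R) :
  is_derive x (1 : R) u a -> is_derive x (1 : R) v b -> u x ^+ 2 + v x ^+ 2 != 0 ->
  is_derive x (1 : R) (fun t => (u t ^+ 2 + v t ^+ 2)^-1)
    (- (u x ^+ 2 + v x ^+ 2) ^- 2 * (2 * (u x * a + v x * b))).
Proof.
move=> hu hv n0.
have -> : (fun t => (u t ^+ 2 + v t ^+ 2)^-1) = (fun t => (u t * u t + v t * v t)^-1).
  by apply: funext => t; rewrite -!expr2.
have n0' : u x * u x + v x * v x != 0 by rewrite -!expr2.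
have hd := is_dD (is_dM hu hu) (is_dM hv hv).
have := @is_dV (fun t => u t * u t + v t * v t) x _ n0' hd => /is_dE; apply.
by rewrite /GRing.scale /= -!expr2; ring.
Qed.

Lemma hol_inv f z c : hol f z c -> f z != 0 ->
  hol (fun w => (f w)^-1) z (- c * (f z)^-1 ^+ 2).
Proof.
move=> [f1 f2 f3 f4] fz0; have n0 := sqmod_gt0 fz0.
have n0' : Re (f z) ^+ 2 + Im (f z) ^+ 2 != 0 by rewrite gt_eqF.
have h1 := is_derive_sqmod f1 f2; have h2 := is_derive_sqmod f3 f4.
rewrite !eta_complex in h1 h2; move: (h1 n0') (h2 n0') => {}h1 {}h2.
split.
- under eq_fun do rewrite Re_inv.
  apply: (is_dE (is_dM f1 h1)).
  rewrite /= /GRing.scale /= !eta_complex expr2 !(Re_mul, Im_mul) Re_inv Im_inv.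
  by rewrite Re_opp Im_opp /sqmod; field.
- under eq_fun do rewrite Im_inv.
  apply: (is_dE (is_dN (is_dM f2 h1))).
  rewrite /= /GRing.scale /= !eta_complex expr2 !(Re_mul, Im_mul) Re_inv Im_inv.
  by rewrite Re_opp Im_opp /sqmod; field.
- under eq_fun do rewrite Re_inv.
  apply: (is_dE (is_dM f3 h2)).
  rewrite /= /GRing.scale /= !eta_complex expr2 !(Re_mul, Im_mul) Re_inv Im_inv.
  by rewrite Re_opp Im_opp /sqmod; field.
- under eq_fun do rewrite Im_inv.
  apply: (is_dE (is_dN (is_dM f4 h2))).
  rewrite /= /GRing.scale /= !eta_complex expr2 !(Re_mul, Im_mul) Re_inv Im_inv.
  by rewrite Re_opp Im_opp /sqmod; field.
Qed.

(** The function [z |-> e^{i l z}]. *)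
Definition wave (l : R) z : C :=
  (expR (- (l * Im z)) * cos (l * Re z) +i* (expR (- (l * Im z)) * sin (l * Re z)))%C.

Lemma is_derive_linear (a x : R) : is_derive x (1 : R) (fun t => a * t) a.
Proof.
apply: (is_dE (is_deriveZ a (is_derive_id x (1 : R)))).
by rewrite /GRing.scale /= mulr1.
Qed.

Lemma hol_wave l z : hol (wave l) z ((l *i)%C * wave l z).
Proof.
have hc : is_derive (Re z) (1 : R) (fun t => cos (l * t)) (- l * sin (l * Re z)).
  apply: (is_dE (@is_derive1_comp _ cos (fun t => l * t) _ _ _ (is_derive_cos _) (is_derive_linear l _))).
  by rewrite mulrC mulrN mulNr.
have hs : is_derive (Re z) (1 : R) (fun t => sin (l * t)) (l * cos (l * Re z)).
  apply: (is_dE (@is_derive1_comp _ sin (fun t => l * t) _ _ _ (is_derive_sin _) (is_derive_linear l _))).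
  by rewrite mulrC.
have he : is_derive (Im z) (1 : R) (fun t => expR (- (l * t))) (- l * expR (- (l * Im z))).
  apply: (is_dE (@is_derive1_comp _ expR (fun t => - (l * t)) _ _ _ (is_derive_expR _)
      (is_dN (is_derive_linear l _)))).
  by rewrite mulrC.
have cst x a : is_derive x (1 : R) (fun=> a) (0 : R) by exact: is_derive_cst.
split; rewrite /wave /=.
- apply: (is_dE (is_dM (cst _ (expR (- (l * Im z)))) hc)).
  by rewrite /GRing.scale /=; ring.
- apply: (is_dE (is_dM (cst _ (expR (- (l * Im z)))) hs)).
  by rewrite /GRing.scale /=; ring.
- apply: (is_dE (is_dM he (cst _ (cos (l * Re z))))).
  by rewrite /GRing.scale /=; ring.
- apply: (is_dE (is_dM he (cst _ (sin (l * Re z))))).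
  by rewrite /GRing.scale /=; ring.
Qed.

Lemma cmod_wave l z : cmod (wave l z) = expR (- (l * Im z)).
Proof.
rewrite cmodE /sqmod /wave /=.
have -> (a b c : R) : (a * b) ^+ 2 + (a * c) ^+ 2 = a ^+ 2 * (b ^+ 2 + c ^+ 2) by ring.
rewrite cos2Dsin2 mulr1.
by rewrite sqrtr_sqr ger0_norm// expR_ge0.
Qed.

Lemma waveD l m z : wave (l + m) z = wave l z * wave m z.
Proof.
apply: complex_ext; rewrite /= mulrDl opprD expRD mulrDl ?cosD ?sinD; ring.
Qed.

Lemma wave0 z : wave 0 z = 1.
Proof. by apply: complex_ext; rewrite /= !mul0r oppr0 expR0 ?cos0 ?sin0 ?mulr1 ?mulr0. Qed.

Lemma waveZ l z w : wave l (z + w) = wave l z * wave l w.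
Proof.
apply: complex_ext; rewrite /= ?Re_add ?Im_add mulrDr opprD expRD mulrDr ?cosD ?sinD; ring.
Qed.

Lemma waveN l z : wave l z * wave l (- z) = 1.
Proof.
rewrite -waveZ subrr; apply: complex_ext;
by rewrite /= !mulr0 oppr0 expR0 ?cos0 ?sin0 ?mulr0 ?mulr1.
Qed.

Lemma wave_sum (I : Type) (r : seq I) (P : pred I) (F : I -> R) z :
  wave (\sum_(i <- r | P i) F i) z = \prod_(i <- r | P i) wave (F i) z.
Proof.
by apply: (big_morph (fun l => wave l z)); [move=> a b; exact: waveD|exact: wave0].
Qed.

End Holomorphic.

(** * Riemann sums at two heights *)
Section Cauchy.
Context {R : realType}.
Local Notation C := R[i].
Implicit Types (f g : C -> C) (z c d : C).

Lemma is_d_sum (I : Type) (r : seq I) (u : I -> R -> R) (x : R) (a : I -> R) :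
  (forall i, is_derive x (1 : R) (u i) (a i)) ->
  is_derive x (1 : R) (fun t => \sum_(i <- r) u i t) (\sum_(i <- r) a i).
Proof.
move=> h; elim: r => [|i r IH].
  by under eq_fun do rewrite big_nil; rewrite big_nil; exact: is_derive_cst.
by under eq_fun do rewrite big_cons; rewrite big_cons; exact: is_dD.
Qed.

Lemma mvt (u du : R -> R) (a b : R) : a <= b ->
  (forall x, a <= x <= b -> is_derive x (1 : R) u (du x)) ->
  exists2 c, a <= c <= b & u b - u a = du c * (b - a).
Proof.
move=> ab h; have [|||c cab e] := @MVT_segment R u du a b => //.
- by move=> x; rewrite in_itv /= => /andP[h1 h2]; apply: h; rewrite !ltW.
- apply: derivable_within_continuous => x; rewrite in_itv /= => hx.
  by have hd := h x hx; exact: (@ex_derive _ _ _ _ _ _ _ hd).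
- by exists c => //; move: cab; rewrite in_itv.
Qed.

Definition rect (a b y1 y2 : R) z := (a <= Re z <= b) && (y1 <= Im z <= y2).

Definition riemann_sum (f : C -> C) (a T : R) (n : nat) (y : R) : R :=
  T / n%:R * \sum_(j < n) Re (f ((a + j%:R * (T / n%:R)) +i* y)%C).

(** A discrete Cauchy theorem.  By the Cauchy-Riemann equations the derivative
    of the horizontal Riemann sum in the height [y] is a Riemann sum of
    [- d/dx Im f], which telescopes up to an error of second order. *)
Lemma riemann_sum_height f f' f'' (a T y1 y2 M B : R) (n : nat) :
  0 <= T -> y1 <= y2 -> (0 < n)%N ->
  (forall z, rect a (a + T) y1 y2 z ->
     [/\ hol f z (f' z), hol f' z (f'' z) & cmod (f'' z) <= M]) ->
  (forall y, y1 <= y <= y2 ->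
     `|Im (f ((a + T) +i* y)%C) - Im (f (a +i* y)%C)| <= B) ->
  `|riemann_sum f a T n y2 - riemann_sum f a T n y1|
    <= (y2 - y1) * (B + M * T ^+ 2 / n%:R).
Proof.
move=> T0 y12 n0 hf hB.
have n0' : (0 : R) < n%:R by rewrite ltr0n.
set h := T / n%:R; have h0 : 0 <= h by rewrite divr_ge0// ltW.
pose x (j : nat) := a + j%:R * h.
have nh : n%:R * h = T by rewrite /h mulrC divfK// gt_eqF.
have xin (j : nat) : (j <= n)%N -> a <= x j <= a + T.
  move=> jn; rewrite /x lerDl mulr_ge0 ?ler0n//= lerD2l -nh.
  by rewrite ler_wpM2r// ler_nat.
have inrect (j : nat) y : (j <= n)%N -> y1 <= y <= y2 ->
    rect a (a + T) y1 y2 (x j +i* y)%C.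
  by move=> jn hy; rewrite /rect /= xin.
have [c hc ->] : exists2 c, y1 <= c <= y2 &
   riemann_sum f a T n y2 - riemann_sum f a T n y1 =
   (h * \sum_(j < n) - Im (f' (x j +i* c)%C)) * (y2 - y1).
  apply: mvt => // y hy; rewrite /riemann_sum.
  have hs : is_derive y (1 : R) (fun y => \sum_(j < n) Re (f (x j +i* y)%C))
      (\sum_(j < n) - Im (f' (x j +i* y)%C)).
    apply: is_d_sum => j.
    by have [[]] := hf _ (inrect _ _ (ltnW (ltn_ord j)) hy).
  apply: (is_dE (is_dM (is_derive_cst h y (1 : R)) hs)).
  by rewrite mulr0 addr0.
rewrite normrM [X in _ * X]ger0_norm ?subr_ge0// mulrC.
rewrite ler_wpM2l ?subr_ge0//.
rewrite sumrN mulrN normrN.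
have e : Im (f ((a + T) +i* c)%C) - Im (f (a +i* c)%C) =
    \sum_(j < n) (Im (f (x j.+1 +i* c)%C) - Im (f (x j +i* c)%C)).
  rewrite -(big_mkord xpredT (fun j => Im (f (x j.+1 +i* c)%C) - Im (f (x j +i* c)%C))).
  by rewrite telescope_sumr// /x nh mul0r addr0.
have M0 : 0 <= M.
  by have [_ _] := hf _ (inrect 0%N c (leq0n _) hc); apply: le_trans (cmod_ge0 _).
have step (j : 'I_n) : `|h * Im (f' (x j +i* c)%C) -
    (Im (f (x j.+1 +i* c)%C) - Im (f (x j +i* c)%C))| <= M * h ^+ 2.
  have xjj : x j.+1 - x j = h by rewrite /x; rewrite -addn1 natrD; ring.
  have le_xjj : x j <= x j.+1 by rewrite -subr_ge0 xjj.
  have sub t : x j <= t <= x j.+1 -> a <= t <= a + T.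
    have /andP[h1 _] := xin j (ltnW (ltn_ord j)).
    have /andP[_ h2] := xin j.+1 (ltn_ord j).
    by move=> /andP[h3 h4]; rewrite (le_trans h1 h3) (le_trans h4 h2).
  have [t ht ->] : exists2 t, x j <= t <= x j.+1 &
     Im (f (x j.+1 +i* c)%C) - Im (f (x j +i* c)%C) = Im (f' (t +i* c)%C) * (x j.+1 - x j).
    apply: (@mvt (fun t => Im (f (t +i* c)%C)) (fun t => Im (f' (t +i* c)%C))) => // t ht.
    have hr : rect a (a + T) y1 y2 (t +i* c)%C by rewrite /rect /= (sub t ht).
    by have [[]] := hf _ hr.
  rewrite xjj mulrC -mulrBl normrM (ger0_norm h0).
  rewrite expr2 mulrA ler_wpM2r//.
  have [/andP[t1 t2]] := ht.
  have [u hu] : exists2 u, x j <= u <= t &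
     Im (f' (t +i* c)%C) - Im (f' (x j +i* c)%C) = Im (f'' (u +i* c)%C) * (t - x j).
    apply: (@mvt (fun t => Im (f' (t +i* c)%C)) (fun t => Im (f'' (t +i* c)%C))) => // u /andP[u1 u2].
    have hu : x j <= u <= x j.+1 by rewrite u1 (le_trans u2).
    have hr : rect a (a + T) y1 y2 (u +i* c)%C by rewrite /rect /= (sub u hu).
    by have [_ []] := hf _ hr.
  rewrite distrC => ->; rewrite normrM ler_pM//.
    have [/andP[u1 u2]] := hu.
    have hu' : x j <= u <= x j.+1 by rewrite u1 (le_trans u2).
    have hr : rect a (a + T) y1 y2 (u +i* c)%C by rewrite /rect /= (sub u hu').
    have [_ _] := hf _ hr; by apply: le_trans (le_Im_cmod _).
  by rewrite ger0_norm ?subr_ge0// -xjj lerD2r.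
have -> : h * \sum_(j < n) Im (f' (x j +i* c)%C) =
    (Im (f ((a + T) +i* c)%C) - Im (f (a +i* c)%C)) +
    \sum_(j < n) (h * Im (f' (x j +i* c)%C) -
      (Im (f (x j.+1 +i* c)%C) - Im (f (x j +i* c)%C))).
  by rewrite e -big_split /= mulr_sumr; apply: eq_bigr => j _; rewrite addrC subrK.
apply: le_trans (ler_normD _ _) (lerD (hB _ hc) _).
apply: le_trans (ler_norm_sum _ _ _) _.
apply: le_trans (ler_sum _ (fun j _ => step j)) _.
rewrite sumr_const card_ord -[leLHS]mulr_natl.
have -> : n%:R * (M * h ^+ 2) = M * (n%:R * h * h) by ring.
by rewrite nh /h expr2 !mulrA.
Qed.

(** Two bounded derivatives are what [riemann_sum_height] asks for, and they are
    inherited by sums, products and inverses. *)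
Definition bhol (D : C -> bool) f :=
  exists M f' f'', forall z, D z ->
    [/\ hol f z (f' z), hol f' z (f'' z) &
        [/\ cmod (f z) <= M, cmod (f' z) <= M & cmod (f'' z) <= M]].

Variable D : C -> bool.

Lemma bhol_cst (a : C) : bhol D (fun=> a).
Proof.
exists (cmod a), (fun=> 0), (fun=> 0) => z Dz; split; try exact: hol_cst.
by rewrite cmod0 cmod_ge0.
Qed.

Lemma bhol_add f g : bhol D f -> bhol D g -> bhol D (fun z => f z + g z).
Proof.
move=> [M [f' [f'' hf]]] [N [g' [g'' hg]]].
exists (M + N), (fun z => f' z + g' z), (fun z => f'' z + g'' z) => z Dz.
have [f1 f2 [f3 f4 f5]] := hf z Dz; have [g1 g2 [g3 g4 g5]] := hg z Dz.
by split; [exact: hol_add|exact: hol_add|split;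
  apply: le_trans (cmodD _ _) _; rewrite lerD].
Qed.

Lemma bhol_mul f g : bhol D f -> bhol D g -> bhol D (fun z => f z * g z).
Proof.
move=> [M [f' [f'' hf]]] [N [g' [g'' hg]]].
exists (4 * (M * N)), (fun z => f' z * g z + f z * g' z),
  (fun z => (f'' z * g z + f' z * g' z) + (f' z * g' z + f z * g'' z)) => z Dz.
have [f1 f2 [f3 f4 f5]] := hf z Dz; have [g1 g2 [g3 g4 g5]] := hg z Dz.
have p (a b : C) : cmod a <= M -> cmod b <= N -> cmod (a * b) <= M * N.
  by move=> ha hb; rewrite cmodM ler_pM ?cmod_ge0.
have MN : 0 <= M * N by apply: le_trans (p _ _ f3 g3); exact: cmod_ge0.
have s (a b : C) x y : cmod a <= x -> cmod b <= y -> cmod (a + b) <= x + y.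
  by move=> ha hb; apply: le_trans (cmodD _ _) _; rewrite lerD.
split; [exact: hol_mul| |split].
- by apply: hol_add; exact: hol_mul.
- by apply: le_trans (p _ _ f3 g3) _; rewrite ler_peMl// ler1n.
- apply: le_trans (s _ _ _ _ (p _ _ f4 g3) (p _ _ f3 g4)) _.
  by move: MN; set q := M * N; lra.
- apply: le_trans (s _ _ _ _ (s _ _ _ _ (p _ _ f5 g3) (p _ _ f4 g4))
    (s _ _ _ _ (p _ _ f4 g4) (p _ _ f3 g5))) _.
  by move: MN; set q := M * N; lra.
Qed.

Lemma bhol_inv f (e : R) : 0 < e -> (forall z, D z -> e <= cmod (f z)) ->
  bhol D f -> bhol D (fun z => (f z)^-1).
Proof.
move=> e0 he [M [f' [f'' hf]]].
pose g z := (f z)^-1.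
exists (e^-1 + (M * e^-1 ^+ 2) + (M * e^-1 ^+ 2 + M * (2 * (M * e^-1 ^+ 2 * e^-1)))),
  (fun z => - f' z * g z ^+ 2),
  (fun z => - f'' z * g z ^+ 2 + - f' z * (2 * (- f' z * g z ^+ 2 * g z))) => z Dz.
have [f1 f2 [f3 f4 f5]] := hf z Dz.
have M0 : 0 <= M by apply: le_trans f3; exact: cmod_ge0.
have fz0 : f z != 0 by rewrite -cmod_gt0; apply: lt_le_trans (he z Dz).
have hg := hol_inv f1 fz0.
have ge : cmod (g z) <= e^-1.
  by rewrite /g cmodV lef_pV2 ?posrE ?he// cmod_gt0.
have e0' : 0 <= e^-1 by rewrite invr_ge0 ltW.
have b1 : cmod (f' z * g z ^+ 2) <= M * e^-1 ^+ 2.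
  by rewrite cmodM cmodX ler_pM ?exprn_ge0 ?cmod_ge0// lerXn2r ?nnegrE ?cmod_ge0.
have b2 : cmod (f'' z * g z ^+ 2) <= M * e^-1 ^+ 2.
  by rewrite cmodM cmodX ler_pM ?exprn_ge0 ?cmod_ge0// lerXn2r ?nnegrE ?cmod_ge0.
have b3 : cmod (- f' z * (2 * (- f' z * g z ^+ 2 * g z))) <= M * (2 * (M * e^-1 ^+ 2 * e^-1)).
  rewrite cmodM cmodN ler_pM ?cmod_ge0//.
  rewrite cmodM (_ : cmod (2 : C) = 2); last by rewrite (_ : 2 = (2 : R)%:C%C) ?cmod_real ?ger0_norm// rmorph_nat.
  by rewrite ler_wpM2l// cmodM ler_pM ?cmod_ge0// mulNr cmodN.
have p1 : 0 <= M * e^-1 ^+ 2 by apply: le_trans b1; exact: cmod_ge0.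
have p2 : 0 <= M * (2 * (M * e^-1 ^+ 2 * e^-1)) by apply: le_trans b3; exact: cmod_ge0.
split; [exact: hg| |split].
- have hN : hol (fun w => - f' w) z (- f'' z).
    have := hol_mul (hol_cst (-1) z) f2.
    rewrite mul0r add0r mulN1r; congr hol; apply: funext => w; exact: mulN1r.
  apply: hol_eq (hol_mul hN (hol_mul hg hg)) _.
  by rewrite /g expr2; ring.
- by apply: le_trans ge _; rewrite -addrA lerDl !addr_ge0.
- rewrite mulNr cmodN; apply: le_trans b1 _.
  by rewrite addrAC lerDr !addr_ge0.
- apply: le_trans (cmodD _ _) _; rewrite mulNr cmodN.
  apply: le_trans (lerD b2 b3) _.
  by rewrite lerDr addr_ge0.
Qed.

Lemma bhol_exp f n : bhol D f -> bhol D (fun z => f z ^+ n).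
Proof.
move=> hf; elim: n => [|n IH]; first exact: bhol_cst.
have -> : (fun z => f z ^+ n.+1) = (fun z => f z * f z ^+ n).
  by apply: funext => z; rewrite exprS.
exact: bhol_mul.
Qed.

Lemma bhol_sum (I : Type) (r : seq I) (u : I -> C -> C) :
  (forall i, bhol D (u i)) -> bhol D (fun z => \sum_(i <- r) u i z).
Proof.
move=> h; elim: r => [|i r IH].
  by under [fun z => _]eq_fun do rewrite big_nil; exact: bhol_cst.
by under [fun z => _]eq_fun do rewrite big_cons; exact: bhol_add.
Qed.

Lemma bhol_wave (l : R) (Y : R) : (forall z, D z -> `|Im z| <= Y) -> bhol D (wave l).
Proof.
move=> hY; pose E := expR (`|l| * Y).
have M : cmod (l *i)%C = `|l| by rewrite cmodE /sqmod /= expr0n add0r sqrtr_sqr.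
exists (E + `|l| * E + `|l| * (`|l| * E)), (fun z => (l *i)%C * wave l z),
  (fun z => (l *i)%C * ((l *i)%C * wave l z)) => z Dz.
have le : cmod (wave l z) <= E.
  rewrite cmod_wave ler_expR.
  by apply: le_trans (ler_norm _) _; rewrite normrN normrM ler_wpM2l// hY.
have E0 : 0 <= E by exact: expR_ge0.
split; first exact: hol_wave.
  apply: hol_eq (hol_mul (hol_cst _ z) (hol_wave l z)) _.
  by rewrite mul0r add0r.
rewrite !cmodM M; split.
- by apply: le_trans le _; rewrite -addrA lerDl addr_ge0// !mulr_ge0.
- apply: le_trans (ler_wpM2l (normr_ge0 l) le) _.
  by rewrite addrAC lerDr addr_ge0// !mulr_ge0.
- apply: le_trans (ler_wpM2l (normr_ge0 l) (ler_wpM2l (normr_ge0 l) le)) _.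
  by rewrite lerDr addr_ge0// !mulr_ge0.
Qed.

Lemma bhol_id (M : R) : 1 <= M -> (forall z, D z -> cmod z <= M) -> bhol D id.
Proof.
move=> M1 hM; exists M, (fun=> 1), (fun=> 0) => z Dz.
split; [exact: hol_id|exact: hol_cst|split; rewrite ?cmod1 ?cmod0 ?hM//].
exact: le_trans M1.
Qed.

End Cauchy.

(** * Limits in punctured neighbourhoods *)
Section PuncturedLimits.
Context {R : realType}.
Local Notation C := R[i].
Implicit Types (f g : C -> C) (z w c d : C).

Lemma mvt_le (u du : R -> R) (a b p q M : R) : a <= p <= b -> a <= q <= b ->
  (forall x, a <= x <= b -> is_derive x (1 : R) u (du x)) ->
  (forall x, a <= x <= b -> `|du x| <= M) -> `|u q - u p| <= M * `|q - p|.
Proof.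
wlog pq : p q / p <= q => [hw|] hp hq hu hM.
  have [pq|/ltW qp] := leP p q; first exact: hw.
  by rewrite distrC [X in _ <= _ * X]distrC; exact: hw.
have sub x : p <= x <= q -> a <= x <= b.
  move: hp hq => /andP[h1 _] /andP[_ h2] /andP[h3 h4].
  by rewrite (le_trans h1 h3) (le_trans h4 h2).
have [c /sub hc ->] := mvt pq (fun x hx => hu x (sub x hx)).
by rewrite normrM ler_wpM2r// hM.
Qed.

(** Moving first horizontally and then vertically inside the rectangle. *)
Lemma hol_lipschitz f f' (a b y1 y2 M : R) z w :
  (forall v, rect a b y1 y2 v -> hol f v (f' v) /\ cmod (f' v) <= M) ->
  rect a b y1 y2 z -> rect a b y1 y2 w ->
  cmod (f z - f w) <= 4 * M * cmod (z - w).
Proof.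
move=> hf /andP[hz1 hz2] /andP[hw1 hw2].
have M0 : 0 <= M.
  have hr : rect a b y1 y2 z by rewrite /rect hz1.
  by have [_] := hf z hr; apply: le_trans (cmod_ge0 _).
pose v := (Re z +i* Im w)%C.
have Rx t : a <= t <= b -> rect a b y1 y2 (t +i* Im w)%C by move=> h; rewrite /rect /= h.
have Ry t : y1 <= t <= y2 -> rect a b y1 y2 (Re z +i* t)%C.
  by move=> h; rewrite /rect /= hz1.
have e1 : cmod (f v - f w) <= 2 * M * `|Re z - Re w|.
  apply: le_trans (cmod_le _) _; rewrite Re_add Im_add Re_opp Im_opp.
  have h1 : `|Re (f v) - Re (f w)| <= M * `|Re z - Re w|.
    have := @mvt_le (fun t => Re (f (t +i* Im w)%C)) (fun t => Re (f' (t +i* Im w)%C)) a b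
      (Re w) (Re z) M hw1 hz1; rewrite eta_complex; apply=> t ht.
      by have [[]] := hf _ (Rx t ht).
    by have [_] := hf _ (Rx t ht); apply: le_trans; exact: le_Re_cmod.
  have h2 : `|Im (f v) - Im (f w)| <= M * `|Re z - Re w|.
    have := @mvt_le (fun t => Im (f (t +i* Im w)%C)) (fun t => Im (f' (t +i* Im w)%C)) a b
      (Re w) (Re z) M hw1 hz1; rewrite eta_complex; apply=> t ht.
      by have [[]] := hf _ (Rx t ht).
    by have [_] := hf _ (Rx t ht); apply: le_trans; exact: le_Im_cmod.
  apply: le_trans (lerD h1 h2) _.
  by rewrite -mulrDl (_ : M + M = 2 * M)//; ring.
have e2 : cmod (f z - f v) <= 2 * M * `|Im z - Im w|.
  apply: le_trans (cmod_le _) _; rewrite Re_add Im_add Re_opp Im_opp.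
  have h1 : `|Re (f z) - Re (f v)| <= M * `|Im z - Im w|.
    have := @mvt_le (fun t => Re (f (Re z +i* t)%C)) (fun t => - Im (f' (Re z +i* t)%C)) y1 y2
      (Im w) (Im z) M hw2 hz2; rewrite eta_complex; apply=> t ht.
      by have [[]] := hf _ (Ry t ht).
    by rewrite normrN; have [_] := hf _ (Ry t ht); apply: le_trans; exact: le_Im_cmod.
  have h2 : `|Im (f z) - Im (f v)| <= M * `|Im z - Im w|.
    have := @mvt_le (fun t => Im (f (Re z +i* t)%C)) (fun t => Re (f' (Re z +i* t)%C)) y1 y2
      (Im w) (Im z) M hw2 hz2; rewrite eta_complex; apply=> t ht.
      by have [[]] := hf _ (Ry t ht).
    by have [_] := hf _ (Ry t ht); apply: le_trans; exact: le_Re_cmod.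
  apply: le_trans (lerD h1 h2) _.
  by rewrite -mulrDl (_ : M + M = 2 * M)//; ring.
rewrite -(subrKA (f v)); apply: le_trans (cmodD _ _) _.
apply: le_trans (lerD e2 e1) _.
have : `|Re z - Re w| <= cmod (z - w).
  by have := le_Re_cmod (z - w); rewrite Re_add Re_opp.
have : `|Im z - Im w| <= cmod (z - w).
  by have := le_Im_cmod (z - w); rewrite Im_add Im_opp.
move: (`|Re z - Re w|) (`|Im z - Im w|) (cmod (z - w)) => x y m ym xm.
rewrite -mulrDr -mulrA (_ : 4 * (M * m) = 2 * M * (m + m)); last by ring.
by rewrite ler_wpM2l ?mulr_ge0// lerD.
Qed.

(** [lim_along P f l]: [f] tends to [l] along the decreasing family of
    neighbourhoods [P d], [d] going to [0].  It is used for punctured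
    neighbourhoods, so that quotients may be considered at their common zeros,
    and for the half-planes [Im z >= 1 / d]. *)
Definition lim_along (P : R -> C -> bool) f l := forall e : R, 0 < e ->
  exists2 d : R, 0 < d & forall z, P d z -> cmod (f z - l) <= e.

Section LimAlong.
Variable P : R -> C -> bool.
Hypothesis mono : forall (d d' : R) z, 0 < d -> d <= d' -> P d z -> P d' z.
Local Notation plim := (lim_along P).

Lemma along_cst a : plim (fun=> a) a.
Proof. by move=> e e0; exists 1 => // z _; rewrite subrr cmod0 ltW. Qed.

Lemma along_add f g c d : plim f c -> plim g d -> plim (fun z => f z + g z) (c + d).
Proof.
move=> hf hg e e0; have e2 : 0 < e / 2 by rewrite divr_gt0.
have [r r0 hr] := hf _ e2; have [s s0 hs] := hg _ e2.
have m0 : 0 < Num.min r s by rewrite lt_min r0.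
exists (Num.min r s) => // z hz.
have zr : P r z by apply: mono hz; rewrite // ge_min lexx.
have zs : P s z by apply: mono hz; rewrite // ge_min lexx orbT.
rewrite opprD addrACA; apply: le_trans (cmodD _ _) _.
by rewrite [leRHS]splitr lerD ?hr ?hs.
Qed.

Lemma along_bnd f c : plim f c -> exists2 r : R, 0 < r &
  forall z, P r z -> cmod (f z) <= cmod c + 1.
Proof.
move=> hf; have [r r0 hr] := hf 1 ltr01; exists r => // z zr.
rewrite -lerBlDl; apply: le_trans (hr z zr).
by rewrite -[in leLHS](subrK c (f z)) lerBlDr; exact: cmodD.
Qed.

Lemma along_mul f g c d : plim f c -> plim g d -> plim (fun z => f z * g z) (c * d).
Proof.
move=> hf hg e e0.
pose K := cmod c + 1 + cmod d; have K0 : 0 < K.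
  by have := cmod_ge0 c; have := cmod_ge0 d; rewrite /K; lra.
have eK : 0 < e / 2 / K by rewrite !divr_gt0.
have [r r0 hr] := hf _ eK; have [s s0 hs] := hg _ eK; have [t t0 ht] := along_bnd hf.
have m0 : 0 < Num.min r (Num.min s t) by rewrite !lt_min r0 s0.
exists (Num.min r (Num.min s t)) => // z hz.
have zr : P r z by apply: mono hz; rewrite // ge_min lexx.
have zs : P s z by apply: mono hz; rewrite // !ge_min lexx ?orbT.
have zt : P t z by apply: mono hz; rewrite // !ge_min lexx ?orbT.
have -> : f z * g z - c * d = f z * (g z - d) + (f z - c) * d by ring.
apply: le_trans (cmodD _ _) _; rewrite !cmodM [leRHS]splitr.
have eE : e / 2 = K * (e / 2 / K) by field; rewrite gt_eqF.
apply: lerD.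
  rewrite [leRHS]eE ler_pM ?cmod_ge0 ?hs//.
  by apply: le_trans (ht z zt) _; rewrite lerDl cmod_ge0.
rewrite [leRHS]eE mulrC ler_pM ?cmod_ge0 ?hr//.
by rewrite /K lerDr addr_ge0// cmod_ge0.
Qed.

Lemma along_ext f g c : (forall (r : R) z, P r z -> f z = g z) -> plim f c -> plim g c.
Proof.
by move=> fg hf e e0; have [r r0 hr] := hf e e0; exists r => // z zr; rewrite -(fg r)// hr.
Qed.

Lemma along_opp f c : plim f c -> plim (fun z => - f z) (- c).
Proof.
move=> hf; rewrite -mulN1r; apply: along_ext (along_mul (along_cst (-1)) hf).
by move=> _ z _; rewrite mulN1r.
Qed.

Lemma along_inv f c : plim f c -> c != 0 -> plim (fun z => (f z)^-1) c^-1.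
Proof.
move=> hf c0 e e0.
have m0 : 0 < cmod c by rewrite cmod_gt0.
pose e1 := Num.min (cmod c / 2) (e * (cmod c / 2 * cmod c)).
have e10 : 0 < e1 by rewrite lt_min !(divr_gt0 m0, mulr_gt0 e0, mulr_gt0 _ m0, ltr0n).
have [r r0 hr] := hf _ e10; exists r => // z zr.
have := hr z zr; rewrite /e1 le_min => /andP[h1 h2].
have fz : cmod c / 2 <= cmod (f z).
  have := cmodB_ge c (c - f z); rewrite (_ : c - (c - f z) = f z); last by ring.
  move=> h3; rewrite cmodC in h1; have := lerB (lexx (cmod c)) h1 => h4.
  apply: le_trans (le_trans h4 h3); lra.
have fz0 : 0 < cmod (f z) by apply: lt_le_trans fz; rewrite divr_gt0.
have fzn : f z != 0 by rewrite -cmod_gt0.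
have -> : (f z)^-1 - c^-1 = (c - f z) * ((f z)^-1 * c^-1) by field; rewrite fzn c0.
rewrite !cmodM !cmodV cmodC -invfM ler_pdivrMr ?mulr_gt0//.
apply: le_trans h2 _; apply: ler_wpM2l; first exact: ltW.
by apply: ler_wpM2r => //; exact: ltW.
Qed.

Lemma along_sum (I : Type) (r : seq I) (Q : pred I) (F : I -> C -> C) (a : I -> C) :
  (forall i, plim (F i) (a i)) ->
  plim (fun z => \sum_(i <- r | Q i) F i z) (\sum_(i <- r | Q i) a i).
Proof.
move=> h; elim: r => [|i r IH].
  by rewrite big_nil; apply: along_ext (along_cst 0) => d z _; rewrite big_nil.
rewrite big_cons; case: ifPn => Qi.
  by apply: along_ext (along_add (h i) IH) => d z _; rewrite big_cons Qi.
by apply: along_ext IH => d z _; rewrite big_cons (negbTE Qi).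
Qed.

Lemma along_prod (I : Type) (r : seq I) (Q : pred I) (F : I -> C -> C) (a : I -> C) :
  (forall i, plim (F i) (a i)) ->
  plim (fun z => \prod_(i <- r | Q i) F i z) (\prod_(i <- r | Q i) a i).
Proof.
move=> h; elim: r => [|i r IH].
  by rewrite big_nil; apply: along_ext (along_cst 1) => d z _; rewrite big_nil.
rewrite big_cons; case: ifPn => Qi.
  by apply: along_ext (along_mul (h i) IH) => d z _; rewrite big_cons Qi.
by apply: along_ext IH => d z _; rewrite big_cons (negbTE Qi).
Qed.

Lemma along_det n (A : C -> 'M[C]_n) (B : 'M[C]_n) :
  (forall i j, plim (fun z => A z i j) (B i j)) -> plim (fun z => \det (A z)) (\det B).
Proof.
move=> h; rewrite /determinant; apply: along_sum => s.
by apply: along_mul; [exact: along_cst|apply: along_prod].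
Qed.

Lemma along_exp f c n : plim f c -> plim (fun z => f z ^+ n) (c ^+ n).
Proof.
move=> hf; elim: n => [|n IH]; first exact: along_cst.
by rewrite exprS; apply: along_ext (along_mul hf IH) => d z _; rewrite exprS.
Qed.

End LimAlong.

Definition punctured w (d : R) z := (z != w) && (cmod (z - w) < d).

Lemma punctured_mono w (d d' : R) z : 0 < d -> d <= d' -> punctured w d z -> punctured w d' z.
Proof. by move=> _ dd /andP[zw h]; rewrite /punctured zw (lt_le_trans h dd). Qed.

Definition upper_half (d : R) z := d^-1 <= Im z.

Lemma upper_half_mono (d d' : R) z : 0 < d -> d <= d' -> upper_half d z -> upper_half d' z.
Proof.
move=> d0 dd; apply: le_trans; rewrite lef_pV2// posrE//; exact: lt_le_trans dd.
Qed.

Definition clim f w l := lim_along (punctured w) f l.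

Lemma clim_id w : clim id w w.
Proof. by move=> e e0; exists e => // z /andP[_] /ltW. Qed.

Local Notation square w := (rect (Re w - 1) (Re w + 1) (Im w - 1) (Im w + 1)).

Lemma squareP z w : cmod (z - w) <= 1 -> square w z.
Proof.
move=> h; rewrite /rect -!ler_distlC.
have := le_trans (le_Re_cmod (z - w)) h; have := le_trans (le_Im_cmod (z - w)) h.
by rewrite Re_add Re_opp Im_add Im_opp => h1 h2; rewrite distrC h2 distrC h1.
Qed.

Lemma clim_wave l w : clim (wave l) w (wave l w).
Proof.
have [|M [f' [f'' h]]] := @bhol_wave R (square w) l (`|Im w| + 1).
  move=> z /andP[_]; rewrite -ler_distlC => h.
  by rewrite -[Im z](subrK (Im w)) addrC; apply: le_trans (ler_normD _ _) _; rewrite lerD2l distrC.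
have M0 : 0 <= M.
  have hw : square w w by apply: squareP; rewrite subrr cmod0.
  by have [_ _ [h1 _ _]] := h w hw; apply: le_trans h1; exact: cmod_ge0.
have hL z : cmod (z - w) <= 1 -> cmod (wave l z - wave l w) <= 4 * M * cmod (z - w).
  move=> hz; apply: (@hol_lipschitz _ f' (Re w - 1) (Re w + 1) (Im w - 1) (Im w + 1) M).
  - by move=> v hv; have [? _ [_ ? _]] := h v hv.
  - exact: squareP.
  - by apply: squareP; rewrite subrr cmod0.
move=> e e0; have d0 : 0 < e / (4 * M + 1) by rewrite divr_gt0// ltr_wpDl// mulr_ge0.
exists (Num.min 1 (e / (4 * M + 1))); first by rewrite lt_min ltr01.
move=> z /andP[zw]; rewrite lt_min => /andP[h1 h2].
apply: le_trans (hL z (ltW h1)) _.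
move/ltW: h2; rewrite ler_pdivlMr ?ltr_wpDl ?mulr_ge0// => h2.
by apply: le_trans h2; rewrite mulrC ler_wpM2l ?cmod_ge0// lerDl.
Qed.

Lemma clim_wave_slope l w :
  clim (fun z => (wave l z - wave l w) / (z - w)) w ((l *i)%C * wave l w).
Proof.
pose c := ((l *i)%C * wave l w).
pose f z := wave l z - c * z.
pose M := cmod (l *i)%C.
have hf z : hol f z ((l *i)%C * (wave l z - wave l w)).
  have h := hol_add (hol_wave l z) (hol_mul (hol_cst (- c) z) (hol_id z)).
  apply: hol_eq (_ : hol f z _) _; first (rewrite (_ : f = fun w => wave l w + - c * id w); first exact: h).
    by apply: funext => v; rewrite /f mulNr.
  by rewrite /c; ring.
move=> e e0; pose e1 := e / (4 * (M + 1)).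
have M1 : 0 < M + 1 by rewrite ltr_wpDl// cmod_ge0.
have e10 : 0 < e1 by rewrite divr_gt0 ?mulr_gt0.
have [d d0 hd] := clim_wave l w e10.
pose r := Num.min d 1 / 4.
have r0 : 0 < r by rewrite divr_gt0// lt_min d0 ltr01.
exists r => // z /andP[zw zr].
have zw0 : z - w != 0 by rewrite subr_eq0.
have -> : (wave l z - wave l w) / (z - w) - c = (f z - f w) / (z - w).
  by rewrite /f; field.
rewrite cmodM cmodV ler_pdivrMr ?cmod_gt0//.
have [hz hw] : rect (Re w - r) (Re w + r) (Im w - r) (Im w + r) z /\
   rect (Re w - r) (Re w + r) (Im w - r) (Im w + r) w.
  rewrite /rect -!ler_distlC !subrr normr0 (ltW r0); split=> //.
  have h1 := le_trans (le_Re_cmod (z - w)) (ltW zr).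
  have h2 := le_trans (le_Im_cmod (z - w)) (ltW zr).
  rewrite Re_add Re_opp in h1; rewrite Im_add Im_opp in h2.
  by rewrite (distrC (Re w)) (distrC (Im w)) h1.
have := @hol_lipschitz f (fun z => (l *i)%C * (wave l z - wave l w)) _ _ _ _ (M * e1) z w _ hz hw.
have -> : 4 * (M * e1) = M / (M + 1) * e by rewrite /e1; field; rewrite gt_eqF.
move=> /(_ _)/le_trans -> //.
  move=> v hv; split; first exact: hf.
  rewrite cmodM ler_wpM2l ?cmod_ge0//.
  have [->|vw] := eqVneq v w; first by rewrite subrr cmod0 ltW.
  apply: hd; rewrite /punctured vw; apply: le_lt_trans (cmod_le _) _.
  move: hv; rewrite /rect -!ler_distlC Re_add Im_add Re_opp Im_opp => /andP[h1 h2].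
  rewrite distrC in h1; rewrite distrC in h2.
  apply: le_lt_trans (lerD h1 h2) _; rewrite /r.
  have : Num.min d 1 <= d by rewrite ge_min lexx.
  by move: (Num.min d 1) => m hm; lra.
apply: ler_wpM2r; first exact: cmod_ge0.
apply: ler_piMl; first exact: ltW.
by rewrite ler_pdivrMr// mul1r lerDl.
Qed.

End PuncturedLimits.

(** * A function on two half-planes *)
Section TwoHalfPlanes.
Context {R : realType}.
Local Notation C := R[i].
Implicit Types (f g : C -> C) (z w c d : C).

Lemma bhol_id_rect (a b y1 y2 : R) : bhol (rect a b y1 y2) (@id C).
Proof.
apply: (@bhol_id _ _ (1 + (`|a| + `|b|) + (`|y1| + `|y2|))).
  by rewrite -addrA lerDl !addr_ge0.
move=> z /andP[h1 h2]; apply: le_trans (cmod_le z) _.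
have bd (x u v : R) : u <= x <= v -> `|x| <= `|u| + `|v|.
  move=> /andP[h3 h4]; rewrite ler_norml opprD.
  have := ler_norm (- u); have := ler_norm v; rewrite normrN => h5 h6.
  have := normr_ge0 u; have := normr_ge0 v; move: h3 h4 h5 h6; lra.
by rewrite lerD ?bd// -[leLHS]add0r lerD ?bd.
Qed.

(** Two Riemann sums may be compared at different heights; this transfers the
    behaviour of [g] at large heights to its sums. *)
Lemma riemann_sum_diff f h (c a T e y y' : R) (n : nat) : 0 <= T -> (0 < n)%N ->
  (forall x, a <= x <= a + T -> `|Re (f (x +i* y)%C) - c * Re (h (x +i* y')%C)| <= e) ->
  `|riemann_sum f a T n y - c * riemann_sum h a T n y'| <= T * e.
Proof.
move=> T0 n0 H; rewrite /riemann_sum mulrCA -mulrBr mulr_sumr -sumrB.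
have n0' : (0 : R) < n%:R by rewrite ltr0n.
rewrite normrM ger0_norm; last by rewrite divr_ge0// ltW.
have -> : T * e = T / n%:R * \sum_(j < n) e.
  by rewrite sumr_const card_ord -[e *+ n]mulr_natl mulrA divfK// gt_eqF.
rewrite ler_wpM2l ?divr_ge0 ?(ltW n0')//.
apply: le_trans (ler_norm_sum _ _ _) _; apply: ler_sum => j _; apply: H.
rewrite lerDl mulr_ge0 ?divr_ge0 ?ler0n//= lerD2l mulrCA ler_piMr//.
by rewrite ler_pdivrMr// mul1r ler_nat ltnW.
Qed.

(** The jump across the segment at height [eta] is uniformly small because [f]
    has a limit at each point of the segment, which is compact. *)
Lemma uniform_gap f (a b e Y : R) : 0 < e -> 0 < Y ->
  (forall x, a <= x <= b -> exists l, clim f x%:C%C l) ->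
  exists2 eta : R, 0 < eta <= Y & forall x, a <= x <= b ->
    cmod (f (x +i* eta)%C - f (x +i* - eta)%C) <= e.
Proof.
move=> e0 Y0 hl.
pose P (eta x : R) := cmod (f (x +i* eta)%C - f (x +i* - eta)%C) <= e.
have hP : \forall eta \near (0 : R)^'+, `[a, b] `<=` P eta.
  apply: (compact_near_coveringP _).1; first exact: segment_compact.
  move=> x /=; rewrite in_itv /= => hx; have [l hc] := hl x hx.
  have e2 : 0 < e / 2 by rewrite divr_gt0.
  have [d d0 hd] := hc _ e2.
  have d2 : 0 < d / 2 by rewrite divr_gt0.
  have near_x (t eta : R) : `|x - t| < d / 2 -> 0 < `|eta| < d / 2 ->
      cmod (f (t +i* eta)%C - l) <= e / 2.
    move=> h1 /andP[h2 h3]; apply: hd; apply/andP; split.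
      apply/eqP => /(congr1 Im)/= h4; by rewrite h4 normr0 ltxx in h2.
    apply: le_lt_trans (cmod_le _) _; rewrite /= subr0 distrC.
    by rewrite [ltRHS]splitr ltrD.
  exists ([set t | `|x - t| < d / 2], [set eta | 0 < eta /\ eta < d / 2]) => /=.
    split; first by exists (d / 2) => //= t.
    by apply: filterI; [exact: nbhs_right_gt|exact: nbhs_right_lt].
  move=> [t eta] /= [h1 [h2 h3]]; rewrite /P.
  have i1 : 0 < `|eta| < d / 2 by rewrite gtr0_norm// h2.
  have i2 : 0 < `|- eta| < d / 2 by rewrite normrN.
  have -> : f (t +i* eta)%C - f (t +i* - eta)%C =
    (f (t +i* eta)%C - l) - (f (t +i* - eta)%C - l) by ring.
  apply: le_trans (cmodD _ _) _.
  by rewrite cmodN [leRHS]splitr lerD// near_x.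
have hY : \forall eta \near (0 : R)^'+, 0 < eta <= Y.
  near=> eta; apply/andP; split; near: eta; first exact: nbhs_right_gt.
  exact: nbhs_right_le.
near (0 : R)^'+ => eta; exists eta; first by near: eta.
have h1 : `[a, b] `<=` P eta by near: eta.
by move=> x hx; apply: h1; rewrite /= in_itv.
Unshelve. all: by end_near.
Qed.

(** The weight vanishes to order [n] at both ends of the segment, which
    compensates the growth of [g] near the real axis on the vertical sides of
    the contour; its integral over the segment is of order [T ^ (2 n + 1)]. *)
Local Notation weight T n z := (((z - 1) * ((1 + T)%:C%C - z)) ^+ n).

Lemma bhol_weight (T a b y1 y2 : R) n :
  bhol (rect a b y1 y2) (fun z : C => weight T n z).
Proof.
apply: bhol_exp; apply: bhol_mul.
  exact: (bhol_add (bhol_id_rect _ _ _ _) (bhol_cst _ _)).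
have hN : bhol (rect a b y1 y2) (fun z : C => - z).
  have := bhol_mul (bhol_cst (rect a b y1 y2) (-1)) (bhol_id_rect a b y1 y2).
  by congr bhol; apply: funext => z; rewrite /= mulN1r.
exact: (bhol_add (bhol_cst _ _) hN).
Qed.

Lemma clim_weight (T : R) n w : clim (fun z : C => weight T n z) w (weight T n w).
Proof.
have mono := @punctured_mono R w.
apply: along_exp => //; apply: along_mul => //.
  have := along_add mono (clim_id w) (along_cst (punctured w) (-1)); exact.
have := along_add mono (along_cst (punctured w) (1 + T)%:C%C) (along_opp mono (clim_id w)); exact.
Qed.

Lemma cmod_weight (T x y : R) n : 0 <= T -> 1 <= x <= 1 + T ->
  cmod (weight T n (x +i* y)%C) <= ((T + `|y|) ^+ n) ^+ 2.
Proof.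
move=> T0 hx; rewrite cmodX cmodM -exprM mulnC exprM.
have Ty : 0 <= T + `|y| by rewrite addr_ge0.
apply: lerXn2r; rewrite ?nnegrE ?mulr_ge0 ?cmod_ge0 ?exprn_ge0// expr2.
apply: ler_pM; rewrite ?cmod_ge0//; apply: le_trans (cmod_le _) _;
  rewrite /= ?subr0 ?sub0r ?normrN lerD2r ler_norml; move: hx; lra.
Qed.

Lemma cmod_weight_end (T x y : R) n : 0 <= T -> x = 1 \/ x = 1 + T ->
  cmod (weight T n (x +i* y)%C) <= `|y| ^+ n * (T + `|y|) ^+ n.
Proof.
move=> T0 hx; rewrite cmodX cmodM -exprMn.
have Ty : 0 <= T + `|y| by rewrite addr_ge0.
apply: lerXn2r; rewrite ?nnegrE ?mulr_ge0 ?cmod_ge0//.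
have e1 (u : R) : cmod (u +i* y)%C <= `|u| + `|y| by exact: cmod_le.
case: hx => ->.
  apply: ler_pM; rewrite ?cmod_ge0//.
    by apply: le_trans (cmod_le _) _; rewrite /= subrr normr0 add0r subr0.
  apply: le_trans (cmod_le _) _; rewrite /= sub0r normrN lerD2r.
  by rewrite addrC addKr ger0_norm.
rewrite mulrC; apply: ler_pM; rewrite ?cmod_ge0//.
  by apply: le_trans (cmod_le _) _; rewrite /= subrr normr0 add0r sub0r normrN.
apply: le_trans (cmod_le _) _; rewrite /= subr0 lerD2r.
by rewrite addrC addKr ger0_norm.
Qed.

(** The middle half of the sample points, where both factors of the weight are at
    least [T / 4], suffices. *)
Lemma riemann_sum_weight (T : R) n N : 0 <= T -> (0 < N)%N ->
  T / 2 * (T ^+ 2 / 16) ^+ n <= riemann_sum (fun z => weight T n z) 1 T (4 * N) 0.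
Proof.
move=> T0 N0; rewrite /riemann_sum.
have N0' : (0 : R) < N%:R by rewrite ltr0n.
have eT : T / 2 * (T ^+ 2 / 16) ^+ n =
    T / (4 * N)%:R * \sum_(N <= j < 3 * N) (T ^+ 2 / 16) ^+ n.
  rewrite sumr_const_nat (_ : 3 * N - N = 2 * N)%N; last by rewrite mulSn addKn.
  rewrite -[_ *+ (2 * N)]mulr_natl !natrM.
  by field; rewrite gt_eqF.
rewrite eT ler_wpM2l ?divr_ge0//.
pose F (j : nat) := ((j%:R * (T / (4 * N)%:R)) * (T - j%:R * (T / (4 * N)%:R))) ^+ n.
have jT (j : nat) : j%:R * (T / (4 * N)%:R) = T * (j%:R / (4 * N)%:R) by ring.
have N4 : (0 : R) < (4 * N)%:R by rewrite natrM mulr_gt0.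
have hF (j : nat) : (j <= 4 * N)%N -> 0 <= F j.
  move=> hj; apply: exprn_ge0; apply: mulr_ge0; first by rewrite mulr_ge0 ?divr_ge0.
  by rewrite subr_ge0 jT ler_piMr// ler_pdivrMr// mul1r ler_nat.
have -> : \sum_(j < 4 * N) Re (weight T n ((1 + j%:R * (T / (4 * N)%:R)) +i* 0)%C) =
    \sum_(0 <= j < 4 * N) F j.
  rewrite big_mkord; apply: eq_bigr => j _.
  rewrite (_ : weight T n _ = (F j)%:C%C)// /F rmorphXn; congr (_ ^+ n).
  rewrite rmorphM; congr (_ * _); apply: complex_ext => //=; rewrite ?subr0//; ring.
rewrite [leRHS](big_cat_nat _ (n := N)) //=; last by rewrite leq_pmull.
rewrite [X in _ <= _ + X](big_cat_nat _ (n := 3 * N)) //=; last 2 first.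
- by rewrite leq_pmull.
- by rewrite leq_mul2r orbT.
have s1 : 0 <= \sum_(0 <= j < N) F j.
  rewrite big_nat sumr_ge0// => j /andP[_ h]; apply: hF.
  by apply: leq_trans (ltnW h) _; rewrite leq_pmull.
have s3 : 0 <= \sum_(3 * N <= j < 4 * N) F j.
  by rewrite big_nat sumr_ge0// => j /andP[_ h]; apply: hF; exact: ltnW.
apply: (@le_trans _ _ (\sum_(N <= j < 3 * N) F j)); last first.
  by move: s1 s3; lra.
rewrite big_nat [leRHS]big_nat; apply: ler_sum => j /andP[h1 h2].
rewrite /F; apply: lerXn2r; rewrite ?nnegrE ?divr_ge0 ?sqr_ge0//.
  apply: mulr_ge0; first by rewrite mulr_ge0 ?divr_ge0.
  rewrite subr_ge0 jT ler_piMr// ler_pdivrMr// mul1r ler_nat.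
  by apply: ltnW; apply: leq_trans h2 _; rewrite leq_mul2r orbT.
rewrite (_ : T ^+ 2 / 16 = T / 4 * (T / 4)); last by field.
apply: ler_pM; rewrite ?divr_ge0//.
  by rewrite jT ler_wpM2l// ler_pdivlMr// natrM mulKf ?pnatr_eq0// ler_nat.
 rewrite lerBrDr -lerBrDl jT (_ : T - T / 4 = T * (3 / 4)); last by field.
rewrite ler_wpM2l// ler_pdivrMr// natrM mulrA divfK ?pnatr_eq0//.
by rewrite -natrM ler_nat ltnW.
Qed.

Lemma riemann_sum_bhol (f : C -> C) (T y1 y2 B : R) :
  0 <= T -> y1 <= y2 -> bhol (rect 1 (1 + T) y1 y2) f ->
  (forall y, y1 <= y <= y2 ->
     cmod (f ((1 + T) +i* y)%C) <= B /\ cmod (f (1 +i* y)%C) <= B) ->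
  exists M : R, forall n, (0 < n)%N ->
    `|riemann_sum f 1 T n y2 - riemann_sum f 1 T n y1|
      <= (y2 - y1) * (2 * B) + M / n%:R.
Proof.
move=> T0 y12 [M [f' [f'' hf]]] hB; exists ((y2 - y1) * (M * T ^+ 2)) => n n0.
have -> : (y2 - y1) * (2 * B) + (y2 - y1) * (M * T ^+ 2) / n%:R =
  (y2 - y1) * (2 * B + M * T ^+ 2 / n%:R) by ring.
apply: (@riemann_sum_height R f f' f'' 1 T y1 y2 M (2 * B) n T0 y12 n0).
- by move=> z hz; have [h1 h2 [_ _ h3]] := hf z hz.
- move=> y hy; have [h1 h2] := hB y hy.
  apply: le_trans (ler_normB _ _) _; rewrite (_ : 2 * B = B + B); last by ring.
  by apply: lerD; apply: le_trans (le_Im_cmod _) _.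
Qed.

(** The arithmetic of [no_gap]: [Z] is the lower bound of the main term, [q] and
    [w] bound the vertical sides, [m1], [m2] and [m3] the discretization errors. *)
Lemma gap_arith (Z q w d1 d2 W0 n3 t r1 n1 n2 n4 r4 Te m1 m2 m3 P : R) :
  d1 <= q -> d2 <= q -> W0 <= n3 + t -> n3 <= w + m3 -> Z <= W0 ->
  t <= Z / 8 + r1 -> r1 <= n1 + n2 + n4 + r4 -> r4 <= Z / 8 -> n2 <= Te ->
  Te <= Z / 8 -> n1 <= d1 + m1 -> n4 <= d2 + m2 -> m1 + m2 + m3 <= 1 -> 1 <= P ->
  Z <= (q + q) + w + P + Z * (3 / 8).
Proof. lra. Qed.

(** Cauchy's theorem for [g] times the weight, on the rectangles over
    [[1, 1 + T]] between the heights [- Y] and [Y].  The real axis can be crossed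
    because [g] has limits there, the vertical sides contribute [O(T ^ n)]
    because of the weight, and the bottom is negligible.  The top would
    contribute a multiple of [alpha T ^ (2 n + 1)], which is too much for large
    [T] unless [alpha = 0]. *)
Lemma no_gap (g : C -> C) (n : nat) (alpha : R) :
  (forall a b y1 y2, 0 < y1 \/ y2 < 0 -> bhol (rect a b y1 y2) g) ->
  (forall Y, 0 < Y -> exists K, forall z, 0 < `|Im z| <= Y ->
     cmod (g z) * `|Im z| ^+ n <= K) ->
  (forall e, 0 < e -> exists Y, forall z, Y <= Im z -> cmod (g z - alpha%:C%C) <= e) ->
  (forall e, 0 < e -> exists Y, forall z, Im z <= - Y -> cmod (g z) <= e) ->
  (forall x, 0 < x -> exists l, clim g x%:C%C l) ->
  alpha = 0.
Proof.
move=> hreg hsing htop hbot hlim; apply/eqP; apply: contraT => a0.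
pose A := `|alpha|; have A0 : 0 < A by rewrite normr_gt0.
have [c0 c00 c0E] : exists2 c0 : R, 0 < c0 & c0 = 16^-1 ^+ n / 2.
  by eexists; last reflexivity; rewrite divr_gt0// exprn_gt0// invr_gt0.
(* On the contour the weight is at most [4 ^ n T ^ (2 n)], so that errors of size
   [e] at the top and at the bottom cost one eighth of the main term each. *)
pose e := A * c0 / (8 * 4 ^+ n).
have e0 : 0 < e.
  by apply: divr_gt0; apply: mulr_gt0 => //; exact: exprn_gt0.
have [Y1 hY1] := htop _ e0; have [Y2 hY2] := hbot _ e0.
pose Y := 1 + `|Y1| + `|Y2|.
have Y0 : 0 < Y by rewrite /Y; have := normr_ge0 Y1; have := normr_ge0 Y2; lra.
have {}hY1 z : Im z = Y -> cmod (g z - alpha%:C%C) <= e.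
  move=> hz; apply: hY1; rewrite hz /Y.
  by have := ler_norm Y1; have := normr_ge0 Y2; lra.
have {}hY2 z : Im z = - Y -> cmod (g z) <= e.
  move=> hz; apply: hY2; rewrite hz /Y.
  by have := normr_ge0 Y1; have := ler_norm Y2; lra.
have [K hK] := hsing _ Y0.
have K0 : 0 <= K.
  have := hK (0 +i* Y)%C; rewrite /= (gtr0_norm Y0) lexx Y0 => /(_ isT).
  by apply: le_trans; rewrite mulr_ge0 ?cmod_ge0 ?exprn_ge0 ?ltW.
have Y0' := ltW Y0; have A0' := ltW A0.
have [Kf Kf0 KfE] : exists2 Kf, 0 < Kf &
    Kf = 4 * Y * K * 2 ^+ n + 2 * A * Y * Y ^+ n * 2 ^+ n + 1.
  eexists; last reflexivity; apply: ltr_wpDl => //.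
  by apply: addr_ge0; repeat first [apply: mulr_ge0|apply: exprn_ge0|done].
have Kf0' := ltW Kf0.
have Ac0 : 0 < A * c0 by rewrite mulr_gt0.
have Ac0' := ltW Ac0.
have frac0 : 0 <= 3 * Kf / (A * c0) by rewrite divr_ge0// mulr_ge0.
(* [Kf T ^ n] bounds the contribution of the vertical sides; [T] is chosen so
   that it is at most a third of the main term. *)
pose T := 1 + Y + 3 * Kf / (A * c0).
have T1 : 1 <= T.
  by move: frac0; rewrite /T; lra.
have T0 : 0 <= T by apply: le_trans T1.
have TY : Y <= T.
  by move: frac0; rewrite /T; lra.
have TK : 3 * Kf <= A * c0 * T.
  rewrite (_ : A * c0 * T = A * c0 * (1 + Y) + 3 * Kf).
    by rewrite lerDr mulr_ge0// addr_ge0.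
  by rewrite /T; field; rewrite (gt_eqF c00) (gt_eqF A0).
pose W z := weight T n z.
pose p z := g z * W z.
pose P := T ^+ n; have P1 : 1 <= P by rewrite /P exprn_ege1.
have P0 : 0 <= P by apply: le_trans P1.
have TYn y : `|y| <= Y -> (T + `|y|) ^+ n <= 2 ^+ n * P.
  move=> hy; rewrite -exprMn; apply: lerXn2r.
  - by rewrite nnegrE addr_ge0.
  - by rewrite nnegrE mulr_ge0.
  - by have := le_trans hy TY; lra.
have W_bnd x y : 1 <= x <= 1 + T -> `|y| <= Y -> cmod (W (x +i* y)%C) <= 4 ^+ n * P ^+ 2.
  move=> hx hy; apply: le_trans (cmod_weight y n T0 hx) _.
  have -> : 4 ^+ n * P ^+ 2 = (2 ^+ n * P) ^+ 2.
    have -> : (4 : R) ^+ n = 2 ^+ n * 2 ^+ n by rewrite -exprMn; congr (_ ^+ n); ring.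
    by ring.
  by apply: lerXn2r; rewrite ?nnegrE ?TYn// ?exprn_ge0 ?mulr_ge0 ?addr_ge0 ?exprn_ge0.
have W_end x y : x = 1 \/ x = 1 + T -> `|y| <= Y ->
    cmod (W (x +i* y)%C) <= `|y| ^+ n * (2 ^+ n * P).
  move=> hx hy; apply: le_trans (cmod_weight_end y n T0 hx) _.
  by rewrite ler_wpM2l ?exprn_ge0// TYn.
have p_end x y : x = 1 \/ x = 1 + T -> 0 < `|y| <= Y ->
    cmod (p (x +i* y)%C) <= K * (2 ^+ n * P).
  move=> hx hy; rewrite /p cmodM.
  have hyY : `|y| <= Y by case/andP: hy.
  apply: le_trans (ler_wpM2l (cmod_ge0 _) (W_end x y hx hyY)) _.
  rewrite [leLHS]mulrA; apply: ler_wpM2r; first by rewrite mulr_ge0 ?exprn_ge0.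
  exact: (hK (x +i* y)%C).
have p_reg y1 y2 : 0 < y1 \/ y2 < 0 -> bhol (rect 1 (1 + T) y1 y2) p.
  by move=> hy; apply: bhol_mul; [exact: hreg|exact: bhol_weight].
have p_lim x : 1 <= x <= 1 + T -> exists l, clim p x%:C%C l.
  move=> /andP[x1 _]; have [l hl] := hlim x (lt_le_trans ltr01 x1).
  by eexists; apply: (along_mul (@punctured_mono R _) hl); exact: clim_weight.
have [eta /andP[eta0 etaY] heta] := uniform_gap e0 Y0 p_lim.
have [M1 h1] : exists M : R, forall N, (0 < N)%N ->
    `|riemann_sum p 1 T N Y - riemann_sum p 1 T N eta| <= (Y - eta) * (2 * (K * (2 ^+ n * P))) + M / N%:R.
  apply: riemann_sum_bhol => //; first by apply: p_reg; left.
  move=> y /andP[y1 y2]; have y0 := lt_le_trans eta0 y1.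
  by split; apply: p_end; rewrite ?(gtr0_norm y0) ?y0//; [right|left].
have [M2 h2] : exists M : R, forall N, (0 < N)%N ->
    `|riemann_sum p 1 T N (- eta) - riemann_sum p 1 T N (- Y)| <= (- eta - - Y) * (2 * (K * (2 ^+ n * P))) + M / N%:R.
  apply: riemann_sum_bhol => //; first by rewrite lerN2.
    by apply: p_reg; right; rewrite oppr_lt0.
  move=> y /andP[y1 y2]; have y0 : y < 0 by apply: le_lt_trans y2 _; rewrite oppr_lt0.
  have yY : - y <= Y by rewrite lerNl.
  by split; apply: p_end; rewrite ?(ltr0_norm y0) ?oppr_gt0 ?y0//; [right|left].
have [M3 h3] : exists M : R, forall N, (0 < N)%N ->
    `|riemann_sum W 1 T N Y - riemann_sum W 1 T N 0| <= (Y - 0) * (2 * (Y ^+ n * (2 ^+ n * P))) + M / N%:R.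
  apply: riemann_sum_bhol => //; first exact: bhol_weight.
  move=> y /andP[y1 y2]; have yY : `|y| <= Y by rewrite ger0_norm.
  have yn : `|y| ^+ n * (2 ^+ n * P) <= Y ^+ n * (2 ^+ n * P).
    by rewrite ler_wpM2r ?mulr_ge0 ?exprn_ge0// lerXn2r ?nnegrE// ltW.
  by split; apply: le_trans (W_end _ _ _ yY) yn; [right|left].
(* The number of sample points is large compared to all the second derivatives. *)
have [N N0 hN] : exists2 N, (0 < N)%N & M1 / N%:R + M2 / N%:R + A * (M3 / N%:R) <= 1 /\
    c0 * T * P ^+ 2 <= riemann_sum W 1 T N 0.
  have [m] : exists m, `|M1 + M2 + A * M3| < m%:R.
    exists (Num.bound `|M1 + M2 + A * M3|).
    exact: archi_boundP.
  move=> hm.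
  have m0 : (0 < m)%N by case: m hm => [|//]; rewrite ltNge normr_ge0.
  exists (4 * m)%N; first by rewrite muln_gt0.
  have m4 : (0 : R) < (4 * m)%:R by rewrite ltr0n muln_gt0.
  split.
    rewrite mulrA -!mulrDl ler_pdivrMr// mul1r; apply: le_trans (ler_norm _) _.
    by apply: le_trans (ltW hm) _; rewrite ler_nat leq_pmull.
  apply: le_trans (riemann_sum_weight n T0 m0).
  have -> : (T ^+ 2 / 16) ^+ n = P ^+ 2 * 16^-1 ^+ n.
    by rewrite exprMn -exprM mulnC exprM.
  rewrite c0E le_eqVlt; apply/orP; left; apply/eqP; ring.
have {}h1 := h1 N N0; have {}h2 := h2 N N0; have {}h3 := h3 N N0.
have top : `|riemann_sum p 1 T N Y - alpha * riemann_sum W 1 T N Y| <= T * (e * (4 ^+ n * P ^+ 2)).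
  apply: riemann_sum_diff => // x hx.
  have -> : Re (p (x +i* Y)%C) - alpha * Re (W (x +i* Y)%C) =
     Re ((g (x +i* Y)%C - alpha%:C%C) * W (x +i* Y)%C).
    by rewrite mulrBl Re_add Re_opp Re_real_mul.
  apply: le_trans (le_Re_cmod _) _; rewrite cmodM ler_pM ?cmod_ge0 ?hY1//.
  by rewrite W_bnd// gtr0_norm.
have bot : `|riemann_sum p 1 T N (- Y) - 0 * riemann_sum W 1 T N (- Y)| <= T * (e * (4 ^+ n * P ^+ 2)).
  apply: riemann_sum_diff => // x hx; rewrite mul0r subr0.
  apply: le_trans (le_Re_cmod _) _; rewrite cmodM ler_pM ?cmod_ge0 ?hY2//.
  by rewrite W_bnd// normrN gtr0_norm.
rewrite mul0r subr0 in bot.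
have mid : `|riemann_sum p 1 T N eta - 1 * riemann_sum p 1 T N (- eta)| <= T * e.
  apply: riemann_sum_diff => // x hx; rewrite mul1r.
  rewrite -Re_opp -Re_add; apply: le_trans (le_Re_cmod _) _; exact: heta.
rewrite mul1r in mid.
case: hN => hM hW.
have eE : e * 4 ^+ n = A * c0 / 8.
  by rewrite /e; field; rewrite expf_neq0 ?pnatr_eq0.
have mid' : T * e <= T * (e * 4 ^+ n) * P ^+ 2.
  rewrite -mulrA ler_wpM2l// -mulrA ler_peMr ?(ltW e0)//.
  by apply: mulr_ege1; rewrite exprn_ege1// ler1n.
have q1 : (Y - eta) * (2 * (K * (2 ^+ n * P))) <= 2 * Y * K * 2 ^+ n * P.
  have -> : 2 * Y * K * 2 ^+ n * P = Y * (2 * (K * (2 ^+ n * P))) by ring.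
  by rewrite ler_wpM2r ?mulr_ge0 ?exprn_ge0// gerBl ltW.
have q2 : (- eta - - Y) * (2 * (K * (2 ^+ n * P))) <= 2 * Y * K * 2 ^+ n * P.
  by apply: le_trans q1; rewrite opprK addrC.
have hA : A * riemann_sum W 1 T N 0 <=
   A * `|riemann_sum W 1 T N Y - riemann_sum W 1 T N 0| + `|alpha * riemann_sum W 1 T N Y|.
  rewrite normrM -/A -mulrDr ler_wpM2l ?(ltW A0)// distrC.
  rewrite addrC -lerBlDl; apply: le_trans (lerB_dist _ _); rewrite lerD2r.
  exact: ler_norm.
have hA3 := ler_wpM2l (ltW A0) h3.
have hAW := ler_wpM2l (ltW A0) hW.
have big : A * c0 * T * P ^+ 2 <= Kf * P + A * c0 * T * P ^+ 2 * (3 / 8).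
  have t1 : `|alpha * riemann_sum W 1 T N Y| <= T * (e * (4 ^+ n * P ^+ 2)) + `|riemann_sum p 1 T N Y|.
    by rewrite -lerBlDr; apply: le_trans top; rewrite distrC; exact: lerB_dist.
  have t2 : `|riemann_sum p 1 T N Y| <= `|riemann_sum p 1 T N Y - riemann_sum p 1 T N eta| +
      `|riemann_sum p 1 T N eta - riemann_sum p 1 T N (- eta)| +
      `|riemann_sum p 1 T N (- eta) - riemann_sum p 1 T N (- Y)| +  `|riemann_sum p 1 T N (- Y)|.
    move: (riemann_sum p 1 T N Y) (riemann_sum p 1 T N eta) (riemann_sum p 1 T N (- eta)) (riemann_sum p 1 T N (- Y)) => a b c d.
    rewrite {1}(_ : a = (a - b) + (b - c) + (c - d) + d); last by ring.
    do 2 (apply: le_trans (ler_normD _ _) _; rewrite lerD2r).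
    exact: ler_normD.
  have eE' : T * (e * (4 ^+ n * P ^+ 2)) = A * c0 * T * P ^+ 2 / 8.
    by rewrite (mulrA e) eE; field.
  have eE'' : T * (e * 4 ^+ n) * P ^+ 2 = A * c0 * T * P ^+ 2 / 8.
    by rewrite eE; field.
  have q3 : A * ((Y - 0) * (2 * (Y ^+ n * (2 ^+ n * P))) + M3 / N%:R) =
     2 * A * Y * Y ^+ n * 2 ^+ n * P + A * (M3 / N%:R) by ring.
  have q4 : Kf * P = 4 * Y * K * 2 ^+ n * P + 2 * A * Y * Y ^+ n * 2 ^+ n * P + P by rewrite KfE; ring.
  have q5 : A * (c0 * T * P ^+ 2) = A * c0 * T * P ^+ 2 by ring.
  rewrite eE' in t1 bot; rewrite eE'' in mid'; rewrite q3 in hA3; rewrite q5 in hAW.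
  rewrite q4 (_ : 4 * Y * K * 2 ^+ n * P = 2 * Y * K * 2 ^+ n * P + 2 * Y * K * 2 ^+ n * P); last by ring.
  exact: (gap_arith q1 q2 hA hA3 hAW t1 t2 bot mid mid' h1 h2 hM P1).
have P2 : P <= P ^+ 2 by rewrite expr2 ler_peMr.
have le3 : 3 * (Kf * P) <= A * c0 * T * P ^+ 2.
  by rewrite mulrA; apply: ler_pM => //; rewrite mulr_ge0// ltW.
have KP : 0 < Kf * P by rewrite mulr_gt0// (lt_le_trans ltr01 P1).
by move: big KP le3; move: (A * c0 * T * P ^+ 2) (Kf * P) => Z k; clear; lra.
Qed.

End TwoHalfPlanes.

(** * Exponential sums and determinants *)
Section ExponentialSums.
Context {R : realType}.
Local Notation C := R[i].

Definition expsum (I : finType) (a l : I -> R) (z : C) : C :=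
  \sum_i (a i)%:C%C * wave (l i) z.

(** The coefficient of an exponential sum at the frequency [x]: several indices
    may have the same frequency. *)
Definition coef (I : finType) (a l : I -> R) (x : R) : R := \sum_(i | l i == x) a i.

Lemma expsum_coef (I : finType) (a l : I -> R) (s : seq R) z :
  uniq s -> (forall i, l i \in s) ->
  expsum a l z = \sum_(x <- s) (coef a l x)%:C%C * wave x z.
Proof.
move=> us ls; rewrite /expsum /coef.
have -> : \sum_(x <- s) (\sum_(i | l i == x) a i)%:C%C * wave x z =
    \sum_(x <- s) \sum_i (if l i == x then (a i)%:C%C * wave (l i) z else 0).
  apply: eq_bigr => x _; rewrite rmorph_sum mulr_suml -big_mkcond /=.
  by apply: eq_bigr => i /eqP ->.
rewrite exchange_big /=; apply: eq_bigr => i _.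
rewrite (bigD1_seq (l i)) //= eqxx big1 ?addr0// => x /negPf.
by rewrite eq_sym => ->.
Qed.

Lemma bhol_expsum (I : finType) (a l : I -> R) (D : C -> bool) (Y : R) :
  (forall z, D z -> `|Im z| <= Y) -> bhol D (expsum a l).
Proof.
move=> hY; apply: bhol_sum => i; apply: bhol_mul; first exact: bhol_cst.
exact: bhol_wave hY.
Qed.

(** The growth in the lower half-plane is governed by the largest frequency. *)
Lemma cmod_expsum (I : finType) (a l : I -> R) (Lmax : R) z : 0 <= Lmax ->
  (forall i, 0 <= l i <= Lmax) ->
  cmod (expsum a l z) <= (\sum_i `|a i|) * expR (Lmax * Num.max 0 (- Im z)).
Proof.
move=> L0 hl; apply: le_trans (cmod_sum _ _ _) _; rewrite mulr_suml.
apply: ler_sum => i _; rewrite cmodM cmod_real ler_wpM2l// cmod_wave ler_expR.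
have /andP[l0 lL] := hl i; rewrite -mulrN.
have m1 : - Im z <= Num.max 0 (- Im z) by rewrite le_max lexx orbT.
have m0 : 0 <= Num.max 0 (- Im z) by rewrite le_max lexx.
by apply: le_trans (ler_wpM2l l0 m1) _; rewrite ler_wpM2r.
Qed.

(** In the Leibniz expansion of [det (1 - A)] each factor is a sum of an entry
    of the identity and one of [- A]; the set of the second choices is [c.1], and
    the first choice forces a fixed point of the permutation. *)
Lemma det_1sub n (A : 'M[C]_n) : \det (1%:M - A) =
  \sum_(c : {set 'I_n} * 'S_n | perm_on c.1 c.2)
    (-1) ^+ c.2 * \prod_(i in c.1) - A i (c.2 i).
Proof.
rewrite /determinant.
pose G (J : {set 'I_n}) (s : 'S_n) : C :=
  (-1) ^+ s * \prod_i (if i \in J then - A i (s i) else (i == s i)%:R).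
transitivity (\sum_J \sum_s G J s).
  rewrite exchange_big /=; apply: eq_bigr => s _; rewrite /G -mulr_sumr; congr (_ * _).
  rewrite -bigA_distr; apply: eq_bigr => i _.
  by rewrite !mxE addrC.
rewrite pair_big /= [RHS]big_mkcond /=; apply: eq_bigr => -[J s] _ /=; rewrite /G.
case: ifPn => [hJ|hJ].
  congr (_ * _); rewrite [RHS]big_mkcond; apply: eq_bigr => i _.
  by case: ifPn => // iJ; rewrite (out_perm hJ)// eqxx.
have [i si iJ] : exists2 i, s i != i & i \notin J.
  by move: hJ => /(elimN fintype.subsetP) h; apply: contrapT => nh; apply: h => i;
    rewrite inE => si; apply: contrapT => /negP iJ; apply: nh; exists i.
by rewrite (bigD1 i)//= (negPf iJ) eq_sym (negPf si) mul0r mulr0.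
Qed.

Definition sqnorm m (v : 'rV[C]_m) : R := \sum_i cmod (v 0 i) ^+ 2.

Lemma sqnorm_gt0 m (v : 'rV[C]_m) : v != 0 -> 0 < sqnorm v.
Proof.
move=> v0; have [i vi] : exists i, v 0 i != 0.
  apply/existsP; apply: contraNT v0; rewrite negb_exists => /forallP h.
  by apply/eqP/rowP => i; rewrite mxE; apply/eqP; rewrite -[_ == _]negbK h.
rewrite /sqnorm (bigD1 i)//= ltr_pwDl ?exprn_gt0 ?cmod_gt0//.
by apply: sumr_ge0 => j _; rewrite exprn_ge0// cmod_ge0.
Qed.

Lemma sqnormZ m (a : C) (v : 'rV[C]_m) : sqnorm (a *: v) = cmod a ^+ 2 * sqnorm v.
Proof.
by rewrite /sqnorm mulr_sumr; apply: eq_bigr => i _; rewrite mxE cmodM exprMn.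
Qed.

(** The eigenvalues of a matrix of norm at most [rho] have modulus at most
    [rho], and [det (1 - A)] is the product of the [1 - lambda]. *)
Lemma det_1sub_ge n (A : 'M[C]_n) (rho : R) : 0 <= rho <= 1 ->
  (forall v, sqnorm (v *m A) <= rho ^+ 2 * sqnorm v) ->
  (1 - rho) ^+ n <= cmod (\det (1%:M - A)).
Proof.
move=> /andP[r0 r1] hA.
have [r hr] := closed_field_poly_normal (char_poly A).
have lc : lead_coef (char_poly A) = 1 by apply/monicP; exact: char_poly_monic.
rewrite lc scale1r in hr.
have sr : size r = n.
  by have := size_char_poly A; rewrite hr size_prod_XsubC => -[].
have -> : \det (1%:M - A) = (char_poly A).[1].
  rewrite /char_poly -[RHS]/(horner_eval 1 _) -det_map_mx; congr (\det _).
  apply/matrixP => i j; rewrite !mxE /= /horner_eval hornerD hornerN hornerMn hornerX hornerC.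
  by [].
rewrite hr horner_prod cmod_prod -[n in leLHS]sr.
have hroot a : a \in r -> cmod a <= rho.
  move=> ar; have : eigenvalue A a by rewrite eigenvalue_root_char hr root_prod_XsubC.
  move=> /eigenvalueP[v hv v0]; have := hA v; rewrite hv sqnormZ.
  rewrite ler_pM2r ?sqnorm_gt0// ler_sqr ?nnegrE ?cmod_ge0//.
have : {in r, forall a, 1 - rho <= cmod ('X - a%:P).[1]}.
  move=> a /hroot ha; rewrite hornerXsubC.
  by apply: le_trans (cmodB_ge _ _); rewrite cmod1 lerB.
elim: (r) => [|a r' IH] h; first by rewrite big_nil expr0.
rewrite big_cons /= exprS ler_pM ?exprn_ge0 ?subr_ge0//.
  by apply: h; rewrite mem_head.
by apply: IH => b br; apply: h; rewrite inE br orbT.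
Qed.

End ExponentialSums.

(** * The secular determinant *)
Section Secular.
Context {R : realType}.
Local Notation C := R[i].

Definition ctrmx m n (A : 'M[C]_(m, n)) : 'M[C]_(n, m) := map_mx (@conjc R) A^T.

Lemma ctrmxM m n p (A : 'M[C]_(m, n)) (B : 'M[C]_(n, p)) : ctrmx (A *m B) = ctrmx B *m ctrmx A.
Proof. by rewrite /ctrmx trmx_mul map_mxM. Qed.

Lemma mulr_conjc (a : C) : a * conjc a = (cmod a ^+ 2)%:C%C.
Proof.
by rewrite cmod_sqr /sqmod; apply: complex_ext; case: a => x y /=; ring.
Qed.

Lemma sqnormE n (v : 'rV[C]_n) : (sqnorm v)%:C%C = (v *m ctrmx v) 0 0.
Proof.
rewrite mxE rmorph_sum; apply: eq_bigr => i _.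
by rewrite !mxE mulr_conjc.
Qed.

Variables (n : nat) (T : 'M[R]_n) (L : 'I_n -> R).
Hypothesis T_orth : T *m T^T = 1%:M.
Hypothesis L_gt0 : forall i, 0 < L i.

Let TC : 'M[C]_n := map_mx (real_complex R) T.

Definition scat (z : C) : 'M[C]_n := \matrix_(i, j) (wave (L i) z * (T i j)%:C%C).
Definition secular (z : C) : C := \det (1%:M - scat z).

(** The weight vanishes unless the permutation is supported by the set, so that
    the sums below may range over all pairs. *)
Definition sec_weight (c : {set 'I_n} * 'S_n) : R :=
  if perm_on c.1 c.2 then (-1) ^+ c.2 * \prod_(i in c.1) - T i (c.2 i) else 0.
Definition sec_len (c : {set 'I_n} * 'S_n) : R := \sum_(i in c.1) L i.

Lemma secular_expsum z : secular z = expsum sec_weight sec_len z.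
Proof.
rewrite /secular det_1sub /expsum [LHS]big_mkcond; apply: eq_bigr => c _.
rewrite /sec_weight; case: ifPn => _; last by rewrite mul0r.
rewrite rmorphM rmorph_sign -mulrA; congr (_ * _).
rewrite wave_sum rmorph_prod -big_split /=; apply: eq_bigr => i _.
by rewrite mxE rmorphN mulNr mulrC.
Qed.

Let Dg (z : C) : 'M[C]_n := diag_mx (\row_i wave (L i) z).

Lemma scatE z : scat z = Dg z *m TC.
Proof. by apply/matrixP => i j; rewrite mul_diag_mx !mxE. Qed.

Lemma TC_orth : TC *m TC^T = 1%:M /\ TC^T *m TC = 1%:M.
Proof.
have h : TC *m TC^T = 1%:M by rewrite /TC map_trmx -map_mxM T_orth map_mx1.
by split => //; apply: mulmx1C.
Qed.

Lemma ctrmx_TC : ctrmx TC = TC^T.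
Proof. by apply/matrixP => i j; rewrite !mxE conjc_real. Qed.

Lemma ctrmx_trTC : ctrmx TC^T = TC.
Proof. by apply/matrixP => i j; rewrite !mxE conjc_real. Qed.

Lemma sqnorm_TC (v : 'rV[C]_n) : sqnorm (v *m TC) = sqnorm v.
Proof.
apply: (@complexI R); rewrite !sqnormE ctrmxM ctrmx_TC mulmxA -(mulmxA v).
by rewrite TC_orth.1 mulmx1.
Qed.

Lemma sqnorm_trTC (v : 'rV[C]_n) : sqnorm (v *m TC^T) = sqnorm v.
Proof.
apply: (@complexI R); rewrite !sqnormE ctrmxM ctrmx_trTC mulmxA -(mulmxA v).
by rewrite TC_orth.2 mulmx1.
Qed.

Lemma sqnorm_Dg (v : 'rV[C]_n) z (m : R) : (forall i, m <= L i) -> 0 <= Im z ->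
  sqnorm (v *m Dg z) <= expR (- (m * Im z)) ^+ 2 * sqnorm v.
Proof.
move=> hm z0; rewrite /sqnorm mulr_sumr; apply: ler_sum => i _.
rewrite mul_mx_diag !mxE cmodM exprMn mulrC ler_wpM2r ?exprn_ge0 ?cmod_ge0//.
rewrite lerXn2r ?nnegrE ?cmod_ge0 ?expR_ge0// cmod_wave ler_expR lerN2.
by rewrite ler_wpM2r.
Qed.

(** Off the real axis [U(z)], or its inverse, is a strict contraction: in the upper
    half-plane [det_1sub_ge] applies directly, in the lower one to the factor
    [1 - U(z) ^ -1] of [1 - U(z) = - U(z) (1 - U(z) ^ -1)]. *)
Lemma secular_ge z (m : R) : (forall i, m <= L i) -> 0 <= m ->
  (1 - expR (- (m * `|Im z|))) ^+ n * expR ((\sum_i L i) * Num.max 0 (- Im z))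
   <= cmod (secular z).
Proof.
move=> hm m0; rewrite /secular scatE.
have rho01 (y : R) : 0 <= y -> 0 <= expR (- (m * y)) <= 1.
  by move=> y0; rewrite expR_ge0 -expR0 ler_expR oppr_le0 mulr_ge0.
have [z0|z0] := leP 0 (Im z).
  rewrite (max_idPl _) ?oppr_le0// mulr0 expR0 mulr1 ger0_norm//.
  apply: det_1sub_ge => [|v]; first exact: rho01.
  by rewrite mulmxA sqnorm_TC; exact: sqnorm_Dg.
rewrite (max_idPr _) ?oppr_ge0 ?(ltW z0)// ltr0_norm//.
have z1 : 0 <= Im (- z) by rewrite Im_opp oppr_ge0 ltW.
have DD : Dg z *m Dg (- z) = 1%:M.
  apply/matrixP => i j; rewrite mul_diag_mx !mxE.
  by case: eqVneq => [->|_]; rewrite ?mulr1n ?mulr0n ?mulr0// waveN.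
have -> : 1%:M - Dg z *m TC = - (Dg z *m TC *m (1%:M - TC^T *m Dg (- z))).
  rewrite mulmxBr mulmx1 mulmxA -(mulmxA _ TC) TC_orth.1 mulmx1 DD.
  by rewrite opprB.
have detN (A : 'M[C]_n) : \det (- A) = (-1) ^+ n * \det A by rewrite -scaleN1r detZ.
rewrite detN cmodM cmodX cmodN cmod1 expr1n mul1r !det_mulmx !cmodM.
have -> : cmod (\det TC) = 1.
  have : \det TC * \det TC = 1 by rewrite -[X in _ * X]det_tr -det_mulmx TC_orth.1 det1.
  move=> /(congr1 (@ComplexField.Normc.normc R)); rewrite cmodM cmod1 -expr2 => /eqP.
  by rewrite sqrp_eq1 ?cmod_ge0// => /eqP.
have -> : cmod (\det (Dg z)) = expR ((\sum_i L i) * - Im z).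
  rewrite det_diag; under eq_bigr do rewrite mxE.
  by rewrite -wave_sum cmod_wave mulrN.
rewrite mulr1 mulrC ler_wpM2l ?expR_ge0//.
rewrite -Im_opp; apply: det_1sub_ge => [|v]; first exact: rho01.
by rewrite mulmxA; apply: le_trans (sqnorm_Dg _ hm z1) _; rewrite sqnorm_trTC.
Qed.

Lemma scat_unitary (k : R) : ctrmx (scat k%:C%C) *m scat k%:C%C = 1%:M.
Proof.
rewrite scatE ctrmxM mulmxA -(mulmxA _ (ctrmx (Dg _))).
have -> : ctrmx (Dg k%:C%C) *m Dg k%:C%C = 1%:M.
  apply/matrixP => i j; rewrite mul_mx_diag !mxE.
  case: eqVneq => [->|_]; last by rewrite mulr0n conjc0 mul0r.
  by rewrite !mulr1n mulrC mulr_conjc cmod_wave /= mulr0 oppr0 expR0 expr1n.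
by rewrite mulmx1 ctrmx_TC TC_orth.2.
Qed.

(* The derivative of [scat] at the real point [k]. *)
Let Dl (k : R) : 'M[C]_n := \matrix_(i, j) ((0 +i* L i)%C * scat k%:C%C i j).

(** The derivative of the scattering matrix is definite on its invariant
    vectors: if [U y = y] and [U' y] lies in the range of [1 - U] then [y = 0],
    because the invariant vectors of the unitary matrix [U] are orthogonal to
    that range and [<y, U' y>] is [i] times a positive combination of the
    squared moduli of the entries of [y]. *)
Lemma scat_transversal (k : R) (y x : 'cV[C]_n) :
  scat k%:C%C *m y = y -> Dl k *m y = (1%:M - scat k%:C%C) *m x -> y = 0.
Proof.
set U := scat _ => hy hx.
have hyU : ctrmx y *m U = ctrmx y.
  by rewrite -{1}hy ctrmxM -mulmxA scat_unitary mulmx1.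
have : ctrmx y *m (Dl k *m y) = 0.
  by rewrite hx mulmxA mulmxBr mulmx1 hyU subrr mul0mx.
have -> : Dl k *m y = \col_i ((0 +i* L i)%C * y i 0).
  apply/colP => i; rewrite !mxE -[in RHS]hy mxE mulr_sumr.
  by apply: eq_bigr => j _; rewrite mxE mulrA.
move=> /matrixP/(_ 0 0); rewrite mxE [RHS]mxE => h0.
have {h0} : \sum_i L i * cmod (y i 0) ^+ 2 = 0.
  have -> : \sum_i L i * cmod (y i 0) ^+ 2 = Im (\sum_j ctrmx y 0 j * (\col_i ((0 +i* L i)%C * y i 0)) j 0).
    rewrite Im_sum; apply: eq_bigr => i _; rewrite !mxE.
    rewrite (_ : _ * _ = (0 +i* L i)%C * (y i 0 * conjc (y i 0))); last by ring.
    by rewrite mulr_conjc Im_mul /= mul0r add0r.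
  by rewrite h0.
move/eqP; rewrite psumr_eq0; last by move=> i _; rewrite mulr_ge0 ?exprn_ge0 ?cmod_ge0// ltW.
move=> /allP h; apply/colP => i; rewrite mxE; apply/eqP.
have := h i (mem_index_enum _); rewrite mulf_eq0 (gt_eqF (L_gt0 i)) /=.
by rewrite expf_eq0 /= cmod_eq0.
Qed.

(** After Gaussian elimination of [1 - U(k)], the last rows of [1 - U(z)] are
    divisible by [z - k].  Taking these factors out leaves a matrix [X z] whose
    limit is invertible by [scat_transversal], so the order of the zero is their
    number, the dimension of the kernel. *)
Lemma secular_local (k : R) : exists2 c : C, c != 0 &
  clim (fun z => secular z / (z - k%:C%C) ^+ (n - \rank (1%:M - scat k%:C%C))) k%:C%C c.
Proof.
set K := k%:C%C; set M0 := 1%:M - scat K; set r := \rank M0.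
have rn : (r <= n)%N by exact: rank_leq_row.
pose P := invmx (col_ebase M0); pose Q := invmx (row_ebase M0).
have cu : col_ebase M0 \in unitmx by exact: col_ebase_unit.
have ru : row_ebase M0 \in unitmx by exact: row_ebase_unit.
have eM0 : col_ebase M0 *m pid_mx r *m row_ebase M0 = M0 by exact: mulmx_ebase.
have PM0Q : P *m M0 *m Q = pid_mx r.
  by rewrite -[in LHS]eM0 /P /Q !mulmxA mulVmx// mul1mx -mulmxA mulmxV// mulmx1.
pose slope z : 'M[C]_n := \matrix_(i, j) ((wave (L i) z - wave (L i) K) / (z - K) * (T i j)%:C%C).
pose N z := P *m slope z *m Q.
pose N0 := P *m Dl k *m Q.
pose X z : 'M[C]_n := \matrix_(i, j)
  if (i < r)%N then (pid_mx r : 'M[C]_n) i j - (z - K) * N z i j else - N z i j.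
pose X0 : 'M[C]_n := \matrix_(i, j)
  if (i < r)%N then (pid_mx r : 'M[C]_n) i j else - N0 i j.
have mono := @punctured_mono R K.
have limN i j : clim (fun z => N z i j) K (N0 i j).
  rewrite /N /N0 !mxE; apply: (along_ext (f := fun z => \sum_l (\sum_m P i m * slope z m l) * Q l j)).
    by move=> _ z _; rewrite !mxE; apply: eq_bigr => l _; rewrite mxE.
  apply: along_sum => // l; apply: along_mul => //; last exact: along_cst.
  rewrite mxE; apply: along_sum => // m; apply: along_mul => //; first exact: along_cst.
  rewrite mxE; apply: (along_ext (f := fun z => (wave (L m) z - wave (L m) K) / (z - K) * (T m l)%:C%C)).
    by move=> _ z _; rewrite mxE.
  rewrite !mxE mulrA; apply: along_mul => //; last exact: along_cst.
  exact: clim_wave_slope.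
have eX z i j : X z i j = if (i < r)%N then (pid_mx r : 'M[C]_n) i j - (z - K) * N z i j
    else - N z i j by exact: mxE.
have eX0 i j : X0 i j = if (i < r)%N then (pid_mx r : 'M[C]_n) i j else - N0 i j by exact: mxE.
have limX : clim (fun z => \det (X z)) K (\det X0).
  apply: along_det => // i j.
  apply: (along_ext (f := fun z => if (i < r)%N then
      (pid_mx r : 'M[C]_n) i j + - ((z + - K) * N z i j) else - N z i j)).
    by move=> _ z _; exact: esym (eX z i j).
  rewrite eX0; case: ltnP => ir; last exact: (along_opp mono (limN i j)).
  rewrite -[X in lim_along _ _ X]subr0 -(mul0r (N0 i j)) -(subrr K).
  apply: (along_add mono (along_cst _ _)); apply: (along_opp mono).
  apply: (fun h => along_mul mono h (limN i j)).
  exact: (along_add mono (@clim_id R K) (along_cst _ _)).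
have X0n0 : \det X0 != 0.
  rewrite -det_tr; apply/det0P => -[v v0 hv]; move/negP: v0; apply.
  pose w := v^T.
  have hw : X0 *m w = 0 by rewrite -[X0]trmxK -trmx_mul hv trmx0.
  clearbody X X0.
  have w_lt (i : 'I_n) : (i < r)%N -> w i 0 = 0.
    move=> ir; move/colP: hw => /(_ i); rewrite [LHS]mxE [RHS]mxE (bigD1 i)//=.
    rewrite eX0 ir mxE eqxx ir /= mul1r big1 ?addr0// => j ji.
    rewrite eX0 ir mxE -[(_ == _ :> nat)]/(i == j) eq_sym (negPf ji) /=.
    by rewrite mul0r.
  have pidw : (pid_mx r : 'M[C]_n) *m w = 0.
    apply/colP => i; rewrite [LHS]mxE [RHS]mxE big1// => j _; rewrite [pid_mx _ _ _]mxE.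
    have [ij|] := eqVneq (nat_of_ord i) j; last by rewrite mul0r.
    case: ltnP => [ir|]; last by rewrite mul0r.
    by rewrite w_lt ?mulr0// -ij.
  have N0w : N0 *m w = (pid_mx r : 'M[C]_n) *m (N0 *m w).
    apply/colP => i; rewrite [RHS]mxE (bigD1 i)//= big1 ?addr0.
      rewrite [pid_mx _ _ _]mxE eqxx; case: ltnP => ir; first by rewrite mul1r.
      rewrite mul0r; move/colP: hw => /(_ i); rewrite [LHS]mxE [RHS]mxE => hwi.
      rewrite [LHS]mxE; apply: oppr_inj; rewrite oppr0 -[RHS]hwi -sumrN.
      by apply: eq_bigr => j _; rewrite eX0 ltnNge ir /= mulNr.
    move=> j ji; rewrite [pid_mx _ _ _]mxE -[(_ == _ :> nat)]/(i == j) eq_sym (negPf ji).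
    by rewrite mul0r.
  pose y := Q *m w.
  have hy : scat K *m y = y.
    apply/eqP; rewrite eq_sym -subr_eq0 -{1}[y]mul1mx -mulmxBl -/M0 -eM0 /y /Q.
    by rewrite mulmxA mulmxK// -mulmxA pidw mulmx0.
  have hD : Dl k *m y = M0 *m (Q *m (N0 *m w)).
    have M0Q : M0 *m Q = col_ebase M0 *m (pid_mx r : 'M[C]_n).
      by rewrite -[M0 in LHS]eM0 mulmxK.
    have e1 : N0 *m w = P *m (Dl k *m y) by rewrite /N0 /y !mulmxA.
    by rewrite (mulmxA M0) M0Q -mulmxA -N0w e1 mulKVmx.
  have y0 := scat_transversal hy hD.
  have : w = 0 by rewrite -[w](mulKVmx ru) -/Q -/y y0 mulmx0.
  by rewrite /w => /(congr1 trmx); rewrite trmxK trmx0 => ->.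
have PQ : \det P * \det Q != 0.
  by rewrite mulf_neq0// -unitfE -unitmxE unitmx_inv.
exists (\det X0 / (\det P * \det Q)); first by rewrite mulf_neq0// invr_neq0.
apply: (along_ext (f := fun z => \det (X z) / (\det P * \det Q))); last first.
  by apply: (along_mul mono limX); exact: along_cst.
move=> _ z /andP[zK _].
have zK0 : z - K != 0 by rewrite subr_eq0.
have e : P *m (1%:M - scat z) *m Q = diag_mx (\row_i (if (i < r)%N then 1 else z - K)) *m X z.
  have -> : 1%:M - scat z = M0 - (z - K) *: slope z.
    apply/matrixP => i j; rewrite !mxE; field; exact: zK0.
  rewrite mulmxBr mulmxBl PM0Q -scalemxAr -scalemxAl -/(N z).
  apply/matrixP => i j; rewrite mul_diag_mx [LHS]mxE [X in _ + X]mxE [X in _ - X]mxE.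
  rewrite [RHS]mxE [X in _ = X * _]mxE eX.
  case: ltnP => ir; first by rewrite mul1r.
  by rewrite [pid_mx _ _ _]mxE ltnNge ir andbF sub0r mulrN.
have := congr1 determinant e; rewrite !det_mulmx det_diag.
have -> : \prod_(i < n) (\row_(i < n) (if (i < r)%N then 1 else z - K)) 0 i = (z - K) ^+ (n - r) :> C.
  transitivity (\prod_(i < n) (if (i < r)%N then 1 else z - K)).
    by apply: eq_bigr => i _; rewrite mxE.
  rewrite -(big_mkord xpredT (fun i => if (i < r)%N then 1 else z - K)).
  rewrite (big_cat_nat _ (n := r))//= big_nat big1 ?mul1r; last by move=> i /andP[_ ->].
  rewrite big_nat (eq_bigr (fun=> z - K)); last by move=> i /andP[ri _]; rewrite ltnNge ri.
  by rewrite -big_nat prodr_const_nat.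
move=> hdet; rewrite /secular.
apply/eqP; rewrite eqr_div ?expf_neq0//; apply/eqP.
by rewrite mulrC -hdet; ring.
Qed.

End Secular.

(** * The kernels determine the secular determinant *)
Section KernelsDetermineSecular.
Context {R : realType}.
Local Notation C := R[i].

Lemma seq_min (s : seq R) : s != [::] -> exists2 m, m \in s & forall x, x \in s -> m <= x.
Proof.
elim: s => // a s IH _; have [->|/IH[m ms hm]] := eqVneq s [::].
  by exists a; rewrite ?mem_head// => x; rewrite inE => /eqP ->.
have [am|ma] := leP a m.
  exists a; first exact: mem_head.
  by move=> x; rewrite inE => /predU1P[->//|/hm]; exact: le_trans.
exists m; first by rewrite inE ms orbT.
by move=> x; rewrite inE => /predU1P[->|/hm//]; exact: ltW.
Qed.

Lemma coef_eq0 (I : finType) (a l : I -> R) x :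
  (forall i, l i != x) -> coef a l x = 0.
Proof. by move=> h; rewrite /coef big_pred0// => i; apply/negbTE. Qed.

Lemma expN_le (t : R) : 0 < t -> expR (- t) <= t^-1.
Proof.
move=> t0; rewrite expRN lef_pV2 ?posrE ?expR_gt0//.
by apply: le_trans (expR_ge1Dx _); rewrite lerDr.
Qed.

Lemma wave_upper (t : R) : 0 < t -> lim_along (@upper_half R) (wave t) 0.
Proof.
move=> t0 e e0; exists (t * e) => [|z]; first exact: mulr_gt0.
rewrite /upper_half => hz; rewrite subr0 cmod_wave.
have z0 : 0 < Im z by apply: lt_le_trans hz; rewrite invr_gt0 mulr_gt0.
apply: le_trans (expN_le (mulr_gt0 t0 z0)) _.
move: hz; rewrite -(div1r (t * e)) -(div1r (t * Im z)) !ler_pdivrMr ?mulr_gt0//.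
by rewrite (_ : Im z * (t * e) = e * (t * Im z))//; ring.
Qed.

Section Data.
Variables (n : nat) (T : 'M[R]_n) (L : 'I_n -> R).
Hypothesis L_gt0 : forall i, 0 < L i.

Lemma sec_len_ge0 c : 0 <= sec_len L c.
Proof. by apply: sumr_ge0 => i _; exact: ltW. Qed.

Lemma sec_len_le c : sec_len L c <= \sum_i L i.
Proof.
rewrite /sec_len [leLHS]big_mkcond; apply: ler_sum => i _.
by case: ifP => // _; exact: ltW.
Qed.

Lemma sec_len_eq0 c : (sec_len L c == 0) = (c.1 == finset.set0).
Proof.
apply/eqP/eqP => [h|h]; last by rewrite /sec_len h finset.big_set0.
apply/setP => i; rewrite finset.in_set0; apply/negP => ic.
have : L i <= sec_len L c.
  by rewrite /sec_len (bigD1 i)//= lerDl; apply: sumr_ge0 => j _; exact: ltW.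
by rewrite h leNgt L_gt0.
Qed.

Lemma coef_sec0 : coef (sec_weight T) (sec_len L) 0 = 1.
Proof.
rewrite /coef (bigD1 (finset.set0, 1%g))/=; last by rewrite sec_len_eq0.
rewrite {1}/sec_weight /= perm_on1 odd_perm1 expr0 finset.big_set0 mulr1 big1 ?addr0//.
move=> [A s]; rewrite sec_len_eq0 /= => /andP[/eqP -> hs].
rewrite /sec_weight /=; case: ifPn => // hp; case/negP: hs.
rewrite xpair_eqE eqxx /=; apply/eqP/permP => i.
by rewrite perm1 (out_perm hp)// finset.in_set0.
Qed.

End Data.

(** Suppose that the coefficients differ.  Then [no_gap] is contradicted by the
    function [g = (F - H) / H e ^ (- i s0 z)], where [s0] is the least frequency at
    which the coefficients of the secular determinants [F] and [H] differ.  The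
    assumption that the total length of [F] is the smaller
    one makes [F / H] bounded in the lower half-plane. *)
Lemma coef_eq_of_kernels n n' (T : 'M[R]_n) (T' : 'M[R]_n') (L : 'I_n -> R) (L' : 'I_n' -> R) :
  T *m T^T = 1%:M -> T' *m T'^T = 1%:M -> (forall i, 0 < L i) -> (forall i, 0 < L' i) ->
  (forall k : R, 0 < k -> (n - \rank (1%:M - scat T L k%:C%C)%R =
                           n' - \rank (1%:M - scat T' L' k%:C%C)%R)%N) ->
  forall x, coef (sec_weight T) (sec_len L) x = coef (sec_weight T') (sec_len L') x.
Proof.
wlog LL : n n' T T' L L' / \sum_i L i <= \sum_i L' i => [hw|].
  move=> h1 h2 h3 h4 h5 x; have [le|/ltW le] := leP (\sum_i L i) (\sum_i L' i).
    exact: hw.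
  by apply/esym; apply: hw => // k k0; rewrite h5.
move=> oT oT' L0 L0' hker x1; apply/eqP; apply: contraT => hx1.
pose d x := coef (sec_weight T) (sec_len L) x - coef (sec_weight T') (sec_len L') x.
pose s := undup (codom (sec_len L) ++ codom (sec_len L')).
have us : uniq s by exact: undup_uniq.
have ls c : sec_len L c \in s by rewrite mem_undup mem_cat codom_f.
have ls' c : sec_len L' c \in s by rewrite mem_undup mem_cat codom_f orbT.
have s_ge0 x : x \in s -> 0 <= x.
  rewrite mem_undup mem_cat => /orP[] /codomP[c ->]; exact: sec_len_ge0.
have d_s x : d x != 0 -> x \in s.
  apply: contraR => xs; rewrite /d !coef_eq0 ?subrr// => c.
    by apply: contraNneq xs => <-.
  by apply: contraNneq xs => <-.
have [s0 hs0 s0min] : exists2 m, m \in [seq x <- s | d x != 0] &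
    forall x, x \in [seq x <- s | d x != 0] -> m <= x.
  apply: seq_min; apply/eqP => e0.
  have : x1 \in [seq x <- s | d x != 0] by rewrite mem_filter d_s ?andbT /d subr_eq0.
  by rewrite e0.
move: hs0; rewrite mem_filter => /andP[ds0 s0s].
have {}s0min x : x < s0 -> d x = 0.
  move=> xs0; apply/eqP; apply: contraLR xs0 => dx; rewrite -leNgt.
  by apply: s0min; rewrite mem_filter dx d_s.
have s00 : 0 < s0.
  rewrite lt_neqAle s_ge0// andbT; apply: contra_neq ds0 => <-.
  by rewrite /d !coef_sec0// subrr.
pose F := secular T L; pose H := secular T' L'.
have FE z : F z = expsum (sec_weight T) (sec_len L) z by exact: secular_expsum.
have HE z : H z = expsum (sec_weight T') (sec_len L') z by exact: secular_expsum.
have FH z : F z - H z = \sum_(x <- s) (d x)%:C%C * wave x z.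
  rewrite FE HE (expsum_coef _ _ us ls) (expsum_coef _ _ us ls') -sumrB.
  by apply: eq_bigr => x _; rewrite -mulrBl -rmorphB.
pose g z := (F z - H z) * (H z)^-1 * wave (- s0) z.
have [m m0 hm] : exists2 m : R, 0 < m & forall i, m <= L' i.
  have [e|/seq_min[m ms hm]] := eqVneq (codom L') [::].
    by exists 1 => // i; have := codom_f L' i; rewrite e.
  exists m; first by case/codomP: ms => i ->.
  by move=> i; apply: hm; exact: codom_f.
have Lsum0 : 0 <= \sum_i L' i by apply: sumr_ge0 => i _; exact: ltW.
pose lo (y : R) := (1 - expR (- (m * y))) ^+ n'.
have lo_gt0 y : 0 < y -> 0 < lo y.
  by move=> y0; rewrite exprn_gt0// subr_gt0 -expR0 ltr_expR oppr_lt0 mulr_gt0.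
have lo_mono y y' : 0 < y -> y <= y' -> lo y <= lo y'.
  move=> y0 yy; rewrite /lo lerXn2r ?nnegrE ?subr_ge0 -?expR0 ?ler_expR ?oppr_le0 ?mulr_ge0 ?(ltW m0)//.
  - exact: ltW.
  - by apply: le_trans yy; exact: ltW.
  - by rewrite lerD2l lerN2 ler_expR lerN2 ler_pM2l.
have H_ge z : lo `|Im z| * expR ((\sum_i L' i) * Num.max 0 (- Im z)) <= cmod (H z).
  by apply: secular_ge => //; exact: ltW.
have H_ge' z : Im z != 0 -> lo `|Im z| <= cmod (H z).
  move=> z0; apply: le_trans (H_ge z); rewrite ler_peMr//.
    by rewrite ltW// lo_gt0// normr_gt0.
  by rewrite -expR0 ler_expR mulr_ge0// le_max lexx.
have : d s0 = 0.
  apply: (@no_gap _ g n').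
  (* Off the real axis [H] has no zeros. *)
  - move=> a b y1 y2 hy; pose e := Num.max y1 (- y2).
    have e0 : 0 < e by rewrite lt_max; case: hy => [->//|h]; rewrite oppr_gt0 h orbT.
    have hY z : rect a b y1 y2 z -> `|Im z| <= `|y1| + `|y2|.
      move=> /andP[_ /andP[h1 h2]]; rewrite ler_norml opprD.
      have := ler_norm (- y1); have := ler_norm y2; rewrite normrN => h5 h6.
      have := normr_ge0 y1; have := normr_ge0 y2; move: h1 h2 h5 h6; clear; lra.
    have hH : bhol (rect a b y1 y2) H.
      have := bhol_expsum (sec_weight T') (sec_len L') hY.
      by congr bhol; apply: funext => z; rewrite HE.
    have hF : bhol (rect a b y1 y2) F.
      have := bhol_expsum (sec_weight T) (sec_len L) hY.
      by congr bhol; apply: funext => z; rewrite FE.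
    have hN : bhol (rect a b y1 y2) (fun z => - H z).
      have := bhol_mul (bhol_cst _ (-1)) hH.
      by congr bhol; apply: funext => z; rewrite mulN1r.
    apply: bhol_mul; last exact: bhol_wave hY.
    apply: bhol_mul; first exact: bhol_add hF hN.
    apply: (bhol_inv (lo_gt0 e e0) _ hH) => z /andP[_ /andP[h1 h2]].
    have ez : e <= `|Im z|.
      rewrite ge_max; apply/andP; split.
        by apply: le_trans h1 (ler_norm _).
      by rewrite -normrN; apply: le_trans (ler_norm _); rewrite lerN2.
    have z0 : Im z != 0 by rewrite -normr_gt0 (lt_le_trans e0).
    by apply: le_trans (H_ge' z z0); apply: lo_mono.
  (* Near the real axis [1 / H] is of order at most [|Im z| ^ - n']. *)
  - move=> Y Y0.
    pose B := (\sum_c `|sec_weight T c| + \sum_c `|sec_weight T' c|) *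
       expR ((\sum_i L' i) * Y) * expR (s0 * Y).
    have B0 : 0 <= B by rewrite !mulr_ge0 ?expR_ge0 ?addr_ge0 ?sumr_ge0.
    exists (B * ((1 + m * Y) / m) ^+ n') => z /andP[z0 zY].
    rewrite /g !cmodM cmodV cmod_wave.
    have maxY : Num.max 0 (- Im z) <= Y.
      rewrite ge_max (ltW Y0) /=; apply: le_trans zY.
      by rewrite -normrN; exact: ler_norm.
    have max0 : 0 <= Num.max 0 (- Im z) by rewrite le_max lexx.
    have bF : cmod (F z - H z) <= (\sum_c `|sec_weight T c| + \sum_c `|sec_weight T' c|) *
       expR ((\sum_i L' i) * Y).
      apply: le_trans (cmodD _ _) _; rewrite cmodN mulrDl; apply: lerD.
        rewrite FE; apply: le_trans (@cmod_expsum _ _ _ _ (\sum_i L' i) z Lsum0 _) _.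
          by move=> c; rewrite sec_len_ge0//= (le_trans (sec_len_le _ _)).
        rewrite ler_wpM2l ?sumr_ge0// ler_expR ler_wpM2l//.
      rewrite HE; apply: le_trans (@cmod_expsum _ _ _ _ (\sum_i L' i) z Lsum0 _) _.
        by move=> c; rewrite sec_len_ge0//= sec_len_le.
      by rewrite ler_wpM2l ?sumr_ge0// ler_expR ler_wpM2l.
    have bs : expR (- (- s0 * Im z)) <= expR (s0 * Y).
      rewrite mulNr opprK ler_expR ler_wpM2l ?(ltW s00)//.
      by apply: le_trans zY; exact: ler_norm.
    have q0 : 0 <= (1 + m * Y) / m.
      by apply: divr_ge0 (ltW m0); apply: addr_ge0 => //; apply: mulr_ge0; exact: ltW.
    have bH : (cmod (H z))^-1 * `|Im z| ^+ n' <= ((1 + m * Y) / m) ^+ n'.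
      have H0 : 0 < cmod (H z).
        by apply: lt_le_trans (H_ge' z _); [exact: lo_gt0|rewrite -normr_gt0].
      rewrite mulrC ler_pdivrMr//.
      apply: le_trans (_ : ((1 + m * Y) / m) ^+ n' * lo `|Im z| <= _); last first.
        apply: ler_wpM2l; first exact: exprn_ge0.
        by apply: H_ge'; rewrite -normr_gt0.
      rewrite /lo -exprMn; apply: lerXn2r; rewrite ?nnegrE//.
        apply: mulr_ge0 => //.
        by rewrite subr_ge0 -expR0 ler_expR oppr_le0 mulr_ge0// ltW.
      move: z0 zY; set t := `|Im z| => t0 tY.
      have mt : 0 < m * t by rewrite mulr_gt0.
      have h1 : m * t / (1 + m * t) <= 1 - expR (- (m * t)).
        have hE : expR (- (m * t)) <= (1 + m * t)^-1.
          by rewrite expRN lef_pV2 ?posrE ?expR_gt0 ?addr_gt0// expR_ge1Dx.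
        have -> : m * t / (1 + m * t) = 1 - (1 + m * t)^-1.
          by field; rewrite gt_eqF// addr_gt0.
        by rewrite lerD2l lerN2.
      apply: le_trans (ler_wpM2l q0 h1).
      have -> : (1 + m * Y) / m * (m * t / (1 + m * t)) = t * ((1 + m * Y) / (1 + m * t)).
        by field; rewrite (gt_eqF m0) gt_eqF// addr_gt0.
      rewrite ler_peMr ?(ltW t0)// ler_pdivlMr ?addr_gt0// mul1r lerD2l.
      by rewrite ler_wpM2l// ltW.
    have -> (a b c e : R) : a * b * c * e = (a * c) * (b * e) by ring.
    apply: ler_pM bH; rewrite ?mulr_ge0 ?expR_ge0 ?cmod_ge0 ?invr_ge0 ?cmod_ge0 ?exprn_ge0//.
    by apply: ler_pM; rewrite ?cmod_ge0 ?expR_ge0.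
  (* Upwards [H] tends to [1] and the term of frequency [s0] dominates [F - H]. *)
  - have mono := @upper_half_mono R.
    have top : lim_along (@upper_half R) g (d s0)%:C%C.
      have -> : (d s0)%:C%C = (d s0)%:C%C * 1^-1 by rewrite invr1 mulr1.
      apply: (along_ext (f := fun z => (\sum_(x <- s) (d x)%:C%C * wave (x - s0) z) * (H z)^-1)).
        move=> _ z _; rewrite /g FH mulrAC; congr (_ * _).
        rewrite mulr_suml; apply: eq_bigr => x _.
        by rewrite waveD mulrA.
      apply: (along_mul mono); last first.
        apply: along_inv (oner_neq0 _).
        have -> : (1 : C) = \sum_(x <- s) (if x == 0 then 1 else 0).
          rewrite (bigD1_seq 0)//=; last first.
            by rewrite -[0](_ : sec_len L (finset.set0, 1%g) = 0)// /sec_len finset.big_set0.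
          by rewrite eqxx big1 ?addr0// => x /negPf ->.
        apply: (along_ext (f := fun z => \sum_(x <- s)
            (coef (sec_weight T') (sec_len L') x)%:C%C * (if 0 <= x then wave x z else 0))).
          move=> _ z _; rewrite HE (expsum_coef _ _ us ls') !big_seq.
          by apply: eq_bigr => x /s_ge0 ->.
        apply: (along_sum mono) => x; case: ifPn => [x0|x0].
          have -> : (1 : C) = (coef (sec_weight T') (sec_len L') x)%:C%C * 1.
            by rewrite (eqP x0) coef_sec0// mulr1.
          apply: (along_mul mono); first exact: along_cst.
          rewrite (eqP x0) lexx; apply: along_ext (along_cst _ _) => _ z _.
          by rewrite wave0.
        rewrite -[X in lim_along _ _ X](mulr0 (coef (sec_weight T') (sec_len L') x)%:C%C).
        apply: (along_mul mono); first exact: along_cst.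
        have [h|h] := boolP (0 <= x).
          apply: (along_ext (f := wave x)); first by move=> _ z _; rewrite ?h.
          by apply: wave_upper; rewrite lt_neqAle eq_sym x0.
        apply: (along_ext (f := fun=> 0)); last exact: along_cst.
        by move=> _ z _; rewrite ?(negPf h).
      have -> : (d s0)%:C%C = \sum_(x <- s) (if x == s0 then (d s0)%:C%C else 0).
        by rewrite (bigD1_seq s0)//= eqxx big1 ?addr0// => x /negPf ->.
      apply: (along_sum mono) => x; have [->|xs0] := eqVneq x s0.
        rewrite subrr; apply: along_ext (along_cst _ _) => _ z _.
        by rewrite wave0 mulr1.
      have [h|h] := ltP x s0.
        by rewrite s0min//; apply: along_ext (along_cst _ _) => _ z _; rewrite mul0r.
      rewrite -[X in lim_along _ _ X](mulr0 (d x)%:C%C); apply: (along_mul mono); first exact: along_cst.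
      by apply: wave_upper; rewrite subr_gt0 lt_neqAle eq_sym xs0.
    move=> e e0; have [r r0 hr] := top e e0; exists r^-1 => z hz; exact: hr.
  (* Downwards [F / H] is bounded and [e ^ (- i s0 z)] tends to [0]. *)
  - move=> e e0.
    pose B := (\sum_c `|sec_weight T c|) / lo 1 + 1.
    have B0 : 0 < B by rewrite ltr_wpDl// divr_ge0 ?sumr_ge0// ltW// lo_gt0.
    exists (1 + B / (s0 * e)) => z hz.
    have q0 : 0 < B / (s0 * e) by rewrite divr_gt0// mulr_gt0.
    have z1 : 1 <= - Im z by move: hz q0; clear; lra.
    have z0 : Im z < 0 by move: z1; clear; lra.
    have zn : `|Im z| = - Im z by rewrite ltr0_norm.
    have zm : Num.max 0 (- Im z) = - Im z by apply/max_idPr; rewrite oppr_ge0 ltW.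
    pose E := expR ((\sum_i L' i) * - Im z).
    have E0 : 0 < E by exact: expR_gt0.
    have bH : lo 1 * E <= cmod (H z).
      apply: le_trans (H_ge z); rewrite zm zn ler_wpM2r ?expR_ge0//.
      exact: lo_mono.
    have H0 : 0 < cmod (H z) by apply: lt_le_trans bH; rewrite mulr_gt0// lo_gt0.
    have bF : cmod (F z) <= (\sum_c `|sec_weight T c|) * E.
      rewrite FE /E -zm; apply: cmod_expsum => // c.
      by rewrite sec_len_ge0//= (le_trans (sec_len_le _ _)).
    have bFH : cmod ((F z - H z) * (H z)^-1) <= B.
      rewrite mulrBl mulfV -?cmod_gt0//.
      apply: le_trans (cmodD _ _) _; rewrite cmodN cmod1 lerD2r cmodM cmodV.
      rewrite ler_pdivrMr//; apply: le_trans bF _.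
      rewrite -mulrA ler_wpM2l ?sumr_ge0//.
      by rewrite mulrC ler_pdivlMr ?lo_gt0// mulrC.
    rewrite /g cmodM cmod_wave mulNr opprK.
    have sz : 0 < s0 * - Im z by rewrite mulr_gt0// oppr_gt0.
    have := expN_le sz; rewrite mulrN opprK => hexp.
    apply: le_trans (ler_pM (cmod_ge0 _) (expR_ge0 _) bFH hexp) _.
    rewrite -mulrN ler_pdivrMr// -ler_pdivrMl//.
    have hq : B / (s0 * e) <= - Im z by move: hz; clear; lra.
    have -> : e^-1 * B = B / (s0 * e) * s0 by field; rewrite (gt_eqF s00) (gt_eqF e0).
    by rewrite mulrC ler_wpM2l// ltW.
  (* At the positive points the zeros of [F] and [H] have the same order. *)
  - move=> k k0; have mono := @punctured_mono R k%:C%C.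
    have [c c0 hc] := secular_local oT L0 k.
    have [c' c0' hc'] := secular_local oT' L0' k.
    rewrite (hker k k0) in hc.
    exists ((c * c'^-1 - 1) * wave (- s0) k%:C%C).
    have h1 : clim (fun z => (F z / (z - k%:C%C) ^+ (n' - \rank (1%:M - scat T' L' k%:C%C))) *
      (H z / (z - k%:C%C) ^+ (n' - \rank (1%:M - scat T' L' k%:C%C)))^-1 - (H z * (H z)^-1)) k%:C%C (c * c'^-1 - 1).
      apply: (along_add mono); first exact: (along_mul mono hc (along_inv hc' c0')).
      apply: (along_opp mono).
      have hH := along_mul mono hc' (along_inv hc' c0').
      rewrite mulfV// in hH; apply: along_ext hH => r z /andP[zk _].
      rewrite invfM invrK mulrACA mulVf ?mulr1//.
      by rewrite expf_neq0// subr_eq0.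
    apply: along_ext (along_mul mono h1 (clim_wave _ _)) => r z /andP[zk _].
    rewrite /g [in RHS]mulrBl; congr ((_ - _) * _).
    rewrite invfM invrK mulrACA mulVf ?mulr1//.
    by rewrite expf_neq0// subr_eq0.
by move/eqP; rewrite (negPf ds0).
Qed.

End KernelsDetermineSecular.

(** * Weak derivatives *)
Section WeakDerivative.
Context {R : realType}.
Local Notation mu := (@lebesgue_measure R).
Variable l : R.
Hypothesis l0 : 0 < l.
Local Notation D := (`[0%R, l]%classic).

Lemma within_subitv (f : R -> R) x : 0 <= x <= l ->
  {within `[0, l], continuous f} -> {within `[0, x], continuous f}.
Proof.
move=> /andP[x0 xl]; apply: continuous_subspaceW.
by apply: subset_itvl; rewrite bnd_simp.
Qed.

Lemma within_integrable (f : R -> R) x : 0 <= x <= l ->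
  {within `[0, l], continuous f} -> mu.-integrable `[0, x] (EFin \o f).
Proof.
move=> hx /(within_subitv hx) cf; apply: continuous_compact_integrable => //.
exact: segment_compact.
Qed.

Lemma L1_integrable (h : R -> R) (e : R) : measurable_fun D h ->
  (\int[mu]_(x in D) `|h x|%:E <= e%:E)%E -> mu.-integrable D (EFin \o h).
Proof.
move=> mh he; apply/integrableP; split; first exact/measurable_EFinP.
by apply: le_lt_trans he _; rewrite ltry.
Qed.

Lemma integrable_subitv (h : R -> R) x : 0 <= x <= l ->
  mu.-integrable D (EFin \o h) -> mu.-integrable `[0, x] (EFin \o h).
Proof.
move=> /andP[x0 xl]; apply: integrableS => //.
by apply: subset_itvl; rewrite bnd_simp.
Qed.

Lemma Rint_L1 (h : R -> R) (e x : R) : 0 <= x <= l -> measurable_fun D h ->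
  (\int[mu]_(x in D) `|h x|%:E <= e%:E)%E -> `|\int[mu]_(t in `[0, x]) h t| <= e.
Proof.
move=> hx mh he; have ih := L1_integrable mh he.
rewrite -lee_fin; apply: le_trans he.
rewrite EFin_normr_Rintegral//; last exact: integrable_subitv.
apply: le_trans (le_abse_integral _ _ _) _ => //.
  by apply/measurable_EFinP; apply: measurable_funS mh => //;
    apply: subset_itvl; rewrite bnd_simp; case/andP: hx.
apply: ge0_subset_integral => //.
  by apply/measurable_EFinP; apply: measurableT_comp.
by apply: subset_itvl; rewrite bnd_simp; case/andP: hx.
Qed.

Lemma Rint_cst (c x : R) : 0 <= x -> \int[mu]_(t in `[0, x]) c = c * x.
Proof.
move=> x0; rewrite Rintegral_cst//; congr (_ * _).
transitivity (fine x%:E) => //; congr fine.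
apply: etrans (lebesgue_measure_itv `[0, x]) _; rewrite /= lte_fin.
have [xp|x0'] := ltP 0 x; first by rewrite oppr0 adde0.
by congr EFin; apply/eqP; rewrite eq_le x0 x0'.
Qed.

Lemma Rint_bnd (h : R -> R) (e x : R) : 0 <= x <= l ->
  mu.-integrable `[0, x] (EFin \o h) -> (forall t, 0 <= t <= x -> `|h t| <= e) ->
  `|\int[mu]_(t in `[0, x]) h t| <= x * e.
Proof.
move=> /andP[x0 xl] ih he; apply: le_trans (le_normr_Rintegral _ ih) _ => //.
have -> : x * e = \int[mu]_(t in `[0, x]) e.
  by rewrite Rint_cst// mulrC.
apply: le_Rintegral => //.
- exact: (integrable_norm ih).
- apply: (@within_integrable (fun=> e) x); first by rewrite x0.
  by apply: continuous_subspaceT => t; exact: cvg_cst.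
Qed.

(** Limits in [W_1] are primitives of their weak derivative: the differences
    [phi n - \int dphi n] are constants, so that [f - \int g] is an [L^1] limit
    of constants. *)
Lemma weak_ftc (f g : R -> R) (phi dphi : nat -> R -> R) :
  {within `[0, l], continuous f} -> measurable_fun D g ->
  (forall n x, is_derive x (1 : R) (phi n) (dphi n x)) ->
  (forall n, continuous (dphi n)) ->
  (forall e : R, 0 < e -> exists n,
     (\int[mu]_(x in D) `|phi n x - f x|%:E <= e%:E)%E /\
     (\int[mu]_(x in D) `|dphi n x - g x|%:E <= e%:E)%E) ->
  mu.-integrable D (EFin \o g) /\
  forall x, 0 <= x <= l -> f x = f 0 + \int[mu]_(t in `[0, x]) g t.
Proof.
move=> cf mg dphiE cdphi hconv.
have lin : 0 <= l <= l by rewrite lexx ltW.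
have mI (x : R) : measurable (`[0, x]%classic : set (measurableTypeR R)).
  exact: measurable_itv.
have cphi n : continuous (phi n).
  by move=> x; apply: differentiable_continuous; apply/derivable1_diffP; have [] := dphiE n x.
have wphi n : {within `[0, l], continuous (phi n)} by exact: continuous_subspaceT.
have wdphi n : {within `[0, l], continuous (dphi n)} by exact: continuous_subspaceT.
have mf : measurable_fun D f by exact: subspace_continuous_measurable_fun.
have mphi n : measurable_fun D (phi n).
  by apply: subspace_continuous_measurable_fun => //; exact: wphi.
have mdphi n : measurable_fun D (dphi n).
  by apply: subspace_continuous_measurable_fun => //; exact: wdphi.
have ig : mu.-integrable D (EFin \o g).
  have [n [_ h]] := hconv 1 ltr01.
  have i1 := L1_integrable (measurable_funB (mdphi n) mg) h.
  have := integrableB (mI l) (within_integrable lin (wdphi n)) i1.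
  apply: eq_integrable => // x _ /=.
  by rewrite -EFinB; congr EFin; rewrite subKr.
split => //.
pose G x := \int[mu]_(t in `[0, x]) g t.
have cG : {within `[0, l], continuous G}.
  exact: (parameterized_integral_continuous (ltW l0) ig).
pose k x := f x - G x.
have ck : {within `[0, l], continuous k}.
  by move=> x; apply: cvgB; [exact: cf|exact: cG].
have ftc n x : 0 <= x <= l -> \int[mu]_(t in `[0, x]) dphi n t = phi n x - phi n 0.
  move=> /andP[]; rewrite le_eqVlt => /predU1P[<- _|x0 xl].
    by rewrite set_itv1 Rintegral_set1 subrr.
  rewrite /Rintegral (@continuous_FTC2 _ (dphi n) (phi n))//.
  - by apply: within_subitv (wdphi n); rewrite ltW.
  - split.
    + by move=> t _; have [] := dphiE n t.
    + by apply: cvg_at_right_filter; exact: cphi.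
    + by apply: cvg_at_left_filter; exact: cphi.
  - by move=> t _; rewrite derive1E; have [_ ->] := dphiE n t.
(* The primitive [K] of [k] is close to linear functions, hence linear, and its
   derivative [k] is constant. *)
pose K x := \int[mu]_(t in `[0, x]) k t.
have hK e : 0 < e -> exists c, forall x, 0 <= x <= l -> `|K x - c * x| <= (l + 1) * e.
  move=> e0; have [n [h1 h2]] := hconv e e0; exists (phi n 0) => x hx.
  have [x0 xl] := andP hx.
  pose E t := phi n t - phi n 0 - G t.
  have hE t : 0 <= t <= l -> `|E t| <= e.
    move=> ht; rewrite /E -ftc// /G -RintegralB//.
    - exact: (Rint_L1 ht (measurable_funB (mdphi n) mg) h2).
    - exact: within_integrable.
    - exact: integrable_subitv.
  have iG : mu.-integrable `[0, x] (EFin \o G) by exact: within_integrable.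
  have iphi : mu.-integrable `[0, x] (EFin \o phi n) by exact: within_integrable.
  have if_ : mu.-integrable `[0, x] (EFin \o f) by exact: within_integrable.
  have icst (c : R) : mu.-integrable `[0, x] (EFin \o (fun=> c)).
    apply: (within_integrable hx); by apply: continuous_subspaceT => t; exact: cvg_cst.
  have ipc : mu.-integrable `[0, x] (EFin \o (fun t => phi n t - phi n 0)).
    have := integrableB (mI x) iphi (icst (phi n 0)).
    by apply: eq_integrable.
  have iE : mu.-integrable `[0, x] (EFin \o E).
    have := integrableB (mI x) ipc iG.
    by apply: eq_integrable.
  have idf : mu.-integrable `[0, x] (EFin \o (fun t => phi n t - f t)).
    have := integrableB (mI x) iphi if_.
    by apply: eq_integrable.
  have ik : mu.-integrable `[0, x] (EFin \o k) by exact: within_integrable.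
  have -> : K x - phi n 0 * x =
      \int[mu]_(t in `[0, x]) E t - \int[mu]_(t in `[0, x]) (phi n t - f t).
    have -> : phi n 0 * x = \int[mu]_(t in `[0, x]) (phi n 0).
      by rewrite Rint_cst.
    rewrite /K -!RintegralB//; apply: eq_Rintegral => t _.
    by rewrite /E /k; ring.
  apply: le_trans (ler_normB _ _) _; rewrite mulrDl mul1r; apply: lerD.
    apply: le_trans (Rint_bnd hx iE _) _.
      by move=> t /andP[t0 tx]; apply: hE; rewrite t0 (le_trans tx).
    by rewrite ler_wpM2r// ltW.
  exact: (Rint_L1 hx (measurable_funB (mphi n) mf) h1).
pose c := K l / l.
have Kc x : 0 <= x <= l -> K x = c * x.
  move=> hx; have [x0 xl] := andP hx.
  apply/eqP; rewrite -subr_eq0 -normr_le0; apply/ler_addgt0Pr => e e0.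
  have e' : 0 < e / (2 * (l + 1)) by rewrite divr_gt0// mulr_gt0// addr_gt0.
  have [a ha] := hK _ e'.
  have hl := ha l lin; have hx' := ha x hx.
  have -> : K x - c * x = (K x - a * x) - (x / l) * (K l - a * l).
    by rewrite /c; field; rewrite gt_eqF.
  rewrite add0r; apply: le_trans (ler_normB _ _) _.
  have -> : e = (l + 1) * (e / (2 * (l + 1))) + (l + 1) * (e / (2 * (l + 1))).
    by field; rewrite gt_eqF// addr_gt0.
  apply: lerD => //; rewrite normrM; apply: le_trans hl.
  rewrite ler_piMl// ger0_norm ?divr_ge0// ?(ltW l0)//.
  by rewrite ler_pdivrMr// mul1r.
have kc x : 0 < x < l -> k x = c.
  move=> /andP[x0 xl].
  have [ckx _ _] := (continuous_within_itvP k l0).1 ck.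
  have xin : x \in `]0, l[ by rewrite in_itv /= x0.
  have [dK <-] := continuous_FTC1_closed xl (within_integrable lin ck) x0 (ckx x xin).
  rewrite derive1E.
  have hd : is_derive x (1 : R) (fun t => c * t) c by exact: is_derive_linear.
  have <- : 'D_1 (fun t => c * t) x = c by have [] := hd.
  apply: near_eq_derive => //.
  near=> t; apply: Kc; apply/andP; split; apply/ltW; near: t.
    exact: lt_nbhsr.
  exact: lt_nbhsl.
have [ckx k0 kl] := (continuous_within_itvP k l0).1 ck.
have kc' x : 0 <= x <= l -> k x = c.
  move=> /andP[]; rewrite le_eqVlt => /predU1P[<- _|x0].
    have h : k @ 0^'+ --> c.
      apply: (@cvg_trans _ ((fun=> c) @ 0^'+)); last exact: cvg_cst.
      apply: near_eq_cvg; near=> t; apply/esym/kc.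
      by apply/andP; split; near: t; [exact: nbhs_right_gt|exact: nbhs_right_lt].
    exact: (cvg_unique _ k0 h).
  rewrite le_eqVlt => /predU1P[->|xl]; last by rewrite kc// x0.
  have h : k @ l^'- --> c.
    apply: (@cvg_trans _ ((fun=> c) @ l^'-)); last exact: cvg_cst.
    apply: near_eq_cvg; near=> t; apply/esym/kc.
    by apply/andP; split; near: t; [exact: nbhs_left_gt|exact: nbhs_left_lt].
  exact: (cvg_unique _ kl h).
move=> x hx; have := kc' x hx; rewrite -(kc' 0) ?lexx ?ltW// /k.
rewrite {2}/G set_itv1 Rintegral_set1 subr0 => <-.
by rewrite subrK.
Unshelve. all: by end_near.
Qed.

End WeakDerivative.

(** * Eigenfunctions on an edge *)
Section EdgeSolutions.
Context {R : realType}.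
Local Notation C := R[i].
Local Notation mu := (@lebesgue_measure R).
Variable l : R.
Hypothesis l0 : 0 < l.
Local Notation D := (`[0%R, l]%classic).

Lemma le_of_eq (x y : \bar R) : x = y -> (x <= y)%E. Proof. by move=> ->. Qed.

(** Integrate [|u| <= e + u ^ 2 / e]; for small [d] a small [e] with [d / e] small
    can be chosen. *)
Lemma L1_le_L2 (u v : R -> R) (e d : R) : 0 < e ->
  measurable_fun D u -> measurable_fun D v ->
  (\int[mu]_(x in D) (u x ^+ 2 + v x ^+ 2)%:E <= d%:E)%E ->
  (\int[mu]_(x in D) `|u x|%:E <= (e * l + e^-1 * d)%:E)%E.
Proof.
move=> e0 mu_ mv hd.
have e0' : 0 <= e^-1 by rewrite invr_ge0 ltW.
have msq : measurable_fun D (fun x => (u x ^+ 2 + v x ^+ 2)%:E).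
  by apply/measurable_EFinP; apply: measurable_funD; apply: measurable_funX.
apply: (@le_trans _ _ (\int[mu]_(x in D) (e%:E + e^-1%:E * (u x ^+ 2 + v x ^+ 2)%:E))%E).
  apply: ge0_le_integral => //.
  - by apply/measurable_EFinP; apply: measurableT_comp.
  - by apply: emeasurable_funD => //; apply: measurable_funeM.
  - move=> x _; rewrite -EFinM -EFinD lee_fin.
    have [ue|ue] := leP `|u x| e.
      by apply: le_trans ue _; rewrite lerDl mulr_ge0// addr_ge0// sqr_ge0.
    apply: (@le_trans _ _ (e^-1 * u x ^+ 2)).
      rewrite -normr_id -real_normK ?num_real// expr2 mulrA normr_id ler_peMl//.
      by rewrite mulrC ler_pdivlMr// mul1r ltW.
    by apply: ler_wpDl; [exact: ltW|rewrite ler_wpM2l// lerDl sqr_ge0].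
rewrite ge0_integralD//; last 3 first.
- by move=> x _; rewrite lee_fin ltW.
- by move=> x _; rewrite -EFinM lee_fin mulr_ge0// addr_ge0// sqr_ge0.
- exact: measurable_funeM.
rewrite ge0_integralZl_EFin//; last by move=> x _; rewrite lee_fin addr_ge0// sqr_ge0.
rewrite EFinD leeD//.
  have hmu : mu D = l%:E.
    by apply: etrans (lebesgue_measure_itv `[0, l]) _; rewrite /= lte_fin l0 oppr0 adde0.
  have mD : measurable (D : set (measurableTypeR R)) by exact: measurable_itv.
  apply: le_of_eq; apply: etrans (integral_cst mu mD e%:E) _.
  by rewrite EFinM; congr (_ * _)%E.
by rewrite EFinM lee_pmul2l// lte_fin invr_gt0.
Qed.

Lemma L2_sqnorm_ge0 (h : R -> C) : (0 <= L2_sqnorm l h)%E.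
Proof. by apply: integral_ge0 => x _; rewrite lee_fin addr_ge0// sqr_ge0. Qed.

(** The squared norm of [W_2] is a sum of squared [L^2] norms of complex functions;
    on a bounded interval these control the [L^1] norms of the real and imaginary
    parts that [weak_ftc] is about. *)
Lemma W2_L1 (p : C -> R) (f f1 f2 : R -> C) :
  p = Re \/ p = Im -> in_W2 l f f1 f2 ->
  [/\ measurable_fun D (p \o f), measurable_fun D (p \o f1), measurable_fun D (p \o f2) &
   exists phi : nat -> R -> R, (forall n, C2 (phi n)) /\
   forall e : R, 0 < e -> exists n,
     [/\ (\int[mu]_(x in D) `|phi n x - p (f x)|%:E <= e%:E)%E,
         (\int[mu]_(x in D) `|derive1n 1 (phi n) x - p (f1 x)|%:E <= e%:E)%E &
         (\int[mu]_(x in D) `|derive1n 2 (phi n) x - p (f2 x)|%:E <= e%:E)%E]].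
Proof.
move=> hp [[mRf mIf] [mRf1 mIf1] [mRf2 mIf2] [phi [hphi hW]]].
split; [by case: hp => ->|by case: hp => ->|by case: hp => ->|].
exists (fun n => p \o phi n); split.
  by move=> n; have [h1 h2] := hphi n; case: hp => ->; [exact: h1|exact: h2].
move=> e e0.
pose e1 := e / (2 * (l + 1)).
have e10 : 0 < e1 by rewrite divr_gt0// mulr_gt0// addr_gt0.
pose d := e1 * e1.
have d0 : 0 < d by rewrite mulr_gt0.
have hd : e1 * l + e1^-1 * d <= e.
  rewrite /d mulKf ?gt_eqF// -[X in _ + X]mulr1 -mulrDr /e1.
  rewrite invfM mulrA mulfVK ?gt_eqF ?addr_gt0//.
  by rewrite ler_pdivrMr// ler_peMr ?(ltW e0)// ler1n.
pose W n := W2_sqnorm l (fun x => phi n x - f x)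
    (fun x => cderiv 1 (phi n) x - f1 x) (fun x => cderiv 2 (phi n) x - f2 x).
have [n hn] : exists n, (W n <= d%:E)%E.
  move/fine_cvgP : hW => [hfin hcv].
  have hlt : \forall n \near \oo, fine (W n) < d by exact: (cvgr_lt _ hcv _ d0).
  near \oo => n; exists n.
  have h1 : W n \is a fin_num by near: n.
  by rewrite -(fineK h1) lee_fin ltW//; near: n; exact: hlt.
exists n.
have parts (h g : R -> C) : measurable_fun D (Re \o h) -> measurable_fun D (Im \o h) ->
    measurable_fun D (Re \o g) -> measurable_fun D (Im \o g) ->
    (L2_sqnorm l (fun x => (h x - g x)%R) <= d%:E)%E ->
    (\int[mu]_(x in D) `|p (h x) - p (g x)|%:E <= e%:E)%E.
  move=> m1 m2 m3 m4 hL.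
  apply: le_trans (_ : (_ <= (e1 * l + e1^-1 * d)%:E)%E) _; last by rewrite lee_fin.
  have mR : measurable_fun D (fun x => Re (h x) - Re (g x)) by exact: measurable_funB.
  have mI : measurable_fun D (fun x => Im (h x) - Im (g x)) by exact: measurable_funB.
  case: hp => ->.
    apply: (@L1_le_L2 _ (fun x => Im (h x) - Im (g x))) => //.
    apply: le_trans hL; apply: le_of_eq; apply: eq_integral => x _.
    by rewrite Re_add Im_add Re_opp Im_opp.
  apply: (@L1_le_L2 _ (fun x => Re (h x) - Re (g x))) => //.
  apply: le_trans hL; apply: le_of_eq; apply: eq_integral => x _.
  by rewrite Re_add Im_add Re_opp Im_opp addrC.
have mcont (h : R -> R) : continuous h -> measurable_fun D h.
  move=> ch; apply: subspace_continuous_measurable_fun => //.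
  exact: continuous_subspaceT.
have cder (h : R -> R) : (forall x, derivable h x 1) -> continuous h.
  by move=> hd' x; apply: differentiable_continuous; apply/derivable1_diffP.
have [[r1 r2 r3] [i1 i2 i3]] := hphi n.
have n0 (a b c : R -> C) : (W2_sqnorm l a b c <= d%:E)%E ->
   [/\ (L2_sqnorm l a <= d%:E)%E, (L2_sqnorm l b <= d%:E)%E & (L2_sqnorm l c <= d%:E)%E].
  rewrite /W2_sqnorm => h; split; apply: le_trans h.
  - by rewrite -addeA leeDl// adde_ge0 ?L2_sqnorm_ge0.
  - by rewrite addeAC leeDr// adde_ge0 ?L2_sqnorm_ge0.
  - by rewrite leeDr// adde_ge0 ?L2_sqnorm_ge0.
have [hn0 hn1 hn2] := n0 _ _ _ hn.
split.
- exact: (parts (phi n) f (mcont _ (cder _ r1)) (mcont _ (cder _ i1)) mRf mIf hn0).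
- have e1' : (fun x => p (cderiv 1 (phi n) x)) = derive1n 1 (p \o phi n) by case: hp => ->.
  have m1 : measurable_fun D (Re \o cderiv 1 (phi n)).
    exact: (mcont (derive1n 1 (fun y => Re (phi n y))) (cder _ r2)).
  have m2 : measurable_fun D (Im \o cderiv 1 (phi n)).
    exact: (mcont (derive1n 1 (fun y => Im (phi n y))) (cder _ i2)).
  rewrite -e1'; exact: (parts (cderiv 1 (phi n)) f1 m1 m2 mRf1 mIf1 hn1).
- have e2' : (fun x => p (cderiv 2 (phi n) x)) = derive1n 2 (p \o phi n) by case: hp => ->.
  have m1 : measurable_fun D (Re \o cderiv 2 (phi n)).
    exact: (mcont (derive1n 2 (fun y => Re (phi n y))) r3).
  have m2 : measurable_fun D (Im \o cderiv 2 (phi n)).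
    exact: (mcont (derive1n 2 (fun y => Im (phi n y))) i3).
  rewrite -e2'; exact: (parts (cderiv 2 (phi n)) f2 m1 m2 mRf2 mIf2 hn2).
Unshelve. all: by end_near.
Qed.

Lemma Rint_is_derive (f g : R -> R) x : 0 < x < l -> {within `[0, l], continuous g} ->
  (forall x, 0 <= x <= l -> f x = f 0 + \int[mu]_(t in `[0, x]) g t) ->
  is_derive x (1 : R) f (g x).
Proof.
move=> /andP[x0 xl] cg fE.
have lin : 0 <= l <= l by rewrite lexx ltW.
have [cgx _ _] := (continuous_within_itvP g l0).1 cg.
have xin : x \in `]0, l[ by rewrite in_itv /= x0.
have [dG Gx] := continuous_FTC1_closed xl (within_integrable lin cg) x0 (cgx x xin).
have hG : is_derive x (1 : R) (fun y => \int[mu]_(t in `[0, y]) g t) (g x).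
  by rewrite -Gx derive1E; exact: DeriveDef.
have hG' := is_dD (is_derive_cst (f 0) x (1 : R)) hG.
rewrite add0r in hG'.
apply: near_eq_is_derive hG' => //.
near=> t; apply/esym/fE; apply/andP; split; apply/ltW; near: t.
  exact: lt_nbhsr.
exact: lt_nbhsl.
Unshelve. all: by end_near.
Qed.

Lemma const_of_deriv0 (h : R -> R) : {within `[0, l], continuous h} ->
  (forall x, 0 < x < l -> is_derive x (1 : R) h 0) -> forall x, 0 <= x <= l -> h x = h 0.
Proof.
move=> ch dh x /andP[x0 xl].
have [|||c _ e] := @MVT_segment R h (fun=> 0) 0 x => //.
- by move=> t; rewrite in_itv /= => /andP[t0 tx]; apply: dh; rewrite t0 (lt_le_trans tx).
- by apply: within_subitv ch; rewrite x0.
- by apply/eqP; rewrite -subr_eq0 e mul0r.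
Qed.

(** The vector [(u, u1 / k)], rotated back by the angle [k x], has derivative zero. *)
Lemma oscillator (k : R) (u u1 : R -> R) : 0 < k ->
  {within `[0, l], continuous u} -> {within `[0, l], continuous u1} ->
  (forall x, 0 < x < l -> is_derive x (1 : R) u (u1 x)) ->
  (forall x, 0 < x < l -> is_derive x (1 : R) u1 (- k ^+ 2 * u x)) ->
  forall x, 0 <= x <= l ->
    u x = u 0 * cos (k * x) + u1 0 / k * sin (k * x) /\
    u1 x = k * (u1 0 / k * cos (k * x) - u 0 * sin (k * x)).
Proof.
move=> k0 cu cu1 du du1 x hx.
have k0' : k != 0 by rewrite gt_eqF.
have dc t : is_derive t (1 : R) (fun t => cos (k * t)) (- k * sin (k * t)).
  apply: (is_dE (@is_derive1_comp _ cos (fun t => k * t) _ _ _ (is_derive_cos _) (is_derive_linear k _))).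
  by rewrite mulrC mulrN mulNr.
have ds t : is_derive t (1 : R) (fun t => sin (k * t)) (k * cos (k * t)).
  apply: (is_dE (@is_derive1_comp _ sin (fun t => k * t) _ _ _ (is_derive_sin _) (is_derive_linear k _))).
  by rewrite mulrC.
have cder (h dh : R -> R) : (forall x, is_derive x (1 : R) h (dh x)) -> {within `[0, l], continuous h}.
  move=> hd; apply: continuous_subspaceT => t; apply: differentiable_continuous.
  by apply/derivable1_diffP; have hdt := hd t; exact: (@ex_derive _ _ _ _ _ _ _ hdt).
have cc := cder _ _ dc; have cs := cder _ _ ds.
pose A t := u t * cos (k * t) - k^-1 * (u1 t * sin (k * t)).
pose B t := u t * sin (k * t) + k^-1 * (u1 t * cos (k * t)).
have hA : A x = A 0.
  apply: const_of_deriv0 => // [t|t ht].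
    apply: cvgB; first by apply: cvgM; [exact: cu|exact: cc].
    by apply: cvgM; [exact: cvg_cst|apply: cvgM; [exact: cu1|exact: cs]].
  apply: (is_dE (is_dB (is_dM (du t ht) (dc t)) (is_dM (is_derive_cst k^-1 t (1 : R)) (is_dM (du1 t ht) (ds t))))).
  by rewrite /=; field.
have hB : B x = B 0.
  apply: const_of_deriv0 => // [t|t ht].
    apply: cvgD; first by apply: cvgM; [exact: cu|exact: cs].
    by apply: cvgM; [exact: cvg_cst|apply: cvgM; [exact: cu1|exact: cc]].
  apply: (is_dE (is_dD (is_dM (du t ht) (ds t)) (is_dM (is_derive_cst k^-1 t (1 : R)) (is_dM (du1 t ht) (dc t))))).
  by rewrite /=; field.
have A0 : A 0 = u 0 by rewrite /A mulr0 cos0 sin0 !mulr0 mulr1 subr0.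
have B0 : B 0 = u1 0 / k by rewrite /B mulr0 cos0 sin0 !mulr0 mulr1 add0r mulrC.
have cs1 := cos2Dsin2 (k * x).
rewrite -A0 -B0 -hA -hB /A /B.
move: (cos (k * x)) (sin (k * x)) cs1 => c s cs1; split.
  have -> : (u x * c - k^-1 * (u1 x * s)) * c + (u x * s + k^-1 * (u1 x * c)) * s =
    u x * (c ^+ 2 + s ^+ 2) by ring.
  by rewrite cs1 mulr1.
have -> : k * ((u x * s + k^-1 * (u1 x * c)) * c - (u x * c - k^-1 * (u1 x * s)) * s) =
  u1 x * (c ^+ 2 + s ^+ 2) by field.
by rewrite cs1 mulr1.
Qed.

(** By [weak_ftc] the weak derivatives of an eigenfunction are classical ones, so
    that it solves the equation of the harmonic oscillator. *)
Lemma edge_solution (k : R) (f f1 f2 : R -> C) : 0 < k ->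
  on_parts (fun h => {within `[0, l], continuous h}) f ->
  on_parts (fun h => {within `[0, l], continuous h}) f1 ->
  in_W2 l f f1 f2 ->
  {ae mu, forall x : R, 0 <= x <= l -> (k ^+ 2)%:C%C * f x = - f2 x} ->
  forall x, 0 <= x <= l ->
    f x = f 0 * (cos (k * x))%:C%C + f1 0 * (k^-1 * sin (k * x))%:C%C /\
    f1 x = f1 0 * (cos (k * x))%:C%C - f 0 * (k * sin (k * x))%:C%C.
Proof.
move=> k0 [cRf cIf] [cRf1 cIf1] hW hae x hx.
have main (p : C -> R) : p = Re \/ p = Im ->
   {within `[0, l], continuous (p \o f)} -> {within `[0, l], continuous (p \o f1)} ->
   p (f x) = p (f 0) * cos (k * x) + p (f1 0) / k * sin (k * x) /\
   p (f1 x) = k * (p (f1 0) / k * cos (k * x) - p (f 0) * sin (k * x)).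
  move=> hp cf cf1.
  have [mf mf1 mf2 [phi [hC2 hphi]]] := W2_L1 hp hW.
  have d1 n x' : is_derive x' (1 : R) (phi n) (derive1n 1 (phi n) x').
    by have [h _ _] := hC2 n; rewrite /= derive1E; exact: DeriveDef.
  have d2 n x' : is_derive x' (1 : R) (derive1n 1 (phi n)) (derive1n 2 (phi n) x').
    have [_ h _] := hC2 n; rewrite [derive1n 2 _ _]derive1E; exact: DeriveDef (h x') _.
  have c1 n : continuous (derive1n 1 (phi n)).
    move=> x'; apply: differentiable_continuous; apply/derivable1_diffP.
    by have [_ h _] := hC2 n; exact: h.
  have conv1 e : 0 < e -> exists n,
      (\int[mu]_(x in D) `|phi n x - p (f x)|%:E <= e%:E)%E /\
      (\int[mu]_(x in D) `|derive1n 1 (phi n) x - p (f1 x)|%:E <= e%:E)%E.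
    by move=> /hphi[n [h1 h2 _]]; exists n.
  have [_ F1] := weak_ftc l0 cf mf1 d1 c1 conv1.
  pose g2 t := - k ^+ 2 * p (f t).
  have cg2 : {within `[0, l], continuous g2}.
    by move=> t; apply: cvgM; [exact: cvg_cst|exact: cf].
  have mg2 : measurable_fun D g2 by exact: subspace_continuous_measurable_fun.
  have c2 n : continuous (derive1n 2 (phi n)) by have [] := hC2 n.
  have m2 n : measurable_fun D (derive1n 2 (phi n)).
    apply: subspace_continuous_measurable_fun => //.
    by apply: continuous_subspaceT; exact: c2.
  have conv2 e : 0 < e -> exists n,
      (\int[mu]_(x in D) `|derive1n 1 (phi n) x - p (f1 x)|%:E <= e%:E)%E /\
      (\int[mu]_(x in D) `|derive1n 2 (phi n) x - g2 x|%:E <= e%:E)%E.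
    move=> /hphi[n [_ h2 h3]]; exists n; split => //.
    apply: le_trans h3; apply: le_of_eq; apply: ge0_ae_eq_integral => //.
    - apply/measurable_EFinP; apply: measurableT_comp => //.
      exact: (measurable_funB (m2 n) mg2).
    - apply/measurable_EFinP; apply: measurableT_comp => //.
      exact: (measurable_funB (m2 n) mf2).
    - apply: (@filterS _ _ (ae_filter_ringOfSetsType mu) _ _ _ hae) => t ht; rewrite /= in_itv /= => /ht hft.
      congr (`| _ - _ |%:E); rewrite /g2.
      have -> : f2 t = - ((k ^+ 2)%:C%C * f t) by rewrite hft opprK.
      by case: hp => ->; rewrite ?Re_opp ?Im_opp ?Re_real_mul ?Im_mul /= ?mul0r ?addr0 mulNr.
  have [_ F2] := weak_ftc l0 cf1 mg2 d2 c2 conv2.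
  apply: (@oscillator k (p \o f) (p \o f1)) => //.
  - by move=> t ht; exact: Rint_is_derive cf1 F1.
  - by move=> t ht; exact: (Rint_is_derive ht cg2 F2).
have [r1 r2] := main Re (or_introl erefl) cRf cRf1.
have [i1 i2] := main Im (or_intror erefl) cIf cIf1.
have k0' : k != 0 by rewrite gt_eqF.
split; apply: complex_ext; rewrite ?r1 ?r2 ?i1 ?i2 !(Re_add, Im_add, Re_opp, Im_opp, Re_mul, Im_mul) /=; field; do ?exact: k0'.
Qed.

End EdgeSolutions.

(** * Trigonometric functions *)
Section Trigonometric.
Context {R : realType}.
Local Notation C := R[i].
Variable k : R.

Definition rtrig (p q x : R) : R := p * cos (k * x) + q * sin (k * x).
Definition trig (P Q : C) (x : R) : C := P * (cos (k * x))%:C%C + Q * (sin (k * x))%:C%C.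

Lemma is_derive_rtrig p q x : is_derive x (1 : R) (rtrig p q) (rtrig (k * q) (- k * p) x).
Proof.
have dc : is_derive x (1 : R) (fun t => cos (k * t)) (- k * sin (k * x)).
  apply: (is_dE (@is_derive1_comp _ cos (fun t => k * t) _ _ _ (is_derive_cos _) (is_derive_linear k _))).
  by rewrite mulrC mulrN mulNr.
have ds : is_derive x (1 : R) (fun t => sin (k * t)) (k * cos (k * x)).
  apply: (is_dE (@is_derive1_comp _ sin (fun t => k * t) _ _ _ (is_derive_sin _) (is_derive_linear k _))).
  by rewrite mulrC.
apply: (is_dE (is_dD (is_dM (is_derive_cst p x (1 : R)) dc) (is_dM (is_derive_cst q x (1 : R)) ds))).
by rewrite /rtrig /=; ring.
Qed.

Lemma derive1_rtrig p q : derive1 (rtrig p q) = rtrig (k * q) (- k * p).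
Proof.
by apply: funext => x; rewrite derive1E; have [_] := is_derive_rtrig p q x.
Qed.

Lemma continuous_rtrig p q : continuous (rtrig p q).
Proof.
move=> x; apply: differentiable_continuous; apply/derivable1_diffP.
by have hd := is_derive_rtrig p q x; exact: (@ex_derive _ _ _ _ _ _ _ hd).
Qed.

Lemma C2_rtrig p q : C2 (rtrig p q).
Proof.
have d1 p' q' x : derivable (rtrig p' q') x 1.
  by have hd := is_derive_rtrig p' q' x; exact: (@ex_derive _ _ _ _ _ _ _ hd).
split; first exact: d1.
- by rewrite /= derive1_rtrig; exact: d1.
- by rewrite /= !derive1_rtrig; exact: continuous_rtrig.
Qed.

Lemma Re_trig P Q : (fun x => Re (trig P Q x)) = rtrig (Re P) (Re Q).
Proof.
by apply: funext => x; rewrite Re_add !Re_mul /= !mulr0 !subr0.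
Qed.

Lemma Im_trig P Q : (fun x => Im (trig P Q x)) = rtrig (Im P) (Im Q).
Proof.
by apply: funext => x; rewrite Im_add !Im_mul /= !mulr0 !add0r.
Qed.

Lemma trig_parts (H : (R -> R) -> Prop) P Q :
  (forall p q, H (rtrig p q)) -> on_parts H (trig P Q).
Proof. by move=> h; rewrite /on_parts Re_trig Im_trig. Qed.

Lemma cderiv1_trig P Q : cderiv 1 (trig P Q) = trig (k%:C%C * Q) (- k%:C%C * P).
Proof.
apply: funext => x; rewrite /cderiv Re_trig Im_trig /= !derive1_rtrig.
apply: complex_ext; rewrite /= ?(Re_add, Im_add, Re_mul, Im_mul, Re_opp, Im_opp) /= /rtrig; ring.
Qed.

Lemma cderiv2_trig P Q : cderiv 2 (trig P Q) = trig (- k%:C%C ^+ 2 * P) (- k%:C%C ^+ 2 * Q).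
Proof.
apply: funext => x; rewrite /cderiv Re_trig Im_trig /= !derive1_rtrig expr2.
apply: complex_ext; rewrite /= ?(Re_add, Im_add, Re_mul, Im_mul, Re_opp, Im_opp) /= /rtrig; ring.
Qed.

Lemma within_trig (l : R) P Q :
  on_parts (fun h => {within `[0, l], continuous h}) (trig P Q).
Proof. by apply: trig_parts => p q; apply: continuous_subspaceT; exact: continuous_rtrig. Qed.

Lemma measurable_trig (l : R) P Q : on_parts (measurable_fun `[0, l]) (trig P Q).
Proof.
apply: trig_parts => p q; apply: subspace_continuous_measurable_fun => //.
by apply: continuous_subspaceT; exact: continuous_rtrig.
Qed.

Lemma in_W2_trig (l : R) P Q : in_W2 l (trig P Q)
  (trig (k%:C%C * Q) (- k%:C%C * P)) (trig (- k%:C%C ^+ 2 * P) (- k%:C%C ^+ 2 * Q)).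
Proof.
split; try exact: measurable_trig.
exists (fun=> trig P Q); split.
  by move=> _; apply: trig_parts => p q; exact: C2_rtrig.
have z (g h : R -> C) : g = h -> L2_sqnorm l (fun x => g x - h x) = 0%E.
  move=> ->; rewrite /L2_sqnorm; under eq_integral => x _ do rewrite subrr /= expr0n /= addr0.
  exact: integral0.
rewrite /W2_sqnorm (z _ _ (erefl _)) (z _ _ (cderiv1_trig P Q)) (z _ _ (cderiv2_trig P Q)) !adde0.
exact: cvg_cst.
Qed.

Lemma trig0 P Q : trig P Q 0 = P.
Proof. by rewrite /trig mulr0 cos0 sin0 mulr1 mulr0 addr0. Qed.

Lemma trig_inj (l : R) P Q : 0 < k -> 0 < l ->
  (forall x, 0 <= x <= l -> trig P Q x = 0) -> P = 0 /\ Q = 0.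
Proof.
move=> k0 l0 h.
have P0 : P = 0 by rewrite -(h 0) ?lexx ?ltW// trig0.
split=> //; pose x := Num.min l k^-1.
have x0 : 0 < x by rewrite lt_min l0 invr_gt0.
have kx : 0 < k * x < pi.
  rewrite mulr_gt0//=; apply: (@le_lt_trans _ _ 1).
    by rewrite -(mulfV (lt0r_neq0 k0)) ler_pM2l// ge_min lexx orbT.
  by apply: lt_le_trans (pi_ge2 R); rewrite ltr1n.
have := h x; rewrite ltW//= ge_min lexx => /(_ isT).
rewrite /trig P0 mul0r add0r => /eqP; rewrite mulf_eq0 => /orP[/eqP//|].
have := sin_gt0_pi kx; move=> s0 /eqP/complexI e.
by rewrite e ltxx in s0.
Qed.

End Trigonometric.

(** * Bonds and scattering *)
Section Bonds.
Context {R : realType}.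
Variable G : qgraph R.

(** Bonds are the oriented edges: [(e, true)] runs from [src e] to [tgt e]. *)
Definition bond : finType := (edge G * bool)%type.
Definition tail (b : bond) : vert G := if b.2 then src b.1 else tgt b.1.
Definition head (b : bond) : vert G := if b.2 then tgt b.1 else src b.1.
Definition brev (b : bond) : bond := (b.1, ~~ b.2).

Lemma brevK : involutive brev. Proof. by case=> e d; rewrite /brev /= negbK. Qed.
Lemma tail_brev b : tail (brev b) = head b. Proof. by case: b => e []. Qed.
Lemma head_brev b : head (brev b) = tail b. Proof. by case: b => e []. Qed.

Lemma sum_bond (V : nmodType) (F : bond -> V) :
  \sum_b F b = \sum_(e : edge G) F (e, true) + \sum_(e : edge G) F (e, false).
Proof.
rewrite -big_split /= (eq_bigr (fun p : bond => F (p.1, p.2))); last by case.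
rewrite -(pair_bigA _ (fun e d => F (e, d))) /=; apply: eq_bigr => e _.
by rewrite big_bool.
Qed.

Lemma card_tail v : (\sum_(b : bond | tail b == v) 1 = deg v)%N.
Proof.
rewrite big_mkcond sum_bond /= /deg -!sum1_card.
by congr (_ + _)%N; rewrite -big_mkcond; apply: eq_bigl => e; rewrite inE.
Qed.

Lemma deg_gt0 (v : vert G) : (0 < deg v)%N.
Proof. by rewrite lt0n; exact: deg_neq0. Qed.

(** The amplitude with which a wave that arrives along the bond [b] leaves along
    the bond [c], under continuity and the Kirchhoff condition. *)
Definition bscat (b c : bond) : R :=
  if head b == tail c then 2 / (deg (head b))%:R - (c == brev b)%:R else 0.

(** At a vertex of degree [d] the matrix is [(2 / d) J - 1] up to the order of
    the columns, a reflection since [J ^ 2 = d J]. *)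
Lemma bscat_orth (b b' : bond) : \sum_c bscat b c * bscat b' c = (b == b')%:R.
Proof.
have [hb|hb] := eqVneq (head b) (head b'); last first.
  rewrite big1; last first.
    move=> c _; rewrite /bscat; case: eqP => [h|]; last by rewrite mul0r.
    by rewrite -h (eq_sym (head b')) (negPf hb) mulr0.
  by have [e|//] := eqVneq b b'; rewrite e eqxx in hb.
set v := head b in hb.
have d0 : (deg v)%:R != 0 :> R by rewrite pnatr_eq0 -lt0n deg_gt0.
have cnt : \sum_(c : bond | v == tail c) (1 : R) = (deg v)%:R.
  rewrite -card_tail natr_sum; apply: eq_bigl => c; exact: eq_sym.
have one (x : bond) : v == head x -> \sum_(c : bond | v == tail c) (c == brev x)%:R = 1 :> R.
  move=> hx; rewrite (bigD1 (brev x)) /=; last by rewrite tail_brev.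
  by rewrite eqxx big1 ?addr0// => c /andP[_ /negPf ->].
have both : \sum_(c : bond | v == tail c) (c == brev b)%:R * (c == brev b')%:R = (b == b')%:R :> R.
  rewrite (bigD1 (brev b)) /=; last by rewrite tail_brev.
  rewrite eqxx mul1r (inj_eq (can_inj brevK)) big1 ?addr0// => c /andP[_ /negPf ->].
  by rewrite mul0r.
transitivity (\sum_(c : bond | v == tail c)
   (2 / (deg v)%:R - (c == brev b)%:R) * (2 / (deg v)%:R - (c == brev b')%:R) : R).
  rewrite [RHS]big_mkcond; apply: eq_bigr => c _; rewrite /bscat -/v -hb.
  by case: ifP; rewrite ?mul0r.
under eq_bigr do rewrite mulrBl !mulrBr.
rewrite !sumrB.
have -> : \sum_(c : bond | v == tail c) 2 / (deg v)%:R * (2 / (deg v)%:R) =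
   2 / (deg v)%:R * (2 / (deg v)%:R) * (deg v)%:R :> R.
  by rewrite -cnt mulr_sumr; apply: eq_bigr => c _; rewrite mulr1.
rewrite -mulr_sumr one -?hb// -mulr_suml one// both.
by field.
Qed.

Lemma sum_rev v (V : nmodType) (F : bond -> V) :
  \sum_(b : bond | head b == v) F b = \sum_(b : bond | tail b == v) F (brev b).
Proof.
rewrite (reindex_inj (can_inj brevK)) /=.
by apply: eq_bigl => b; rewrite head_brev.
Qed.

Local Notation C := R[i].

(** Let [inc] be the incoming amplitudes at a vertex of degree [d], where [w b] is the
    phase acquired along [b].  Invariance of the outgoing amplitudes reads
    [a + inc = 2 / d * \sum inc]: the common value is that of the function at the
    vertex, and summing over the bonds gives the Kirchhoff condition. *)
Lemma scattering_invariant (a w : bond -> C) :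
  (forall c, \sum_b a b * (w b * (bscat b c)%:C%C) = a c) <->
  (exists fv : vert G -> C, forall b, a b + a (brev b) * w (brev b) = fv (tail b)) /\
  (forall v, \sum_(b : bond | tail b == v) (a b - a (brev b) * w (brev b)) = 0).
Proof.
pose inc b := a (brev b) * w (brev b).
have sE c : \sum_b a b * (w b * (bscat b c)%:C%C) =
   (2 / (deg (tail c))%:R) * (\sum_(b : bond | tail b == tail c) inc b) - inc c.
  transitivity (\sum_(b : bond | head b == tail c)
     a b * (w b * (2 / (deg (tail c))%:R - (c == brev b)%:R))).
    rewrite [RHS]big_mkcond; apply: eq_bigr => b _; rewrite /bscat.
    case: eqP => [->|_]; last by rewrite rmorph0 !mulr0.
    by rewrite rmorphB fmorph_div !rmorph_nat.
  rewrite sum_rev.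
  rewrite (eq_bigr (fun b => 2 / (deg (tail c))%:R * inc b - (b == c)%:R * inc b)); last first.
    by move=> b _; rewrite brevK /inc (eq_sym b); ring.
  rewrite sumrB -mulr_sumr; congr (_ - _).
  rewrite (bigD1 c)//= eqxx mul1r big1 ?addr0// => b /andP[_ /negPf ->].
  by rewrite mul0r.
have d0 v : (deg v)%:R != 0 :> C by rewrite pnatr_eq0; exact: deg_neq0.
have cnt v : \sum_(c : bond | tail c == v) (1 : C) = (deg v)%:R.
  by rewrite -card_tail natr_sum.
split=> [h|[[fv hfv] hK] c].
  have e c : a c + inc c = 2 / (deg (tail c))%:R * (\sum_(b : bond | tail b == tail c) inc b).
    by rewrite -[a c]h sE subrK.
  split; first by exists (fun v => 2 / (deg v)%:R * (\sum_(b : bond | tail b == v) inc b)).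
  move=> v; rewrite (eq_bigr (fun b => 2 / (deg v)%:R * (\sum_(b : bond | tail b == v) inc b) * 1 - 2 * inc b)); last first.
    move=> b /eqP <-; rewrite mulr1 -e /inc; ring.
  rewrite sumrB -!mulr_sumr cnt; field; exact: d0.
rewrite sE; set v := tail c.
have hK' := hK v.
rewrite (eq_bigr (fun b => fv v * 1 - 2 * inc b)) in hK'; last first.
  by move=> b /eqP <-; rewrite -hfv /inc; ring.
rewrite sumrB -!mulr_sumr cnt in hK'.
have -> : 2 / (deg v)%:R * (\sum_(b : bond | tail b == v) inc b) = fv v.
  have -> : fv v = fv v * (deg v)%:R / (deg v)%:R by rewrite mulfK.
  by move/eqP: hK'; rewrite subr_eq0 => /eqP ->; ring.
by rewrite -hfv /inc addrK.
Qed.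

End Bonds.

(** * Multiplicities of eigenvalues *)
Section Multiplicity.
Context {R : realType}.
Local Notation C := R[i].
Variable G : qgraph R.

Lemma multiplicity_le (a : C) (n m : nat) :
  multiplicity G a n -> multiplicity G a m -> (n <= m)%N.
Proof.
move=> [b [hb ib _]] [b' [_ _ sb']].
have hM i : exists c : 'I_m -> C, Defs.geq (b i) (lincomb c b') by exact: sb'.
have [M hM'] := choice hM.
pose A : 'M[C]_(n, m) := \matrix_(i, j) M i j.
suff : row_free A by move=> /eqP <-; exact: rank_leq_col.
rewrite -kermx_eq0; apply/eqP/row_matrixP => i; rewrite row0.
have h0 : row i (kermx A) *m A = 0 by apply/sub_kermxP; exact: row_sub.
apply/rowP => j; rewrite [RHS]mxE; move: j.
apply: ib => e x hx; rewrite /lincomb.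
transitivity (\sum_j (row i (kermx A) *m A) 0 j * b' j e x); last first.
  by rewrite h0 big1// => j _; rewrite mxE mul0r.
under [RHS]eq_bigr do rewrite [(_ *m A) _ _]mxE mulr_suml.
rewrite exchange_big /=; apply: eq_bigr => j _.
rewrite (hM' j e x hx) /lincomb mulr_sumr; apply: eq_bigr => l _.
by rewrite [A _ _]mxE mulrA.
Qed.

Lemma multiplicity_unique (a : C) (n m : nat) :
  multiplicity G a n -> multiplicity G a m -> n = m.
Proof.
by move=> h1 h2; apply/eqP; rewrite eqn_leq (multiplicity_le h1 h2) (multiplicity_le h2 h1).
Qed.

Variables (n : nat) (beta : 'I_n -> bond G) (iota : bond G -> 'I_n).
Hypothesis betaK : cancel beta iota.
Hypothesis iotaK : cancel iota beta.

Definition bond_scat : 'M[R]_n := \matrix_(i, j) bscat (beta i) (beta j).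
Definition bond_len (i : 'I_n) : R := len (beta i).1.

Lemma bond_scat_orth : bond_scat *m bond_scat^T = 1%:M.
Proof.
apply/matrixP => i j; rewrite mxE.
transitivity (\sum_c bscat (beta i) c * bscat (beta j) c).
  rewrite (reindex beta) /=; last by exists iota => x _.
  by apply: eq_bigr => c _; rewrite !mxE.
by rewrite bscat_orth mxE (inj_eq (can_inj betaK)).
Qed.

Lemma bond_len_gt0 i : 0 < bond_len i. Proof. exact: len_gt0. Qed.

Variable k : R.
Hypothesis k0 : 0 < k.
Local Notation K := (k%:C%C).
Local Notation U := (scat bond_scat bond_len K).

Let wv (e : edge G) : C := wave (len e) K.

Lemma wvE e : wv e = (cos (k * len e) +i* sin (k * len e))%C.
Proof. by rewrite /wv /wave /= mulr0 oppr0 expR0 !mul1r mulrC. Qed.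

(** [amp a b] is the amplitude with which the wave travelling along [b] leaves
    the vertex [tail b]; on an edge [e], with the coordinate [x] running from
    [src e] to [tgt e], the two waves add up to [efun a e]. *)
Definition amp (a : 'rV[C]_n) (b : bond G) : C := a 0 (iota b).
Definition cosamp a (e : edge G) : C := amp a (e, true) + amp a (e, false) * wv e.
Definition sinamp a (e : edge G) : C :=
  'i%C * (amp a (e, true) - amp a (e, false) * wv e).
Definition efun (a : 'rV[C]_n) : gfun G := fun e => trig k (cosamp a e) (sinamp a e).
Definition efun' (a : 'rV[C]_n) : gfun G :=
  fun e => trig k (K * sinamp a e) (- K * cosamp a e).

Lemma efun0 a e : efun a e 0 = amp a (e, true) + amp a (e, false) * wv e.
Proof. exact: trig0. Qed.

Let ii : 'i%C * 'i%C = -1 :> C.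
Proof. by apply: complex_ext; rewrite /= ?mulr0 ?mul0r ?mulr1 ?mul1r ?addr0 ?sub0r ?oppr0. Qed.

Lemma wv_decomp e : exists c s : C, [/\ (cos (k * len e))%:C%C = c,
  (sin (k * len e))%:C%C = s, wv e = c + 'i%C * s & c * c + s * s = 1].
Proof.
exists (cos (k * len e))%:C%C, (sin (k * len e))%:C%C; split => //.
  by rewrite wvE; apply: complex_ext; rewrite /= ?mul0r ?mul1r ?mulr0 ?subr0 ?addr0 ?add0r.
by rewrite -!rmorphM -rmorphD -!expr2 cos2Dsin2.
Qed.

Lemma efun_len a e : efun a e (len e) = amp a (e, false) + amp a (e, true) * wv e.
Proof.
rewrite /efun /trig /cosamp /sinamp.
have [c [s [-> -> -> cs]]] := wv_decomp e.
set x := amp _ _; set y := amp _ _.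
transitivity (x * (c + 'i%C * s) + y * (c * c + s * s * - ('i%C * 'i%C))); first by ring.
by rewrite ii opprK mulr1 cs; ring.
Qed.

Lemma efun'0 a e :
  efun' a e 0 = 'i%C * K * (amp a (e, true) - amp a (e, false) * wv e).
Proof. by rewrite /efun' trig0 /sinamp; ring. Qed.

Lemma efun'_len a e :
  efun' a e (len e) = - ('i%C * K * (amp a (e, false) - amp a (e, true) * wv e)).
Proof.
rewrite /efun' /trig /cosamp /sinamp.
have [c [s [-> -> -> cs]]] := wv_decomp e.
set x := amp _ _; set y := amp _ _.
transitivity (- ('i%C * K * (y - x * (c + 'i%C * s))) +
  K * (- 'i%C * y * (c * c + s * s - 1) - (y * s * c + x * s) * ('i%C * 'i%C + 1))).
  by ring.
by rewrite ii cs; ring.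
Qed.

Lemma kirchhoff_efun a : kirchhoff (efun' a) <->
  forall v, \sum_(b : bond G | tail b == v) (amp a b - amp a (brev b) * wv (brev b).1) = 0.
Proof.
have e v : \sum_(e : edge G | src e == v) - efun' a e 0 +
   \sum_(e : edge G | tgt e == v) efun' a e (len e) =
   - ('i%C * K) * \sum_(b : bond G | tail b == v) (amp a b - amp a (brev b) * wv (brev b).1).
  rewrite [X in _ * X]big_mkcond sum_bond -!big_mkcond /= mulrDr !mulr_sumr.
  congr (_ + _); apply: eq_bigr => e _.
    by rewrite efun'0 mulNr.
  by rewrite efun'_len mulNr.
have iK : - ('i%C * K) != 0 :> C.
  rewrite oppr_eq0 mulf_eq0 negb_or; apply/andP; split.
    by rewrite eq_complex /= oner_eq0 andbF.
  by rewrite eq_complex /= gt_eqF.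
split=> h v; have := e v; rewrite h.
  by move/esym/eqP; rewrite mulf_eq0 (negPf iK) => /eqP.
by rewrite mulr0.
Qed.

Lemma continuity_efun a :
  (exists fv : vert G -> C, forall b, amp a b + amp a (brev b) * wv (brev b).1 = fv (tail b)) <->
  (exists fv : vert G -> C, forall e, efun a e 0 = fv (src e) /\ efun a e (len e) = fv (tgt e)).
Proof.
split=> -[fv h]; exists fv.
  by move=> e; rewrite efun0 efun_len; split; [exact: (h (e, true))|exact: (h (e, false))].
by move=> [e []]; have [h1 h2] := h e; rewrite /= -?efun0 -?efun_len.
Qed.

Lemma kernel_amp a : a *m U = a <->
  forall c, \sum_b amp a b * (wv b.1 * (bscat b c)%:C%C) = amp a c.
Proof.
have e j : (a *m U) 0 j = \sum_b amp a b * (wv b.1 * (bscat b (beta j))%:C%C).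
  rewrite mxE (reindex beta) /=; last by exists iota => x _.
  by apply: eq_bigr => i _; rewrite /amp betaK !mxE.
split=> [h c|h]; first by rewrite -[c]iotaK -e h iotaK.
by apply/rowP => j; rewrite e h /amp betaK.
Qed.

Lemma eigen_of_kernel a : a *m U = a -> eigenfun (k ^+ 2)%:C%C (efun a).
Proof.
move/kernel_amp/(scattering_invariant (amp a) (fun b => wv b.1)) => [hc hK].
exists (efun' a), (fun e => trig k (- K ^+ 2 * cosamp a e) (- K ^+ 2 * sinamp a e)); split.
- split; first by move=> e; exact: within_trig.
  exact/continuity_efun.
- by move=> e; exact: in_W2_trig.
- by move=> e; exact: within_trig.
- exact/kirchhoff_efun.
- move=> e; apply: aeW => x _.
  by rewrite /efun /trig rmorphXn; ring.
Qed.

Lemma kernel_of_eigen f : eigenfun (k ^+ 2)%:C%C f -> exists2 a, a *m U = a & Defs.geq f (efun a).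
Proof.
move=> [f1 [f2 [[cf [fv hfv]] hW cf1 hK hae]]].
have hE e x : 0 <= x <= len e ->
   f e x = f e 0 * (cos (k * x))%:C%C + f1 e 0 * (k^-1 * sin (k * x))%:C%C /\
   f1 e x = f1 e 0 * (cos (k * x))%:C%C - f e 0 * (k * sin (k * x))%:C%C.
  exact: (@edge_solution R (len e) (len_gt0 e) k (f e) (f1 e) (f2 e) k0
    (cf e) (cf1 e) (hW e) (hae e) x).
have Kn0 : K != 0 by rewrite eq_complex /= gt_eqF.
pose Q e := f1 e 0 / K.
pose A (b : bond G) : C :=
  if b.2 then (f b.1 0 - 'i%C * Q b.1) / 2 else (f b.1 0 + 'i%C * Q b.1) / 2 / wv b.1.
pose a : 'rV[C]_n := \row_i A (beta i).
have aA b : amp a b = A b by rewrite /amp mxE iotaK.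
have wn0 e : wv e != 0 by rewrite -cmod_gt0 cmod_wave expR_gt0.
have cE e : cosamp a e = f e 0 by rewrite /cosamp !aA /A /=; field; exact: wn0.
have sE e : sinamp a e = Q e.
  rewrite /sinamp !aA /A /=.
  have -> : 'i%C * ((f e 0 - 'i%C * Q e) / 2 - (f e 0 + 'i%C * Q e) / 2 / wv e * wv e) =
    - ('i%C * 'i%C) * Q e by field; exact: wn0.
  by rewrite ii opprK mul1r.
have hf e x : 0 <= x <= len e -> f e x = efun a e x /\ f1 e x = efun' a e x.
  move=> hx; have [-> ->] := hE e x hx; rewrite /efun /efun' cE sE /trig /Q; split.
    by rewrite rmorphM fmorphV; field.
  by rewrite rmorphM; field.
have h0 (e : edge G) : (0 : R) <= 0 <= len e by rewrite lexx ltW// len_gt0.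
have h1 (e : edge G) : 0 <= len e <= len e by rewrite lexx ltW// len_gt0.
exists a; last by move=> e x /hf[].
apply/kernel_amp/(scattering_invariant (amp a) (fun b => wv b.1)); split.
  apply/continuity_efun; exists fv => e.
  by have [<- <-] := hfv e; have [-> _] := hf e _ (h0 e); have [-> _] := hf e _ (h1 e).
apply/kirchhoff_efun => v; rewrite -[RHS](hK v); congr (_ + _); apply: eq_bigr => e _.
  by have [_ ->] := hf e _ (h0 e).
by have [_ ->] := hf e _ (h1 e).
Qed.

Lemma efun_lin m (c : 'I_m -> C) (v : 'I_m -> 'rV[C]_n) e x :
  efun (\sum_i c i *: v i) e x = \sum_i c i * efun (v i) e x.
Proof.
have hamp b : amp (\sum_i c i *: v i) b = \sum_i c i * amp (v i) b.
  by rewrite /amp summxE; apply: eq_bigr => i _; rewrite mxE.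
have hc : cosamp (\sum_i c i *: v i) e = \sum_i c i * cosamp (v i) e.
  rewrite /cosamp !hamp mulr_suml -big_split /=; apply: eq_bigr => i _; ring.
have hs : sinamp (\sum_i c i *: v i) e = \sum_i c i * sinamp (v i) e.
  rewrite /sinamp !hamp mulr_suml -sumrB mulr_sumr; apply: eq_bigr => i _; ring.
rewrite /efun /trig hc hs !mulr_suml -big_split /=; apply: eq_bigr => i _; ring.
Qed.

Lemma efun_inj a : Defs.geq (efun a) (fun _ _ => 0) -> a = 0.
Proof.
move=> h.
have hA b : amp a b = 0.
  case: b => e d.
  have [c0 s0] := trig_inj k0 (len_gt0 e) (h e).
  have wn0 : wv e != 0 by rewrite -cmod_gt0 cmod_wave expR_gt0.
  have e1 : amp a (e, true) - amp a (e, false) * wv e = 0.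
    apply/eqP; move/eqP: s0; rewrite /sinamp mulf_eq0 => /orP[|//].
    by rewrite eq_complex /= oner_eq0 andbF.
  have t0 : amp a (e, true) = 0.
    apply/eqP; move/eqP: (congr2 +%R c0 e1).
    rewrite /cosamp addr0 (_ : _ + _ = 2 * amp a (e, true)); last by ring.
    by rewrite mulf_eq0 pnatr_eq0.
  case: d => //; apply/eqP; move/eqP: e1.
  by rewrite t0 sub0r oppr_eq0 mulf_eq0 (negPf wn0) orbF.
by apply/rowP => i; rewrite mxE -(hA (beta i)) /amp betaK.
Qed.

(** [efun] is an isomorphism from the kernel of [1 - U] onto the eigenspace. *)
Lemma multiplicity_kernel : multiplicity G (k ^+ 2)%:C%C (n - \rank (1%:M - U)%R)%N.
Proof.
rewrite -mxrank_ker.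
set M := 1%:M - U; pose V := row_base (kermx M).
have kerP a : (a <= kermx M)%MS = (a *m U == a).
  rewrite /M; apply/sub_kermxP/eqP; rewrite mulmxBr mulmx1.
    by move/eqP; rewrite subr_eq0 => /eqP.
  by move=> ->; rewrite subrr.
exists (fun i => efun (row i V)); split.
- move=> i; apply: eigen_of_kernel; apply/eqP; rewrite -kerP.
  by rewrite -(eq_row_base (kermx M)) row_sub.
- move=> c hc; pose u : 'rV[C]_(\rank (kermx M)) := \row_i c i.
  have uV : u *m V = \sum_i c i *: row i V.
    by rewrite mulmx_sum_row; apply: eq_bigr => i _; rewrite mxE.
  have : u *m V = 0.
    apply: efun_inj => e x hx; rewrite uV efun_lin; exact: hc.
  rewrite -(mul0mx _ V) => /(row_free_inj (row_base_free _)) u0 i.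
  by have := congr1 (fun w : 'rV[C]_(\rank (kermx M)) => w 0 i) u0; rewrite !mxE.
- move=> f /kernel_of_eigen[a aU fa].
  have : (a <= V)%MS by rewrite eq_row_base kerP aU.
  move=> /submxP[u au]; exists (u 0) => e x hx; rewrite (fa e x hx) au mulmx_sum_row.
  exact: efun_lin.
Qed.

End Multiplicity.

(** * Shortest configurations *)
Local Close Scope classical_set_scope.

Section Configurations.
Context {R : realType}.

Lemma ex_min (X : finType) (P : pred X) (f : X -> R) : (exists x, P x) ->
  exists2 x, P x & forall y, P y -> f x <= f y.
Proof.
by move=> [x0 Px0]; case: (arg_minP f Px0) => x Px h; exists x.
Qed.

(** The elements outside [A] are fixed, so that the parity, [#|B|] minus the number
    of cycles, is that of [#|A| - 1]. *)
Lemma odd_perm_cycle (B : finType) (A : {set B}) (s : {perm B}) (b : B) :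
  perm_on A s -> A = porbit s b -> odd_perm s = ~~ odd #|A|.
Proof.
move=> sA Ab.
have bA : b \in A by rewrite Ab porbit_id.
have orb y : y \notin A -> porbit s y = [set y].
  move=> yA; apply/setP => x; rewrite inE; apply/porbitP/eqP => [[i ->]|->].
    by rewrite permX; elim: i => //= i ->; exact: out_perm yA.
  by exists 0%N; rewrite expg0 perm1.
have orbA y : y \in A -> porbit s y = A.
  by rewrite Ab => yA; apply/eqP; rewrite eq_porbit_mem.
have pE : porbits s = A |: [set [set y] | y in ~: A].
  apply/setP => X; rewrite !inE; apply/imsetP/orP => [[y _ ->]|].
    have [yA|yA] := boolP (y \in A); first by left; rewrite orbA.
    by right; rewrite orb//; apply/imsetP; exists y; rewrite ?inE.
  case=> [/eqP ->|/imsetP[y]]; first by exists b => //; rewrite orbA.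
  by rewrite inE => yA ->; exists y => //; rewrite orb.
rewrite /odd_perm pE cardsU1.
have -> : A \notin [set [set y] | y in ~: A].
  apply/imsetP => -[y]; rewrite inE => yA Ay.
  by move: yA; rewrite Ay inE eqxx.
rewrite card_imset; last exact: set1_inj.
rewrite -(cardsC A) add1n oddD /=.
by case: (odd #|A|); case: (odd _).
Qed.

(* [B] stands for the bonds and [E] for the edges of a graph, [nxt a b] says that
   [b] starts where [a] ends; no vertices are mentioned, so that the results
   apply to any numbering of the bonds. *)
Variables (B E : finType) (ed : B -> E) (rv : B -> B) (nxt : rel B).
Hypothesis rvK : involutive rv.
Hypothesis rv_neq : forall b, rv b != b.
Hypothesis ed_rv : forall b, ed (rv b) = ed b.
Hypothesis ed_onto : forall e, exists b, ed b = e.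
Hypothesis nxt_rv : forall b, nxt b (rv b).
Hypothesis nxt_trans : forall a b c, nxt a b -> nxt (rv b) c -> nxt a c.

(** A configuration is a permutation [c.2] supported by [c.1] each cycle of which
    is a closed walk along the relation [nxt]. *)
Definition config (c : {set B} * {perm B}) : bool :=
  perm_on c.1 c.2 && [forall b in c.1, nxt b (c.2 b)].
Definition inside (K : {set E}) (c : {set B} * {perm B}) : bool :=
  [forall b in c.1, ed b \in K].
Definition clen (l : E -> R) (c : {set B} * {perm B}) : R := \sum_(b in c.1) l (ed b).

Definition bounce (b : B) : {set B} * {perm B} := ([set b; rv b], tperm b (rv b)).

Lemma config_bounce b : config (bounce b).
Proof.
apply/andP; split; first exact: tperm_on.
apply/forall_inP => x; rewrite /= !inE => /orP[]/eqP ->; first by rewrite tpermL.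
by rewrite tpermR -{2}[b]rvK.
Qed.

Lemma clen_bounce l b : clen l (bounce b) = 2 * l (ed b).
Proof.
rewrite /clen /= big_setU1 ?inE ?(eq_sym b) ?rv_neq//= big_set1 ed_rv.
by ring.
Qed.

Lemma inside_bounce K b : inside K (bounce b) = (ed b \in K).
Proof.
apply/forall_inP/idP => [h|h x]; first by apply: h; rewrite !inE eqxx.
by rewrite !inE => /orP[]/eqP -> //; rewrite ed_rv.
Qed.

Variable l : E -> R.
Hypothesis l_gt0 : forall e, 0 < l e.

Lemma clen_sub (A A' : {set B}) s s' : A' \subset A ->
  clen l (A', s') <= clen l (A, s) /\ (clen l (A, s) <= clen l (A', s') -> A = A').
Proof.
move=> sA; have -> : clen l (A, s) = clen l (A', s') + \sum_(b in A :\: A') l (ed b).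
  by rewrite /clen /= (big_setID A') /= (finset.setIidPr sA).
have s0 : 0 <= \sum_(b in A :\: A') l (ed b) by apply: sumr_ge0 => b _; exact: ltW.
split; first by rewrite lerDl.
rewrite gerDl => s0'; apply/eqP; rewrite finset.eqEsubset sA andbT -finset.setD_eq0.
apply/finset.set0Pn => -[b bA]; move: s0'; rewrite leNgt (bigD1 b)//= ltr_pwDl//.
by apply: sumr_ge0 => x _; exact: ltW.
Qed.

Definition shortest (K : {set E}) c :=
  [/\ config c, ~~ inside K c &
      forall c', config c' -> ~~ inside K c' -> clen l c <= clen l c'].

Lemma shortest_ex K : K != [set: E] -> exists c, shortest K c.
Proof.
move=> KT; have [e eK] : exists e, e \notin K.
  apply/existsP; apply: contraNT KT; rewrite negb_exists => /forallP h.
  by apply/eqP/setP => e; rewrite inE; have := h e; rewrite negbK.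
have [b be] := ed_onto e.
have [|c /andP[h1 h2] h3] := @ex_min _ (fun c => config c && ~~ inside K c) (clen l).
  by exists (bounce b); rewrite config_bounce inside_bounce be.
by exists c; split => // c' h4 h5; apply: h3; rewrite h4.
Qed.

(** Otherwise the cycle through [b0] alone would be a shorter configuration. *)
Lemma shortest_cycle K c b0 : shortest K c -> b0 \in c.1 -> ed b0 \notin K ->
  c.1 = porbit c.2 b0.
Proof.
case: c => A s [/andP[/= sA nA] _ hmin] bA bK /=.
pose A' := porbit s b0.
have sA' : A' \subset A.
  by apply/fintype.subsetP => x /porbitP[i ->]; rewrite permX; elim: i => //= i IH; rewrite perm_closed.
have sN : s \in ('N(A' | 'P))%g.
  apply/astabsP => x /=; rewrite apermE /A' -!eq_porbit_mem.
  by rewrite (_ : s x = (s ^+ 1)%g x) ?porbit_perm// expg1.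
have cc : config (A', restr_perm A' s).
  apply/andP; split; first exact: restr_perm_on.
  apply/forall_inP => x /= xA; rewrite restr_permE//.
  by apply: (forall_inP nA); exact: (fintype.subsetP sA').
have nK : ~~ inside K (A', restr_perm A' s).
  apply/forall_inP => /(_ b0 (porbit_id s b0)) h; by rewrite h in bK.
have [_ h] := clen_sub s (restr_perm A' s) sA'.
by apply: h; apply: hmin.
Qed.

(** Otherwise the bounce on [b] would be shorter, if its edge is outside [K], or else
    the reversal could be cut out. *)
Lemma shortest_reversal K c b : shortest K c -> b \in c.1 -> c.2 b = rv b ->
  c.1 = [set b; rv b] /\ c.2 (rv b) = b.
Proof.
case: c => A s /= hs bA sb.
have [/andP[/= sA nA] nK hmin] := hs.
have rA : rv b \in A by rewrite -sb perm_closed.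
have sub : [set b; rv b] \subset A by apply/fintype.subsetP => x; rewrite !inE => /orP[]/eqP ->.
have fin : A = [set b; rv b] -> s (rv b) = b.
  move=> AE; have : s (rv b) \in A by rewrite perm_closed.
  rewrite AE !inE => /orP[/eqP//|/eqP]; rewrite -{2}sb => /perm_inj e.
  by have := rv_neq b; rewrite e eqxx.
have [bK|bK] := boolP (ed b \in K); last first.
  have AE : A = [set b; rv b].
    have [_ h] := clen_sub s (tperm b (rv b)) sub.
    by apply: h; apply: hmin (config_bounce b) _; rewrite inside_bounce.
  by split => //; exact: fin.
have [b0 b0A b0K] : exists2 b0, b0 \in A & ed b0 \notin K.
  move: nK; rewrite negb_forall => /existsP[b0]; rewrite negb_imply => /andP[h1 h2].
  by exists b0.
have Ab0 : A = porbit s b0 by exact: (shortest_cycle hs).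
have bo : b \in porbit s b0 by rewrite -Ab0.
have Ab : A = porbit s b by apply/eqP; rewrite Ab0 eq_sym eq_porbit_mem.
pose a := (s^-1)%g b.
have sa : s a = b by rewrite /a permKV.
have aA : a \in A by rewrite -(perm_closed a sA) sa.
have [ar|ar] := eqVneq a (rv b).
  have AE : A = [set b; rv b].
    apply/eqP; rewrite finset.eqEsubset sub andbT; apply/fintype.subsetP => x.
    rewrite Ab => /porbitP[i ->]; rewrite permX.
    elim: i => [|i]; first by rewrite /= !inE eqxx.
    rewrite iterS !inE => /orP[]/eqP ->; first by rewrite sb eqxx orbT.
    by rewrite -ar sa eqxx.
  by move: b0A; rewrite AE !inE => /orP[]/eqP e; move: b0K; rewrite e ?ed_rv bK.
have ab : a != b by apply/eqP => e; move: sa; rewrite e sb => /eqP; rewrite (negPf (rv_neq b)).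
(* The walk [a, b, rv b, s (rv b)] is cut short to [a, s (rv b)]. *)
pose s' := (tperm a (rv b) * tperm a b * s)%g.
have s'E x : s' x = s (tperm a b (tperm a (rv b) x)) by rewrite !permM.
have s'a : s' a = s (rv b).
  by rewrite s'E tpermL tpermD// eq_sym ?rv_neq// eq_sym.
have s'b : s' b = b by rewrite s'E (tpermD ab (rv_neq b)) tpermR sa.
have s'r : s' (rv b) = rv b by rewrite s'E tpermR tpermL.
have s'o x : x != a -> x != b -> x != rv b -> s' x = s x.
  by move=> h1 h2 h3; rewrite s'E !tpermD// eq_sym.
pose A' := A :\: [set b; rv b].
have s'A : perm_on A' s'.
  apply/fintype.subsetP => x; rewrite inE => xs; rewrite !inE negb_or.
  have [xb|xb] := eqVneq x b; first by rewrite xb s'b eqxx in xs.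
  have [xr|xr] := eqVneq x (rv b); first by rewrite xr s'r eqxx in xs.
  have [->//|xa] := eqVneq x a.
  by apply: (fintype.subsetP sA); rewrite inE -s'o.
have cc : config (A', s').
  apply/andP; split => //; apply/forall_inP => x /=.
  rewrite !inE negb_or => /andP[/andP[xb xr] xA].
  have [xa|xa] := eqVneq x a; last by rewrite s'o//; exact: (forall_inP nA).
  rewrite xa s'a; apply: (@nxt_trans _ b); first by rewrite -[X in nxt _ X]sa; exact: (forall_inP nA).
  exact: (forall_inP nA).
have nK' : ~~ inside K (A', s').
  apply/forall_inP => /(_ b0) /=; rewrite !inE negb_or b0A andbT.
  have -> : b0 != b by apply: contraNneq b0K => ->.
  have -> : b0 != rv b by apply: contraNneq b0K => ->; rewrite ed_rv.
  by move=> /(_ isT) h; rewrite h in b0K.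
have [_ h] := clen_sub s s' (finset.subsetDl A [set b; rv b]).
have AA := h (hmin _ cc nK').
by move: bA; rewrite AA !inE eqxx.
Qed.

Variable T : B -> B -> R.
Hypothesis T_out : forall a b, ~~ nxt a b -> T a b = 0.
Hypothesis T_pos : forall a b, nxt a b -> b != rv a -> 0 < T a b.
Hypothesis T_neg : forall a, T a (rv a) < 0.

Definition cweight (c : {set B} * {perm B}) : R :=
  if perm_on c.1 c.2 then (-1) ^+ c.2 * \prod_(b in c.1) - T b (c.2 b) else 0.

Lemma cweight0 c : ~~ config c -> cweight c = 0.
Proof.
rewrite /config /cweight; case: ifP => //= _.
rewrite negb_forall => /existsP[b]; rewrite negb_imply => /andP[bA hn].
by rewrite (bigD1 b)//= T_out// oppr0 mul0r mulr0.
Qed.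

(** All the shortest configurations contribute with the same sign.  A cycle of
    length [p] has the sign [(-1) ^ (p - 1)], so its weight is minus the product
    of its amplitudes, and these are all positive or, for a bounce, two negative
    numbers. *)
Lemma shortest_weight K c : shortest K c -> cweight c < 0.
Proof.
case: c => A s hs; have [/andP[/= sA nA] nK hmin] := hs.
have [b0 b0A b0K] : exists2 b0, b0 \in A & ed b0 \notin K.
  move: nK; rewrite negb_forall => /existsP[b0]; rewrite negb_imply => /andP[h1 h2].
  by exists b0.
have Ab0 : A = porbit s b0 by exact: (shortest_cycle hs).
rewrite /cweight /= sA (odd_perm_cycle sA Ab0) prodrN mulrA.
have -> : (-1) ^+ (~~ odd #|A|) * (-1) ^+ #|A| = -1 :> R.
  by rewrite -[(-1) ^+ #|A|]signr_odd; case: (odd _); rewrite ?expr0 ?expr1 ?mul1r ?mulr1.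
rewrite mulN1r oppr_lt0.
have [/exists_inP[b bA /eqP sb]|] := boolP [exists b in A, s b == rv b].
  have [/= AE sr] := shortest_reversal hs bA sb.
  rewrite AE big_setU1 ?inE ?(eq_sym b) ?rv_neq//= big_set1 sb sr.
  by have := T_neg (rv b); rewrite rvK nmulr_rgt0 ?T_neg.
rewrite negb_exists => /forallP h.
apply: prodr_gt0 => b bA; apply: T_pos; first exact: (forall_inP nA).
by have := h b; rewrite bA.
Qed.

(** If a shortest configuration uses two edges outside [K] then it is at least as
    long as the sum of their lengths, hence as the bounce on one of them, which
    uses only this edge. *)
Lemma next_edge K : K != [set: E] ->
  exists2 e, e \notin K & exists2 c, shortest K c & inside (e |: K) c.
Proof.
move=> /shortest_ex[c hs]; have [cc nK hmin] := hs.
have [b0 b0A b0K] : exists2 b0, b0 \in c.1 & ed b0 \notin K.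
  move: nK; rewrite negb_forall => /existsP[b0]; rewrite negb_imply => /andP[h1 h2].
  by exists b0.
exists (ed b0) => //.
have [ins|] := boolP (inside (ed b0 |: K) c); first by exists c.
rewrite negb_forall => /existsP[b1]; rewrite negb_imply !inE negb_or.
move=> /andP[b1A /andP[b1b0 b1K]].
have n0 : ~~ inside K (bounce b0) by rewrite inside_bounce.
have n1 : ~~ inside K (bounce b1) by rewrite inside_bounce.
have h0 := hmin _ (config_bounce b0) n0; have h1 := hmin _ (config_bounce b1) n1.
have hc : l (ed b0) + l (ed b1) <= clen l c.
  have b10 : b1 != b0 by apply: contraNneq b1b0 => ->.
  rewrite /clen (bigD1 b0)//= (bigD1 b1) ?b1A//= addrA lerDl.
  by apply: sumr_ge0 => b _; exact: ltW.
exists (bounce b0); last by rewrite inside_bounce !inE eqxx.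
split => //; first exact: config_bounce.
move=> c' h2 h3; apply: le_trans (hmin _ h2 h3).
by move: h0 h1 hc; rewrite !clen_bounce; lra.
Qed.

End Configurations.

(** * Reconstruction of the lengths *)
Section Reconstruction.
Context {R : realType}.
Variables (B E : finType) (ed : B -> E) (rv : B -> B) (nxt : rel B).
Hypothesis rvK : involutive rv.
Hypothesis rv_neq : forall b, rv b != b.
Hypothesis ed_rv : forall b, ed (rv b) = ed b.
Hypothesis nxt_rv : forall b, nxt b (rv b).
Hypothesis nxt_trans : forall a b c, nxt a b -> nxt (rv b) c -> nxt a c.
Variable T : B -> B -> R.
Hypothesis T_out : forall a b, ~~ nxt a b -> T a b = 0.
Hypothesis T_pos : forall a b, nxt a b -> b != rv a -> 0 < T a b.
Hypothesis T_neg : forall a, T a (rv a) < 0.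

Local Notation shortest := (shortest ed nxt).
Local Notation clen := (clen ed).
Local Notation inside := (inside ed).

Lemma clen_inside (l l' : E -> R) (K : {set E}) c :
  {in K, l =1 l'} -> inside K c -> clen l c = clen l' c.
Proof. by move=> ll /forall_inP h; apply: eq_bigr => b bA; apply: ll; exact: h. Qed.

(** The coefficients as functions of the edge lengths, the amplitudes [T] being
    fixed. *)
Definition lcoef (l : E -> R) (x : R) : R := \sum_(c | clen l c == x) cweight T c.

(** The part of a coefficient that is not accounted for by the edges in [K]. *)
Definition outer_coef (l : E -> R) (K : {set E}) (x : R) : R :=
  \sum_(c | (clen l c == x) && ~~ inside K c) cweight T c.

Lemma lcoef_outside (l l' : E -> R) (K : {set E}) x : {in K, l =1 l'} -> lcoef l x = lcoef l' x ->
  outer_coef l K x = outer_coef l' K x.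
Proof.
move=> ll; rewrite /lcoef (bigID (inside K)) [RHS](bigID (inside K)) /=.
have -> : \sum_(c | (clen l c == x) && inside K c) cweight T c =
    \sum_(c | (clen l' c == x) && inside K c) cweight T c.
  apply: eq_bigl => c; case ic: (inside K c); last by rewrite !andbF.
  by rewrite (clen_inside ll ic).
exact: addrI.
Qed.

Lemma outer_coef_below (l : E -> R) (K : {set E}) c x :
  shortest l K c -> x < clen l c -> outer_coef l K x = 0.
Proof.
move=> [_ _ hmin] lt; apply: big1 => d /andP[/eqP ld nd].
have [cd|] := boolP (config nxt d); last exact: cweight0.
by have := hmin d cd nd; rewrite ld leNgt lt.
Qed.

Lemma outer_coef_lt0 (l : E -> R) (K : {set E}) c : (forall e, 0 < l e) ->
  shortest l K c -> outer_coef l K (clen l c) < 0.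
Proof.
move=> l0 hc; have [_ nK hmin] := hc.
rewrite /outer_coef (bigD1 c) /= ?eqxx//.
have neg d : shortest l K d -> cweight T d < 0.
  exact: (shortest_weight rvK rv_neq ed_rv nxt_rv nxt_trans l0 T_pos T_neg).
apply: ltr_nwDl; first exact: neg.
apply: sumr_le0 => d /andP[/andP[/eqP ld nd] _].
have [cd|nc] := boolP (config nxt d); last by rewrite (cweight0 T_out).
by apply/ltW/neg; split => // d' cd' nd'; rewrite ld; exact: hmin.
Qed.

Lemma lcoef_outer0 (l : E -> R) x : 0 < x -> lcoef l x = outer_coef l finset.set0 x.
Proof.
move=> x0; apply: eq_bigl => c; case: eqP => //= cx; apply/esym/negP => /forall_inP h.
move: x0; rewrite -cx /clen big1 ?ltxx// => b /h; by rewrite inE.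
Qed.

(** The length of the shortest configurations outside [K] is the least frequency
    with a nonzero outer coefficient. *)
Lemma shortest_le (l l' : E -> R) (K : {set E}) c c' : (forall e, 0 < l' e) ->
  {in K, l =1 l'} -> (forall x, lcoef l x = lcoef l' x) ->
  shortest l K c -> shortest l' K c' -> clen l c <= clen l' c'.
Proof.
move=> l0' ll hco hc hc'; rewrite leNgt; apply/negP => lt.
have := outer_coef_lt0 l0' hc'.
by rewrite -(lcoef_outside ll (hco _)) (outer_coef_below hc lt) ltxx.
Qed.

(** If [e] were longer under [l] than under [l'], the configuration [c] would be
    shorter under [l'] than any configuration outside [K] can be. *)
Lemma length_le (l l' : E -> R) (K : {set E}) e c c' : (forall e, 0 < l e) -> (forall e, 0 < l' e) ->
  {in K, l =1 l'} -> (forall x, lcoef l x = lcoef l' x) ->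
  shortest l K c -> inside (e |: K) c -> shortest l' K c' -> l e <= l' e.
Proof.
move=> l0 l0' ll hco hc ic hc'; rewrite leNgt; apply/negP => lt.
have [cc nK _] := hc; have [_ _ hmin'] := hc'.
have le1 : clen l c <= clen l' c.
  exact: le_trans (shortest_le l0' ll hco hc hc') (hmin' c cc nK).
have [b0 b0A b0K] : exists2 b0, b0 \in c.1 & ed b0 \notin K.
  move: nK; rewrite negb_forall => /existsP[b0]; rewrite negb_imply => /andP[h1 h2].
  by exists b0.
have lb b : b \in c.1 -> l' (ed b) <= l (ed b).
  move=> /(forall_inP ic); rewrite !inE => /orP[/eqP ->|/ll ->//]; exact: ltW.
have : clen l' c < clen l c.
  rewrite /clen (bigD1 b0)//= [ltRHS](bigD1 b0)//=; apply: ltr_leD.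
    by move: (forall_inP ic _ b0A); rewrite !inE (negPf b0K) orbF => /eqP ->.
  by apply: ler_sum => b /andP[bA _]; exact: lb.
by rewrite ltNge le1.
Qed.

Lemma length_step (l l' : E -> R) (K : {set E}) e c c' : (forall e, 0 < l e) -> (forall e, 0 < l' e) ->
  {in K, l =1 l'} -> (forall x, lcoef l x = lcoef l' x) ->
  shortest l K c -> inside (e |: K) c -> shortest l' K c' -> inside (e |: K) c' ->
  l e = l' e.
Proof.
move=> l0 l0' ll hco hc ic hc' ic'; apply/eqP; rewrite eq_le.
rewrite (length_le l0 l0' ll hco hc ic hc').
by apply: (length_le l0' l0 _ _ hc' ic' hc) => [x xK|x]; [rewrite ll|rewrite hco].
Qed.

End Reconstruction.

Section Transport.
Context {R : realType}.

Lemma transport_config (B E B' E' : finType) (ed : B -> E) (ed' : B' -> E') (nxt : rel B) (nxt' : rel B')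
  (phi : B -> B') (phi' : B' -> B) (psi : E -> E') (l : E -> R) (l' : E' -> R) c :
  cancel phi phi' -> cancel phi' phi ->
  (forall b, ed' (phi b) = psi (ed b)) -> (forall a b, nxt' (phi a) (phi b) = nxt a b) ->
  (forall e, l' (psi e) = l e) -> config nxt c ->
  exists c', [/\ config nxt' c', forall K, inside ed' K c' = inside ed (psi @^-1: K) c &
                 clen ed' l' c' = clen ed l c].
Proof.
case: c => A s phiK phiK' hed hnxt hl /andP[/= sA nA].
have sI : injective (fun x => phi (s (phi' x))).
  by move=> x y /(can_inj phiK)/perm_inj/(can_inj phiK').
exists (phi @: A, perm sI); split.
- apply/andP; split.
    apply/fintype.subsetP => x; rewrite inE permE => xs; rewrite -[x]phiK' imset_f//.
    by apply: (fintype.subsetP sA); rewrite inE; apply: contraNneq xs => ->; rewrite phiK'.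
  apply/forall_inP => _ /imsetP[x xA ->]; rewrite /= permE phiK hnxt.
  exact: (forall_inP nA).
- move=> K; apply/forall_inP/forall_inP => /= h.
    by move=> b bA; rewrite inE -hed; apply: h; exact: imset_f.
  by move=> _ /imsetP[b bA ->]; have := h b bA; rewrite inE hed.
- rewrite /clen /= big_imset /=; last by move=> x y _ _; exact: can_inj phiK _ _.
  by apply: eq_bigr => b _; rewrite hed hl.
Qed.

(** Being shortest only depends on the relation [nxt] and the lengths, so that a
    discovery order can be transported to a numbering of the bonds. *)
Lemma transport_shortest (B E B' E' : finType) (ed : B -> E) (ed' : B' -> E') (nxt : rel B) (nxt' : rel B')
  (phi : B -> B') (phi' : B' -> B) (psi : E -> E') (psi' : E' -> E) (l : E -> R) (l' : E' -> R) e (K : {set E'}) :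
  cancel phi phi' -> cancel phi' phi -> cancel psi psi' -> cancel psi' psi ->
  (forall b, ed' (phi b) = psi (ed b)) -> (forall a b, nxt' (phi a) (phi b) = nxt a b) ->
  (forall e, l' (psi e) = l e) ->
  (exists2 c, shortest ed nxt l (psi @^-1: K) c & inside ed (e |: psi @^-1: K) c) ->
  exists2 c, shortest ed' nxt' l' K c & inside ed' (psi e |: K) c.
Proof.
move=> phiK phiK' psiK psiK' hed hnxt hl [c [cc nK hmin] ic].
have [c' [cc' inc' lc']] := transport_config phiK phiK' hed hnxt hl cc.
have preK : psi @^-1: (psi e |: K) = e |: psi @^-1: K.
  by apply/setP => x; rewrite !inE (inj_eq (can_inj psiK)).
exists c'; last by rewrite inc' preK.
split => //; first by rewrite inc'.
move=> d cd nd; rewrite lc'.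
have hed' b : ed (phi' b) = psi' (ed' b) by rewrite -{2}[b]phiK' hed psiK.
have hnxt' a b : nxt (phi' a) (phi' b) = nxt' a b by rewrite -hnxt !phiK'.
have hl' e' : l (psi' e') = l' e' by rewrite -hl psiK'.
have [d' [cd' ind' <-]] := transport_config phiK' phiK hed' hnxt' hl' cd.
apply: hmin => //; rewrite ind'.
suff -> : psi' @^-1: (psi @^-1: K) = K by [].
by apply/setP => x; rewrite !inE psiK'.
Qed.

End Transport.

Local Open Scope classical_set_scope.

(** * The total length *)
Section TopCoefficient.
Context {R : realType}.
Variables (n : nat) (T : 'M[R]_n) (L : 'I_n -> R).
Hypothesis T_orth : T *m T^T = 1%:M.
Hypothesis L_gt0 : forall i, 0 < L i.

Lemma sec_len_eq_sum c : (sec_len L c == \sum_i L i) = (c.1 == [set: 'I_n]%SET).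
Proof.
apply/eqP/eqP => [h|h]; last by apply: eq_bigl => i; rewrite h inE.
apply/setP => i; rewrite inE; apply: contraT => ic.
have : sec_len L c < \sum_i L i.
  rewrite /sec_len big_mkcond [ltRHS](bigD1 i)//= [ltLHS](bigD1 i)//= (negPf ic).
  by rewrite ltr_leD// ler_sum// => j _; case: ifP => // _; exact: ltW.
by rewrite h ltxx.
Qed.

(** Only the full set of bonds has the total length as its frequency. *)
Lemma coef_sec_sum : coef (sec_weight T) (sec_len L) (\sum_i L i) = \det (- T).
Proof.
rewrite /coef (eq_bigl (fun c => (c.1 == [set: 'I_n]%SET) && true)); last first.
  by move=> c; rewrite sec_len_eq_sum andbT.
rewrite -(pair_big_dep (fun A => A == [set: 'I_n]%SET) (fun _ _ => true)
  (fun A s => sec_weight T (A, s))) /= big_pred1_eq.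
apply: eq_bigr => s _; rewrite /sec_weight /=.
have -> : perm_on [set: 'I_n]%SET s by apply/fintype.subsetP => x; rewrite inE.
congr (_ * _); apply: eq_big => i; first by rewrite inE.
by rewrite mxE.
Qed.

Lemma coef_sec_sum_neq0 : coef (sec_weight T) (sec_len L) (\sum_i L i) != 0.
Proof.
rewrite coef_sec_sum -scaleN1r detZ mulf_eq0 signr_eq0 /=.
apply/eqP => d0; have := congr1 determinant T_orth.
by rewrite det_mulmx d0 mul0r det1 => /eqP; rewrite eq_sym oner_eq0.
Qed.

Lemma coef_sec_large x : \sum_i L i < x -> coef (sec_weight T) (sec_len L) x = 0.
Proof.
by move=> h; apply: coef_eq0 => c; rewrite lt_eqF// (le_lt_trans (sec_len_le L_gt0 c)).
Qed.

End TopCoefficient.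

Lemma sum_len_eq (R : realType) n n' (T : 'M[R]_n) (T' : 'M[R]_n')
    (L : 'I_n -> R) (L' : 'I_n' -> R) :
  T *m T^T = 1%:M -> T' *m T'^T = 1%:M -> (forall i, 0 < L i) -> (forall i, 0 < L' i) ->
  (forall x, coef (sec_weight T) (sec_len L) x = coef (sec_weight T') (sec_len L') x) ->
  \sum_i L i = \sum_i L' i.
Proof.
move=> oT oT' L0 L0' h; have [lt|lt|//] := ltgtP (\sum_i L i) (\sum_i L' i).
  by have := coef_sec_sum_neq0 oT' L0'; rewrite -h (coef_sec_large _ L0)// eqxx.
by have := coef_sec_sum_neq0 oT L0; rewrite h (coef_sec_large _ L0')// eqxx.
Qed.

(** * Discovery orders of the edges *)

Section LeaflessBonds.
Context {R : realType}.
Variable G : qgraph R.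

Definition bedge (b : bond G) : edge G := b.1.
Definition follows (b c : bond G) : bool := head b == tail c.

Lemma brev_neq (b : bond G) : brev b != b.
Proof. by case: b => e []; apply/eqP => -[]. Qed.

Lemma follows_brev (b : bond G) : follows b (brev b).
Proof. by rewrite /follows tail_brev. Qed.

Lemma follows_trans (a b c : bond G) : follows a b -> follows (brev b) c -> follows a c.
Proof. by rewrite /follows head_brev => /eqP -> . Qed.

Lemma bscat_out (b c : bond G) : ~~ follows b c -> bscat b c = 0.
Proof. by rewrite /follows /bscat => /negPf ->. Qed.

Lemma bscat_gt0 (b c : bond G) : follows b c -> c != brev b -> 0 < bscat b c.
Proof.
rewrite /follows /bscat => -> /negPf ->; rewrite subr0 divr_gt0// ltr0n; exact: deg_gt0.
Qed.

Hypothesis lfG : leafless G.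

Lemma deg_ge3 (v : vert G) : (2 < deg v)%N.
Proof. by have := deg_neq0 v; have := deg_neq2 v; have := lfG v; case: (deg v) => [|[|[]]]. Qed.

Lemma bscat_brev_lt0 (b : bond G) : bscat b (brev b) < 0.
Proof.
rewrite /bscat tail_brev !eqxx subr_lt0 ltr_pdivrMr ?ltr0n ?deg_gt0// mul1r.
by rewrite ltr_nat deg_ge3.
Qed.

Lemma sum_deg : (\sum_(v : vert G) deg v = 2 * #|edge G|)%N.
Proof.
rewrite (eq_bigr (fun v => \sum_(b : bond G | tail b == v) 1)%N); last by move=> v _; rewrite card_tail.
rewrite (exchange_big_dep predT) //= (eq_bigr (fun=> 1%N)); last first.
  by move=> b _; rewrite (big_pred1 (tail b))// => v; rewrite eq_sym.
by rewrite sum1_card card_prod card_bool mulnC.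
Qed.

Lemma card_vert_edge : (3 * #|vert G| <= 2 * #|edge G|)%N.
Proof. by rewrite -sum_deg mulnC -sum_nat_const; apply: leq_sum => v _; exact: deg_ge3. Qed.

Lemma card_vert_le : (#|vert G| <= #|edge G|)%N.
Proof. by have := card_vert_edge; lia. Qed.

Lemma card_edge_ge2 : (1 < #|edge G|)%N.
Proof. by have := card_vert_edge; have := vert_gt0 G; lia. Qed.

(** In a discovery order the lengths can be found one after the other: among the
    shortest configurations that use an undiscovered edge, one uses no
    undiscovered edge other than [gam j]. *)
Definition discovery m (gam : 'I_m -> edge G) : Prop := forall j : 'I_m,
  let K := [set gam i | i : 'I_m & (i < j)%N]%SET in
  exists2 c, shortest bedge follows (@len R G) K c & inside bedge (gam j |: K)%SET c.

Lemma discovery_ex : exists (m : nat) (gam : 'I_m -> edge G), bijective gam /\ discovery gam.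
Proof.
have e0 : edge G by move: card_edge_ge2; case: (pickP (edge G)) => // h; rewrite eq_card0.
pose good (s : seq (edge G)) := forall j, (j < size s)%N -> let K := [set x in take j s]%SET in
  exists2 c, shortest bedge follows (@len R G) K c & inside bedge (nth e0 s j |: K)%SET c.
have [s [us ss gs]] : exists s, [/\ uniq s, size s = #|edge G| & good s].
  suff h k : (k <= #|edge G|)%N -> exists s, [/\ uniq s, size s = k & good s] by exact: h.
  elim: k => [_|k IH lk]; first by exists [::].
  have [s [us ss gs]] := IH (ltnW lk).
  have KT : [set x in s]%SET != [set: edge G]%SET.
    apply/eqP => h; have := cardsT (edge G); rewrite -h cardsE (card_uniqP us) ss => ke.
    by rewrite ke ltnn in lk.
  have onto e : exists b : bond G, bedge b = e by exists (e, true).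
  have [e es hc] := next_edge (@brevK R G) brev_neq (fun b => erefl (bedge b)) onto follows_brev
     (@len_gt0 R G) KT.
  exists (rcons s e); rewrite inE in es; split.
  - by rewrite rcons_uniq es.
  - by rewrite size_rcons ss.
  - move=> j; rewrite size_rcons ltnS leq_eqVlt => /orP[/eqP ->|js] /=.
      by rewrite -cats1 take_size_cat// nth_cat ltnn subnn /=.
    by rewrite -cats1 takel_cat ?(ltnW js)// nth_cat js; exact: gs.
have sm : forall i : 'I_(size s), nth e0 s i \in s by move=> i; rewrite mem_nth.
have sin e : e \in s.
  have : s =i edge G by apply/subset_cardP; rewrite ?(card_uniqP us)// ; apply/fintype.subsetP.
  by move=> ->.
have si e : (index e s < size s)%N by rewrite index_mem.
exists (size s), (fun i => nth e0 s i); split.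
  exists (fun e => Ordinal (si e)) => [i|e]; last by rewrite nth_index.
  by apply: val_inj; rewrite /= index_uniq.
move=> j; have := gs j (ltn_ord j).
suff -> : [set x in take j s]%SET = [set nth e0 s i | i : 'I_(size s) & (i < j)%N]%SET by [].
apply/setP => e; rewrite inE; apply/idP/imsetP => [|[] i ].
  case/(nthP e0) => i; rewrite size_take ltn_ord => ij <-.
  by exists (Ordinal (ltn_trans ij (ltn_ord j))); rewrite ?inE//= nth_take.
rewrite inE => ij ->; rewrite -(nth_take e0 ij) mem_nth// size_take ltn_ord.
exact: ij.
Qed.

End LeaflessBonds.

(** * Spectrum and codes *)
Section SpectralCoefficients.
Context {R : realType}.

(** The numbers of bonds may differ a priori, as only the spectra relate the two
    graphs. *)
Lemma spectral_coef (G H : qgraph R) n n' (beta : 'I_n -> bond G) (iota : bond G -> 'I_n)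
    (beta' : 'I_n' -> bond H) (iota' : bond H -> 'I_n') :
  cancel beta iota -> cancel iota beta -> cancel beta' iota' -> cancel iota' beta' ->
  isospectral G H -> forall x,
  coef (sec_weight (bond_scat beta)) (sec_len (bond_len beta)) x =
  coef (sec_weight (bond_scat beta')) (sec_len (bond_len beta')) x.
Proof.
move=> bK iK bK' iK' iso; apply: coef_eq_of_kernels => [||i|i|k k0].
- exact: bond_scat_orth bK iK.
- exact: bond_scat_orth bK' iK'.
- exact: bond_len_gt0.
- exact: bond_len_gt0.
- apply: multiplicity_unique (multiplicity_kernel bK' iK' k0).
  exact: (proj1 (iso _ _) (multiplicity_kernel bK iK k0)).
Qed.

End SpectralCoefficients.

(** The bonds are numbered so that the numbering only depends on the number of
   edges: the relations between bonds of two graphs with the same code become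
   equal, not merely isomorphic. *)
Section Numbering.
Variable m : nat.
Local Notation B := ('I_m * bool)%type.
Local Notation n := #|{: B}|.

Definition nedge (i : 'I_n) : 'I_m := (enum_val i).1.
Definition nrev (i : 'I_n) : 'I_n := enum_rank ((enum_val i).1, ~~ (enum_val i).2).

Lemma nrevK : involutive nrev.
Proof.
by move=> i; rewrite /nrev !enum_rankK /= negbK -surjective_pairing enum_valK.
Qed.

Lemma nrev_neq i : nrev i != i.
Proof.
apply/eqP => /(congr1 (fun i => (enum_val i).2)); rewrite enum_rankK /=.
by case: (_.2).
Qed.

Lemma nedge_rev i : nedge (nrev i) = nedge i.
Proof. by rewrite /nedge enum_rankK. Qed.

Context {R : realType}.
Variables (G : qgraph R) (gam : 'I_m -> edge G) (gam' : edge G -> 'I_m).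
Hypothesis gamK : cancel gam gam'.
Hypothesis gamK' : cancel gam' gam.

Definition nbond (i : 'I_n) : bond G := (gam (nedge i), (enum_val i).2).
Definition nbond' (b : bond G) : 'I_n := enum_rank (gam' b.1, b.2).

Lemma nbondK : cancel nbond nbond'.
Proof.
by move=> i; rewrite /nbond /nbond' /= gamK -surjective_pairing enum_valK.
Qed.

Lemma nbondK' : cancel nbond' nbond.
Proof. by case=> e d; rewrite /nbond /nbond' /nedge enum_rankK /= gamK'. Qed.

Lemma nbond_rev i : nbond (nrev i) = brev (nbond i).
Proof. by rewrite /nbond nedge_rev /nrev enum_rankK. Qed.

Definition nfollows (i j : 'I_n) : bool := follows (nbond i) (nbond j).
Definition nlen (i : 'I_m) : R := len (gam i).

Lemma nlen_gt0 i : 0 < nlen i. Proof. exact: len_gt0. Qed.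

Lemma nfollows_rev i : nfollows i (nrev i).
Proof. by rewrite /nfollows nbond_rev follows_brev. Qed.

Lemma nfollows_trans a b c : nfollows a b -> nfollows (nrev b) c -> nfollows a c.
Proof. by rewrite /nfollows nbond_rev; exact: follows_trans. Qed.

Local Notation T := (bond_scat nbond).

Lemma nscat_out i j : ~~ nfollows i j -> T i j = 0.
Proof. by move=> h; rewrite mxE bscat_out. Qed.

Lemma nscat_gt0 i j : nfollows i j -> j != nrev i -> 0 < T i j.
Proof.
move=> h ij; rewrite mxE bscat_gt0// -nbond_rev.
by rewrite (inj_eq (can_inj nbondK)).
Qed.

Lemma nscat_rev_lt0 i : leafless G -> T i (nrev i) < 0.
Proof. by move=> lf; rewrite mxE nbond_rev bscat_brev_lt0. Qed.

Lemma ncoef x : coef (sec_weight T) (sec_len (bond_len nbond)) x = lcoef nedge (fun i j => T i j) nlen x.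
Proof. by []. Qed.

Lemma ndiscovery (j : 'I_m) : discovery gam -> let K := [set i : 'I_m | (i < j)%N]%SET in
  exists2 c, shortest nedge nfollows nlen K c & inside nedge (j |: K)%SET c.
Proof.
move=> dG K; rewrite -[X in (X |: K)%SET]gamK.
apply: (transport_shortest (phi := nbond') (phi' := nbond) (psi := gam') (psi' := gam)
  (ed := @bedge R G) (nxt := @follows R G) (l := @len R G) nbondK' nbondK gamK' gamK).
- by move=> b; rewrite /nedge enum_rankK.
- by move=> a b; rewrite /nfollows !nbondK'.
- by move=> e; rewrite /nlen gamK'.
- suff -> : (gam' @^-1: K)%SET = [set gam i | i : 'I_m & (i < j)%N]%SET by exact: dG.
  apply/setP => e; rewrite !inE; apply/idP/imsetP => [h|[i hi ->]]; last by rewrite gamK; move: hi; rewrite inE.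
  by exists (gam' e); rewrite ?inE ?gamK'.
Qed.

End Numbering.

(** A code lists the end points of the edges in a discovery order, as labels of
    vertices, and is padded with [None] so that graphs with different numbers
    of edges are coded in one finite type. *)
Local Notation code M := {ffun 'I_M -> option ('I_M * 'I_M)}.

Section Codes.
Context {R : realType}.

(** The incidences determine the scattering matrix, so [length_step] applies to
    each edge once the lengths of the earlier ones are known to agree. *)
Lemma same_lengths (G H : qgraph R) m (gam : 'I_m -> edge G) (gam' : edge G -> 'I_m)
    (del : 'I_m -> edge H) (del' : edge H -> 'I_m) (fv : vert G -> vert H) :
  cancel gam gam' -> cancel gam' gam -> cancel del del' -> cancel del' del ->
  leafless G -> leafless H -> discovery gam -> discovery del -> injective fv ->
  (forall i, src (del i) = fv (src (gam i))) -> (forall i, tgt (del i) = fv (tgt (gam i))) ->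
  isospectral G H -> forall i, len (gam i) = len (del i).
Proof.
move=> gK gK' dK dK' lG lH hg hd fI hs ht iso.
have tE i : tail (nbond del i) = fv (tail (nbond gam i)).
  by rewrite /tail /=; case: ifP.
have hE i : head (nbond del i) = fv (head (nbond gam i)).
  by rewrite /head /=; case: ifP.
have degE v : deg (fv v) = deg v.
  rewrite -!card_tail (reindex (nbond gam)) /=; last first.
    by exists (nbond' gam') => x _; [exact: nbondK|exact: nbondK'].
  rewrite (reindex (nbond del)) /=; last first.
    by exists (nbond' del') => x _; [exact: nbondK|exact: nbondK'].
  by apply: eq_bigl => i; rewrite tE (inj_eq fI).
have fE i j : nfollows del i j = nfollows gam i j.
  by rewrite /nfollows /follows tE hE (inj_eq fI).
have TE : bond_scat (nbond del) = bond_scat (nbond gam).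
  apply/matrixP => i j; rewrite !mxE /bscat tE hE (inj_eq fI) degE.
  rewrite -!nbond_rev (inj_eq (can_inj (nbondK dK))) (inj_eq (can_inj (nbondK gK))).
  by [].
pose T i j := bond_scat (nbond gam) i j.
have hco x : lcoef (@nedge m) T (nlen gam) x = lcoef (@nedge m) T (nlen del) x.
  have := spectral_coef (nbondK gK) (nbondK' gK') (nbondK dK) (nbondK' dK') iso x.
  by rewrite TE !ncoef.
suff h k (i : 'I_m) : (i < k)%N -> nlen gam i = nlen del i by move=> i; exact: (h i.+1).
elim: k i => // k IH i; rewrite ltnS => ik.
have hK : {in [set j : 'I_m | (j < i)%N]%SET, nlen gam =1 nlen del}.
  by move=> j; rewrite inE => ji; apply: IH; exact: leq_trans ji ik.
have [c hc ic] := ndiscovery gK gK' i hg.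
have [c' hc' ic'] := ndiscovery dK dK' i hd.
have fE' : nfollows del = nfollows gam.
  by apply/funext => a; apply/funext => b.
rewrite fE' in hc'.
exact: (length_step (@nrevK m) (@nrev_neq m) (@nedge_rev m) (nfollows_rev gam)
  (@nfollows_trans m R G gam) (@nscat_out m R G gam) (nscat_gt0 gK)
  (fun i => nscat_rev_lt0 gam i lG) (nlen_gt0 gam) (nlen_gt0 del) hK hco hc ic hc' ic').
Qed.

Definition codes (G : qgraph R) M (f : code M) : Prop :=
  exists (m : nat) (gam : 'I_m -> edge G) (vl : vert G -> 'I_M),
    [/\ (m <= M)%N, bijective gam, discovery gam, injective vl &
        forall j, f j = omap (fun i => (vl (src (gam i)), vl (tgt (gam i)))) (insub (j : nat))].

(** Numbering the vertices by ['I_M] is possible because a graph with all degrees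
    at least 3 has no more vertices than edges. *)
Lemma code_ex (G : qgraph R) M : leafless G -> (#|edge G| <= M)%N -> exists f, codes G (M := M) f.
Proof.
move=> lG lM; have [m [gam [bg dg]]] := discovery_ex lG.
have vM : (#|vert G| <= M)%N by exact: leq_trans (card_vert_le lG) lM.
have mM : (m <= M)%N by rewrite -(card_ord m) (bij_eq_card bg).
pose vl (v : vert G) : 'I_M := widen_ord vM (enum_rank v).
exists [ffun j : 'I_M => omap (fun i => (vl (src (gam i)), vl (tgt (gam i)))) (insub (j : nat))].
exists m, gam, vl; split => // [v w|j]; last by rewrite ffunE.
by move=> /(congr1 (fun i : 'I_M => (i : nat))) /= /val_inj/enum_rank_inj.
Qed.

Lemma incident_edge (G : qgraph R) (v : vert G) : exists e : edge G, (src e == v) || (tgt e == v).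
Proof.
have := deg_gt0 v; rewrite -card_tail sum1_card => /card_gt0P[[e d]].
by rewrite unfold_in /tail /=; case: d => h; exists e; apply/orP; [left|right].
Qed.

(** Every vertex is an end point of an edge, so its label occurs in the code. *)
Lemma code_vertex (G H : qgraph R) m M (gam : 'I_m -> edge G) (del : 'I_m -> edge H)
    (vl : vert G -> 'I_M) (wl : vert H -> 'I_M) : bijective gam ->
  (forall i, vl (src (gam i)) = wl (src (del i))) -> (forall i, vl (tgt (gam i)) = wl (tgt (del i))) ->
  forall v, exists w, wl w = vl v.
Proof.
move=> [gam' _ gK'] hs ht v; have [e] := incident_edge v; rewrite -[e]gK'.
by move=> /orP[]/eqP <-; [exists (src (del (gam' e)))|exists (tgt (del (gam' e)))].
Qed.

Lemma code_qiso (G H : qgraph R) M (f : code M) :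
  leafless G -> leafless H -> isospectral G H -> codes G f -> codes H f -> qiso G H.
Proof.
move=> lG lH iso [m [gam [vl [mM bg dg vI hf]]]] [m' [del [wl [mM' bd dd wI hf']]]].
have mm : m = m'.
  have lt k k' (P : 'I_k -> 'I_M * 'I_M) (Q : 'I_k' -> 'I_M * 'I_M) : (k' <= M)%N ->
      (forall j, f j = omap P (insub (j : nat))) -> (forall j, f j = omap Q (insub (j : nat))) ->
      (k' <= k)%N.
    move=> kM hP hQ; rewrite leqNgt; apply/negP => kk.
    have := hP (Ordinal (leq_trans kk kM)); rewrite hQ /=.
    by rewrite [in RHS]insubN -?leqNgt// insubT.
  by apply/eqP; rewrite eqn_leq (lt _ _ _ _ mM hf' hf) (lt _ _ _ _ mM' hf hf').
subst m'.
have hij i : (vl (src (gam i)), vl (tgt (gam i))) = (wl (src (del i)), wl (tgt (del i))).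
  have := hf (widen_ord mM i); rewrite hf' /= valK.
  by move=> [-> ->].
have hs i : vl (src (gam i)) = wl (src (del i)) by have [] := hij i.
have ht i : vl (tgt (gam i)) = wl (tgt (del i)) by have [] := hij i.
have [fv hfv] := choice (code_vertex bg hs ht).
have [fw hfw] := choice (code_vertex bd (fun i => esym (hs i)) (fun i => esym (ht i))).
have fK : cancel fv fw by move=> v; apply: vI; rewrite hfw hfv.
have fK' : cancel fw fv by move=> v; apply: wI; rewrite hfv hfw.
have hs' i : src (del i) = fv (src (gam i)) by apply: wI; rewrite hfv hs.
have ht' i : tgt (del i) = fv (tgt (gam i)) by apply: wI; rewrite hfv ht.
have [gam' gK gK'] := bg; have [del' dK dK'] := bd.
exists fv, (del \o gam'); split.
- by exists fw.
- by exists (gam \o del') => x /=; rewrite ?dK ?gK' ?gK ?dK'.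
- by move=> e; left; rewrite /= hs' ht' gK'.
- move=> e; rewrite /= -[in RHS](gK' e).
  by rewrite (same_lengths gK gK' dK dK' lG lH dg dd (can_inj fK) hs' ht' iso).
Qed.

End Codes.

(** * The number of edges *)
Section EdgeBound.
Context {R : realType}.

Section Numbered.
Variable G : qgraph R.

Let gam : 'I_(#|edge G|) -> edge G := enum_val.
Let gam' : edge G -> 'I_(#|edge G|) := enum_rank.
Let gK : cancel gam gam'. Proof. exact: enum_valK. Qed.
Let gK' : cancel gam' gam. Proof. exact: enum_rankK. Qed.

Definition gcoef (x : R) : R :=
  coef (sec_weight (bond_scat (nbond gam))) (sec_len (bond_len (nbond gam))) x.

Definition bond_total : R := \sum_i bond_len (nbond gam) i.

Lemma bond_totalE : bond_total = 2 * total_length G.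
Proof.
rewrite /bond_total (reindex (nbond' gam')) /=; last first.
  by exists (nbond gam) => x _; [exact: nbondK'|exact: nbondK].
rewrite (eq_bigr (fun b : bond G => len b.1)); last first.
  by move=> b _; rewrite /bond_len (nbondK' gK').
by rewrite sum_bond /= -/(total_length G); ring.
Qed.

Hypothesis lG : leafless G.

(** The length of the shortest configurations is taken, with [K] empty; the bounce
    on any edge is a configuration, which bounds it from above. *)
Lemma first_frequency : exists a, [/\ 0 < a, gcoef a != 0,
  forall x, 0 < x < a -> gcoef x = 0 & forall e : edge G, a <= 2 * len e].
Proof.
have e0 : edge G by have := card_edge_ge2 lG; case: (pickP (edge G)) => // h; rewrite eq_card0.
have onto j : exists i, nedge i = j :> 'I_(#|edge G|).
  by exists (enum_rank (j, true)); rewrite /nedge enum_rankK.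
have l0 := nlen_gt0 gam.
have KT : finset.set0 != [set: 'I_(#|edge G|)]%SET.
  by apply/eqP => /setP/(_ (gam' e0)); rewrite !inE.
have [c hc] := shortest_ex (@nrevK _) (@nedge_rev _) onto (nfollows_rev gam) (nlen gam) KT.
have [cc nc hmin] := hc.
pose T i j := bond_scat (nbond gam) i j.
have out := @nscat_out _ R G gam.
have c0 : 0 < clen (@nedge _) (nlen gam) c.
  move: nc; rewrite negb_forall => /existsP[b]; rewrite negb_imply => /andP[bA _].
  by rewrite /clen (bigD1 b)//= ltr_pwDl ?sumr_ge0// => i _; exact: ltW.
have gE x : 0 < x -> gcoef x = outer_coef (@nedge _) T (nlen gam) finset.set0 x.
  by move=> x0; rewrite -lcoef_outer0.
exists (clen (@nedge _) (nlen gam) c); split => //.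
- rewrite gE// lt_eqF//; apply: (outer_coef_lt0 (rv := @nrev _)) hc => //.
  + exact: nrevK.
  + exact: nrev_neq.
  + exact: nedge_rev.
  + exact: nfollows_rev.
  + exact: nfollows_trans.
  + exact: nscat_gt0 gK.
  + by move=> i; exact: nscat_rev_lt0.
- move=> x /andP[x0 xc]; rewrite gE//; exact: outer_coef_below hc xc.
- move=> e; pose i : 'I_(#|{: 'I_(#|edge G|) * bool}|) := enum_rank (gam' e, true).
  have -> : 2 * len e = clen (@nedge _) (nlen gam) (bounce (@nrev _) i).
    rewrite (clen_bounce (@nrev_neq _) (@nedge_rev _)).
    by rewrite /nlen /nedge enum_rankK gK'.
  apply: hmin.
    apply: config_bounce; [exact: nrevK|exact: nfollows_rev].
  by rewrite (inside_bounce (@nedge_rev _)) inE.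
Qed.

End Numbered.

Lemma gcoef_isospectral (G H : qgraph R) : isospectral G H -> gcoef G =1 gcoef H.
Proof.
move=> iso x; apply: spectral_coef iso x.
- exact: nbondK (@enum_valK _).
- exact: nbondK' (@enum_rankK _).
- exact: nbondK (@enum_valK _).
- exact: nbondK' (@enum_rankK _).
Qed.

Lemma bond_total_isospectral (G H : qgraph R) : isospectral G H ->
  bond_total G = bond_total H.
Proof.
move=> iso; apply: sum_len_eq (gcoef_isospectral iso) => [||i|i].
- exact: bond_scat_orth (nbondK (@enum_valK _)) (nbondK' (@enum_rankK _)).
- exact: bond_scat_orth (nbondK (@enum_valK _)) (nbondK' (@enum_rankK _)).
- exact: bond_len_gt0.
- exact: bond_len_gt0.
Qed.

(** The spectrum bounds the number of edges: the total length and the lowest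
    frequency are determined by it. *)
Lemma isospectral_edges (G : qgraph R) : leafless G ->
  exists M, forall H, leafless H -> isospectral G H -> (#|edge H| <= M)%N.
Proof.
move=> lG; have [a [a0 ca za _]] := first_frequency lG.
exists (Num.truncn (bond_total G / a)) => H lH iso.
have [b [b0 cb zb hb]] := first_frequency lH.
have ab : a <= b.
  rewrite leNgt; apply: contra cb => ba.
  by rewrite -(gcoef_isospectral iso) za ?b0.
have tot : #|edge H|%:R * a <= bond_total G.
  rewrite (bond_total_isospectral iso) bond_totalE /total_length mulr_sumr.
  rewrite mulr_natl -sumr_const; apply: ler_sum => e _.
  exact: le_trans ab (hb e).
have h : #|edge H|%:R <= bond_total G / a by rewrite ler_pdivlMr.
by rewrite truncn_ge_nat// (le_trans _ h).
Qed.

End EdgeBound.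

(** * Counting *)

Section Counting.
Context {R : realType}.

Lemma card_code M : #|{: code M}| = ((M * M).+1 ^ M)%N.
Proof. by rewrite card_ffun card_option card_prod !card_ord. Qed.

Lemma code_family (I : Type) (G : I -> qgraph R) M :
  (forall i, leafless (G i)) -> (forall i, #|edge (G i)| <= M)%N ->
  (forall i j, i <> j -> ~ qiso (G i) (G j)) ->
  (forall i j, isospectral (G i) (G j)) ->
  exists2 N, ([set: I] #= `I_N)%card & (N <= (M * M).+1 ^ M)%N.
Proof.
move=> lG eM ni iso.
have [F hF] := choice (fun i => code_ex (lG i) (eM i)).
pose g i : nat := enum_rank (F i).
have gI : injective g.
  move=> i j /val_inj/enum_rank_inj Fij; apply: contrapT => /ni; apply.
  by apply: code_qiso (lG i) (lG j) (iso i j) (hF i) _; rewrite Fij.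
have le : ([set: I] #<= `I_#|{: code M}|)%card.
  rewrite -(card_le_eql (inj_card_eq (in2W gI))).
  by apply: subset_card_le => _ [i _ <-] /=; exact: ltn_ord.
have [N hN] : finite_set [set: I] by apply: card_le_finite le _; exact: finite_II.
exists N => //; rewrite -card_code -card_le_II.
by rewrite -(card_le_eql hN).
Qed.

(** [M ^ 2 + 1 <= ell ^ 3 <= ell ^ 7] as [ell >= 2]. *)
Lemma code_count_le (ell : R) M : 2 <= ell -> M%:R <= ell ->
  ((M * M).+1 ^ M)%:R <= expR (7 * ell * ln ell).
Proof.
move=> l2 Ml; have l0 : 0 < ell by lra.
have M0 : 0 <= M%:R :> R by [].
have base : (M * M).+1%:R <= ell ^+ 7.
  rewrite -natr1 natrM; apply: (@le_trans _ _ (ell * ell + 1)); first by rewrite lerD2r; nra.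
  apply: (@le_trans _ _ (ell ^+ 3)); last by rewrite ler_weXn2l//; lra.
  by nra.
have lnE : ell = expR (ln ell) by rewrite lnK.
apply: (@le_trans _ _ ((ell ^+ 7) ^+ M)).
  by rewrite natrX lerXn2r// nnegrE ?exprn_ge0// ltW.
rewrite {1}lnE -!expRM_natl ler_expR.
have ln0 : 0 <= ln ell by rewrite ln_ge0//; lra.
have -> : 7 * ell * ln ell = ell * (7 * ln ell) by ring.
by rewrite ler_wpM2r// mulr_ge0.
Qed.

End Counting.

Theorem theorem1p1 (R : realType) :
  (forall ell : R, 0 < ell ->
   forall (I : Type) (G : I -> qgraph R),
     (forall i, leafless (G i)) ->
     (forall i, min_edge_length (G i) 1) ->
     (forall i, total_length (G i) = ell) ->
     (forall i j, i <> j -> ~ qiso (G i) (G j)) ->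
     (forall i j, isospectral (G i) (G j)) ->
     exists n : nat,
       ([set: I] #= `I_n)%card /\ n%:R <= expR (7 * ell * ln ell)) /\
  (forall (I : Type) (G : I -> qgraph R),
     (forall i, leafless (G i)) ->
     (forall i j, i <> j -> ~ qiso (G i) (G j)) ->
     (forall i j, isospectral (G i) (G j)) ->
     finite_set [set: I]).
Proof.
split=> [ell ell0 I G lG mG tG ni iso|I G lG ni iso].
  have [[i0]|nI] := pselect (inhabited I); last first.
    exists 0%N; split; last exact: expR_ge0.
    rewrite II0 card_eq0; apply/eqP/seteqP; split => // i _.
    by case: nI; exists.
  have edges i : #|edge (G i)|%:R <= ell.
    rewrite -(tG i) /total_length -sumr_const; apply: ler_sum => e _.
    have [/(_ e) h _] := mG i; apply: le_trans h _.
    by rewrite /counted_len; case: ifP => // _; have := len_gt0 e; lra.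
  (* There are at least two edges, and every edge has length at least 1. *)
  have ell2 : 2 <= ell.
    by apply: le_trans (edges i0); rewrite ler_nat; exact: card_edge_ge2.
  have trunc : (Num.truncn ell)%:R <= ell by rewrite -truncn_ge_nat// ltW.
  have eM i : (#|edge (G i)| <= Num.truncn ell)%N by rewrite truncn_ge_nat// ltW.
  have [N hN lN] := code_family lG eM ni iso.
  exists N; split => //; apply: le_trans (code_count_le ell2 trunc).
  by rewrite ler_nat.
have [[i0]|nI] := pselect (inhabited I); last first.
  by exists 0%N; rewrite II0 card_eq0; apply/eqP/seteqP; split => // i _; case: nI; exists.
have [M hM] := isospectral_edges (lG i0).
have [N hN _] := code_family lG (fun i => hM _ (lG i) (iso i0 i)) ni iso.
by exists N.
Qed.
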